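(* Let $s, m_1, m_2$ be integers such that $s \geq 0$ and $2 \leq m_1 \leq m_2$. Let $m = m_1 + m_2$ and $n = s + m$. Then $\mathrm{HOP}(2^{\langle s \rangle}, 2m_1, 2m_2)$ has a solution in each of the following cases: (i) $n \equiv 1 \pmod{2m}$; (ii) $m$ is odd and $n \equiv m \pmod{2m}$.
   Context: Generalized Honeymoon Oberwolfach Problem. Let $s\ge 0$, $t\ge 1$ and $m_1,\dots,m_t\ge 2$ be integers and $n=s+m_1+\dots+m_t$. $\mathrm{HOP}(2^{\langle s\rangle},2m_1,\dots,2m_t)$ asks whether $2n$ participants consisting of $n$ couples can be seated, over several nights, at $s$ tables of size $2$ and $t$ round tables of sizes $2m_1,\dots,2m_t$ (all tables full each night) so that each participant sits next to their spouse every night and next to every other participant exactly once. Formally: let $I$ be a fixed $1$-factor (perfect matching) of the complete graph $K_{2n}$. For an integer $\gamma\ge 1$, $K_{2n}+(\gamma-1)I$ is the multigraph obtained from $K_{2n}$ by adjoining $\gamma-1$ additional parallel copies of each edge of $I$; all copies of edges of $I$ are called $I$-edges and the other edges non-$I$-edges. A $(K_2^{\langle s\rangle},C_{2m_1},\dots,C_{2m_t})$-factor is a spanning subgraph that is a vertex-disjoint union of $s$ copies of $K_2$ and $t$ cycles of lengths $2m_1,\dots,2m_t$; it is $I$-alternating if along every one of its cycles $I$-edges and non-$I$-edges alternate and each of its $K_2$ components is an $I$-edge. $\mathrm{HOP}(2^{\langle s\rangle},2m_1,\dots,2m_t)$ has a solution if and only if, for some $\gamma\geq 1$ (necessarily $\gamma=2n(n-1)/(m_1+\dots+m_t)$),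 the edge set of $K_{2n}+(\gamma-1)I$ can be partitioned into the edge sets of $I$-alternating $(K_2^{\langle s\rangle},C_{2m_1},\dots,C_{2m_t})$-factors. *)

(* Defs.v *)
From mathcomp Require Import all_boot.

Set Implicit Arguments.
Unset Strict Implicit.
Unset Printing Implicit Defensive.

Definition one_factor (V : finType) (I : {set {set V}}) : Prop :=
  partition I [set: V] /\ {in I, forall e : {set V}, #|e| = 2}.

(* An edge of a multigraph on V is a pair (e, k): the set e of its two ends and
   a label k telling parallel edges apart. *)
Notation medge V g := ({set V} * 'I_g)%type.

(* The edge set of K_V + (g - 1) I: every edge of I occurs with all g labels,
   every other edge of the complete graph only with label 0. *)
Definition complete_plus (V : finType) (g : nat) (I : {set {set V}}) :
    {set medge V g} :=
  [set e : medge V g | (#|e.1| == 2) && ((e.1 \in I) || (e.2 == 0 :> nat))].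

Section Factors.
Variables (V : finType) (g : nat).
Implicit Types (I : {set {set V}}) (C F : {set medge V g}).

(* Subgraphs without isolated vertices are identified with their edge sets. *)
Definition verts F : {set V} := \bigcup_(e in F) e.1.

Definition is_K2 C : Prop := exists2 e : medge V g, #|e.1| = 2 & C = [set e].

(* c lists the vertices and es the edges met when going once around a cycle:
   the i-th edge joins the i-th vertex to the next one, cyclically. *)
Definition traverses (c : seq V) (es : seq (medge V g)) : bool :=
  [&& 2 < size c, uniq c
    & [seq e.1 | e <- es] == [seq [set p.1; p.2] | p <- zip c (rot 1 c)]].

Definition is_cycle (l : nat) C : Prop :=
  exists (c : seq V) (es : seq (medge V g)),
    [/\ traverses c es, size c = l & C = [set:: es]].

(* The choice of traversal is immaterial: a cycle has only one up to rotation
   and reversal, which preserve alternation. *)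
Definition alternating_cycle I C : Prop :=
  exists (c : seq V) (es : seq (medge V g)),
    [/\ traverses c es, C = [set:: es]
      & cycle (fun e f : medge V g => (e.1 \in I) != (f.1 \in I)) es].

(* The components D exhibit F as a spanning vertex-disjoint union of s copies
   of K_2 and of cycles of lengths 2 m, for m in ms. *)
Definition factor_components (s : nat) (ms : seq nat)
    (D : 'I_s + 'I_(size ms) -> {set medge V g}) F : Prop :=
  [/\ forall i : 'I_s, is_K2 (D (inl i)),
      forall j : 'I_(size ms), is_cycle (2 * nth 0 ms j) (D (inr j)),
      forall x y, x != y -> [disjoint verts (D x) & verts (D y)],
      F = \bigcup_x D x
    & verts F = [set: V]].

Definition alternating_factor (s : nat) (ms : seq nat) I F : Prop :=
  F \subset complete_plus g I /\
  exists D : 'I_s + 'I_(size ms) -> {set medge V g},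
    [/\ factor_components D F,
        forall i : 'I_s, {in D (inl i), forall e, e.1 \in I}
      & forall j : 'I_(size ms), alternating_cycle I (D (inr j))].

End Factors.

(* HOP(2^<s>, 2 m_1, ..., 2 m_t) has a solution, for ms = [:: m_1; ...; m_t].
   All 1-factors of a complete graph are isomorphic, so the fixed I may be
   taken arbitrary. *)
Definition HOP_solvable (s : nat) (ms : seq nat) : Prop :=
  forall I : {set {set 'I_(2 * (s + sumn ms))}}, one_factor I ->
  exists2 g : nat, 1 <= g &
  exists2 P : {set {set medge 'I_(2 * (s + sumn ms)) g}},
    partition P (complete_plus g I) &
    {in P, forall F, alternating_factor s ms I F}.

(* Main.v *)
Require Import Defs.
From HB Require Import structures.
From mathcomp Require Import all_boot all_order all_algebra.
From mathcomp Require Import zify ring.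

(** A cycle of an alternating factor runs through each of its couples along the
I-edge of the couple.  It is therefore known from the list of the ends through
which it leaves its couples: from an end it crosses to the spouse of the next
end in the list ([darts]).  A night is a pair of such lists, and the couples that
occur in neither sit at the small tables.  Let a list of nights have as many
crossings in total as K_2n has edges outside I.  Then it is enough that any two
people who are not spouses meet at some night: by counting, no meeting is
repeated, and because every night uses one copy of every I-edge, the nights
partition the multigraph ([solution_exists], [family_solves]).  So the problem is
one of covering all pairs.

Let n = 2mk + 1.  The couples are the residues modulo n, and 4k base nights are
rotated by all residues; they have to cover the differences 1, ..., mk of
couples, each with all four choices of ends ([cyclic_solution]).  The cycles are
ladders: a zigzag path with decreasing step lengths, its translate by some c, and
a connection of the two at both ends.  If the connection is a single edge, a
rung, then it has difference c; if it passes through one more couple, a cap, then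
the two edges can be given the differences p and p + c.  Both arms of a ladder
have the same differences, and so two nights sharing a path cover all the
differences of its steps, provided that the ends are chosen well ([orth],
[doubles_cover]).  An even cycle has two rungs, an odd one a rung and a cap.  What
remains is to divide 1, ..., mk into intervals for the steps, shifts, and triples
p, a, p + a; for the triples one needs Skolem sequences ([skolem]), or sequences
in which each difference occurs twice ([twofold_skolem]).  A cycle of length four
is added to the other cycle of its night wherever there is room ([with_digons]).

Let n = m (2k + 1) with m odd.  The couples are the pairs of a residue modulo m
and one modulo 2k + 1.  The pairs with different second components are covered by
ladders whose zigzags alternate between two layers ([multipartite_block]).  The
pairs with equal second components are left to solutions of the case n = m
([multipartite_solution]).  In this case one couple is fixed and 2N people, where
N = m - 1, sit on a circle opposite to their spouses.  A single night is rotated,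
and it has to contain every circular distance 1, ..., N - 1 ([starter_family]).
Such a night is assembled from graceful paths, which have steps of all lengths
1, 2, ..., each once; they exist with a prescribed start, by nesting short ones
([alpha_exists]).  If the odd cycle is short, it is made of a path closed up
around a small gap; the even cycle, which contains the fixed couple, passes through
the gap and around it ([odd_small]).  If it is long, then it is the one that passes around the even
cycle ([odd_large], [odd_digon]).  The six remaining pairs of lengths are given
explicitly. *)

Set Implicit Arguments.
Unset Strict Implicit.
Unset Printing Implicit Defensive.

Import GRing.Theory.

(** * Crossings between couples *)

(** The I-edges of the tour are implicit: only the crossings from one couple to
the next are listed. *)
Definition darts (V : Type) (sp : V -> V) (us : seq V) : seq (V * V) :=
  zip us (map sp (rot 1 us)).

Section Seating.
Variables (V : eqType) (sp : V -> V).
Local Notation darts := (darts sp).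

Definition seats m1 m2 (F : seq V * seq V) : bool :=
  [&& size F.1 == m1, size F.2 == m2
    & uniq ((F.1 ++ F.2) ++ map sp (F.1 ++ F.2))].

Definition joined (us : seq V) (u v : V) : bool :=
  ((u, v) \in darts us) || ((v, u) \in darts us).

Definition meets (F : seq V * seq V) (u v : V) : bool :=
  joined F.1 u v || joined F.2 u v.

Lemma joinedC us u v : joined us u v = joined us v u.
Proof. by rewrite /joined orbC. Qed.

Lemma size_darts us : size (darts us) = size us.
Proof. by rewrite size_zip size_map size_rot minnn. Qed.

Lemma dart_next (s1 : seq V) (u v : V) (s2 : seq V) : (u, sp v) \in darts (s1 ++ u :: v :: s2).
Proof.
have szE : size (s1 ++ u :: v :: s2) = (size s1 + (size s2).+2)%N.
  by rewrite size_cat.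
suff -> : (u, sp v) = nth (u, u) (darts (s1 ++ u :: v :: s2)) (size s1).
  by apply: mem_nth; rewrite size_darts szE; lia.
rewrite nth_zip ?size_map ?size_rot //.
rewrite nth_cat ltnn subnn /= (nth_map u) ?size_rot ?szE; last by lia.
congr (_, sp _).
rewrite /rot nth_cat size_drop szE.
case: ltnP => [_|]; last by lia.
by rewrite nth_drop nth_cat add1n ltnNge leqnSn /= subSnn.
Qed.

Lemma dart_last (u : V) (s : seq V) : (last u s, sp u) \in darts (u :: s).
Proof.
have szE : size (u :: s) = (size s).+1 by [].
suff -> : (last u s, sp u) = nth (u, u) (darts (u :: s)) (size s).
  by apply: mem_nth; rewrite size_darts szE.
rewrite nth_zip ?size_map ?size_rot // (nth_map u) ?size_rot //.
rewrite /rot nth_cat size_drop /= drop0 subn1 /= ltnn subnn /=.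
by rewrite nth_last.
Qed.

Lemma mem_darts us a b : uniq us -> 1 < size us -> (a, b) \in darts us ->
  exists2 v, [/\ a \in us, v \in us & v != a] & b = sp v.
Proof.
move=> Uus szus; have [z zus] : exists z, z \in us.
  by case: us szus {Uus} => // z us; exists z; rewrite mem_head.
case/(nthP (z, z)) => i; rewrite size_darts => ltis.
rewrite nth_zip ?size_map ?size_rot // (nth_map z) ?size_rot // => -[<- <-].
exists (nth z (rot 1 us) i) => //; rewrite mem_nth //; split=> //.
  by have := @mem_nth _ z (rot 1 us) i; rewrite size_rot mem_rot; apply.
move: {zus} z => z.
case: us szus Uus ltis => [|x s] //= szs /andP[xs Us] ltis; rewrite rot1_cons.
rewrite nth_rcons; case: ltnP => [lti|gei].
  case: i lti {ltis} => [|i] lti /=.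
    by apply: contraNneq xs => E; rewrite -E mem_nth.
  by rewrite nth_uniq ?gtn_eqF // ltnW.
have -> : i = size s by apply/eqP; rewrite eqn_leq gei -ltnS ltis.
rewrite eqxx (_ : nth z (x :: s) (size s) = last x s); last by rewrite nth_last.
apply: contraNneq xs => ->.
by case: s szs {Us gei ltis} => [|y s] //= _; apply: mem_last.
Qed.

End Seating.

(** * The factor of a night *)

Section Tour.
Variables (T : finType) (pt : T -> T).
Hypothesis ptK : involutive pt.
Hypothesis pt_neq : forall x, pt x != x.

Definition tour (us : seq T) : seq T := flatten [seq [:: pt u; u] | u <- us].

Lemma size_tour us : size (tour us) = 2 * size us.
Proof. by elim: us => //= u us IH; rewrite /tour /= -/(tour us) IH mulnS. Qed.

Lemma perm_tour us : perm_eq (tour us) (us ++ map pt us).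
Proof.
elim: us => //= u us IH; rewrite /tour /= -/(tour us).
apply/permP => a; move/permP/(_ a): IH; rewrite /= !count_cat /= => ->; lia.
Qed.

Lemma tour_zip u us z :
  zip (tour (u :: us)) (rcons (behead (tour (u :: us))) z) =
  flatten [seq [:: (pt d.1, d.1); (d.1, d.2)]
          | d <- zip (u :: us) (rcons (map pt us) z)].
Proof. by elim: us u => [|v us IH] u //=; rewrite -IH. Qed.

Lemma tour_rot us :
  zip (tour us) (rot 1 (tour us)) =
  flatten [seq [:: (pt d.1, d.1); (d.1, d.2)] | d <- darts pt us].
Proof.
case: us => [|u us] //; rewrite /darts rot1_cons map_rcons -tour_zip.
by rewrite (_ : tour (u :: us) = pt u :: u :: tour us) // rot1_cons.
Qed.

Variables (I : {set {set T}}) (g : nat) (i o : 'I_g).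
Hypothesis I_pair : forall x, [set pt x; x] \in I.

(** All I-edges get the label [i] of the night and the others the only label that
they have. *)
Definition tour_edges (us : seq T) : seq (medge T g) :=
  flatten [seq [:: ([set pt d.1; d.1], i); ([set d.1; d.2], o)]
          | d <- darts pt us].

Lemma tour_traverses us : 1 < size us -> uniq (us ++ map pt us) ->
  traverses (tour us) (tour_edges us).
Proof.
move=> szus Uus; apply/and3P; split; first by rewrite size_tour; lia.
  by rewrite (perm_uniq (perm_tour us)).
rewrite tour_rot /tour_edges; apply/eqP.
by elim: (darts pt us) => //= d ds ->.
Qed.

Lemma tour_alternates us :
    (forall d, d \in darts pt us -> [set d.1; d.2] \notin I) ->
  cycle (fun e f : medge T g => (e.1 \in I) != (f.1 \in I)) (tour_edges us).
Proof.
rewrite /tour_edges; case: (darts pt us) => // d ds nI.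
set R := fun e f => _; set es := flatten _.
have path_es f : f.1 \notin I -> path R f es.
  rewrite {}/es; elim: {d ds} (d :: ds) nI f => //= d ds IH nI f nIf.
  rewrite /R /= (negPf nIf) I_pair (negPf (nI d (mem_head _ _))) /=.
  apply: IH => [e eds|]; last by rewrite /= nI ?mem_head.
  by apply: nI; rewrite in_cons eds orbT.
rewrite (cycle_path ([set d.1; d.2], o)); apply: path_es.
rewrite {}/es {R}; elim/last_ind: ds nI => [|ds e _] nI /=.
  by apply: (nI d); rewrite mem_head.
rewrite map_rcons flatten_rcons last_cat /=.
by apply: (nI e); rewrite -rcons_cons mem_rcons mem_head.
Qed.

Lemma mem_tour_edges us e : (e \in tour_edges us) =
  has (fun d => (e == ([set pt d.1; d.1], i)) || (e == ([set d.1; d.2], o)))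
      (darts pt us).
Proof.
rewrite /tour_edges; elim: (darts pt us) => //= d ds IH.
by rewrite !in_cons IH orbA.
Qed.

End Tour.

Section Mates.
Variables (T : finType) (I : {set {set T}}).
Hypothesis factorI : one_factor I.

Definition mate (x : T) : T := odflt x [pick y in pblock I x :\ x].

Lemma mate_pblock x : mate x != x /\ pblock I x = [set mate x; x].
Proof.
have [/and3P[/eqP covI _ _] card2] := factorI.
have xI : x \in cover I by rewrite covI.
have /cards2P [y [z [yz def]]] : #|pblock I x| == 2.
  by rewrite card2 ?pblock_mem.
have xb : x \in pblock I x by rewrite mem_pblock.
rewrite /mate; case: pickP => [w|none] /=.
  rewrite !inE => /andP[wx wb]; split=> //.
  apply/eqP; rewrite eq_sym eqEcard subUset !sub1set wb xb cards2 wx.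
  by rewrite def cards2 yz.
move: xb; rewrite def !inE => /orP[]/eqP E.
  by have := none z; rewrite !inE def E !inE eqxx orbT eq_sym yz.
by have := none y; rewrite !inE def E !inE eqxx yz.
Qed.

Lemma mate_neq x : mate x != x. Proof. by case: (mate_pblock x). Qed.

Lemma mate_pair x : [set mate x; x] \in I.
Proof.
have [/and3P[/eqP covI _ _] _] := factorI.
by case: (mate_pblock x) => _ <-; rewrite pblock_mem // covI.
Qed.

Lemma mem_factor e x : e \in I -> x \in e -> e = [set mate x; x].
Proof.
have [/and3P[_ tI _] _] := factorI; move=> eI xe.
by case: (mate_pblock x) => _ <-; rewrite (def_pblock tI eI xe).
Qed.

Lemma mateK : involutive mate.
Proof.
move=> x; have := mem_factor (mate_pair x) (set21 _ _).
move/setP/(_ x); rewrite !inE eqxx orbT => /esym/orP[/eqP //|/eqP E].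
by have := mate_neq x; rewrite -E eqxx.
Qed.

Lemma card_factor : #|T| = 2 * #|I|.
Proof.
have [pI card2] := factorI.
by rewrite -cardsT (card_uniform_partition card2 pI) mulnC.
Qed.

End Mates.

Lemma uniq_flatten_index (A : eqType) (ss : seq (seq A)) i j x :
  uniq (flatten ss) -> i < size ss -> j < size ss ->
  x \in nth [::] ss i -> x \in nth [::] ss j -> i = j.
Proof.
elim: ss i j => //= s ss IH [|i] [|j] //=; rewrite cat_uniq => /and3P[_ /hasPn n U].
- move=> _ ltj xs xj; have /n : x \in flatten ss.
    by apply/flattenP; exists (nth [::] ss j); rewrite ?mem_nth.
  by rewrite /= xs.
- move=> lti _ xi xs; have /n : x \in flatten ss.
    by apply/flattenP; exists (nth [::] ss i); rewrite ?mem_nth.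
  by rewrite /= xs.
- by move=> lti ltj xi xj; rewrite (IH i j).
Qed.

Section Solution.
Variables (T : finType) (I : {set {set T}}) (s m1 m2 : nat).
Variable Fs : seq (seq T * seq T).
Local Notation n := (s + (m1 + m2)).
Local Notation pt := (mate I).
Local Notation g := (size Fs).
Hypotheses (factorI : one_factor I) (m1_gt1 : 1 < m1) (m2_gt1 : 1 < m2).
Hypothesis cardT : #|T| = 2 * n.
Hypothesis count : g * (m1 + m2) = 2 * n * n.-1.
Hypothesis seatsFs : all (seats pt m1 m2) Fs.
Hypothesis meetFs :
  forall u v, v != u -> v != pt u -> has (fun F => meets pt F u v) Fs.

Let F_ i := nth ([::], [::]) Fs i.

Definition links (us : seq T) : seq {set T} :=
  [seq [set d.1; d.2] | d <- darts pt us].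

Definition all_links : seq (seq {set T}) :=
  [seq links F.1 ++ links F.2 | F <- Fs].

Definition foreign : {set {set T}} := [set e : {set T} | #|e| == 2] :\: I.

Lemma set2_foreign u v : ([set u; v] \in foreign) = (v != u) && (v != pt u).
Proof.
rewrite !inE cards2 eqSS eqb1 andbC [u == v]eq_sym; case: eqVneq => //= vu.
congr (~~ _); apply/idP/eqP => [uvI|->].
  have := mem_factor factorI uvI (set21 _ _) => /setP/(_ v).
  by rewrite !inE eqxx orbT (negPf vu) orbF => /esym/eqP.
by rewrite setUC (mate_pair factorI).
Qed.

Lemma card_foreign : #|foreign| = 2 * n * n.-1.
Proof.
have subI : I \subset [set e : {set T} | #|e| == 2].
  by apply/subsetP=> e eI; rewrite inE; apply/eqP; exact: (proj2 factorI) e eI.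
rewrite cardsD (setIidPr subI) card_draws bin2 cardT.
have := card_factor factorI; rewrite cardT => /eqP; rewrite eqn_pmul2l // => /eqP <-.
by case: (s + _) (m1_gt1) => [|k] _ //=; lia.
Qed.

Lemma links_seated F : F \in Fs ->
  [/\ {subset links F.1 <= foreign}, {subset links F.2 <= foreign},
      size (links F.1) = m1 & size (links F.2) = m2].
Proof.
move/(allP seatsFs) => /and3P[/eqP sz1 /eqP sz2 U].
rewrite !size_map !size_darts sz1 sz2.
have Upts (us vs : seq T) : perm_eq (F.1 ++ F.2) (us ++ vs) -> 1 < size us ->
    {subset links us <= foreign}.
  move=> pe szus e /mapP[[u w] uw ->] /=; rewrite set2_foreign.
  have U' : uniq ((us ++ vs) ++ map pt (us ++ vs)).
    by rewrite -(perm_uniq (perm_cat pe (perm_map pt pe))).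
  have Uus : uniq us by move: U'; rewrite !cat_uniq => /andP[/andP[]].
  have [v [uus vus vu] ->] := mem_darts Uus szus uw.
  rewrite (inj_eq (inv_inj (mateK factorI))) vu andbT.
  apply: contraTneq U' => E; rewrite cat_uniq negb_and; apply/orP; right.
  rewrite negb_and; apply/orP; left; rewrite negbK; apply/hasP.
  by exists u; rewrite ?mem_cat ?uus // -E map_cat mem_cat map_f.
split=> //; first by apply: (Upts F.1 F.2) => //; rewrite sz1.
by apply: (Upts F.2 F.1); rewrite ?sz2 // perm_catC.
Qed.

(** The nights have as many links in total as there are edges outside I.  As every
such edge is met, there is no room for a repetition. *)
Lemma links_uniq : uniq (flatten all_links).
Proof.
have sub : {subset enum foreign <= flatten all_links}.
  move=> e; rewrite mem_enum => ef.
  have /cards2P [u [v [uv def]]] : #|e| == 2 by move: ef; rewrite !inE => /andP[].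
  move: ef; rewrite def set2_foreign => /andP[vu vpu].
  have /hasP[F FFs mF] := meetFs vu vpu.
  apply/flattenP; exists (links F.1 ++ links F.2); first exact: map_f.
  rewrite mem_cat; case/orP: mF => /orP[] m; apply/orP.
  - by left; apply/mapP; exists (u, v).
  - by left; apply/mapP; exists (v, u) => //; rewrite setUC.
  - by right; apply/mapP; exists (u, v).
  - by right; apply/mapP; exists (v, u) => //; rewrite setUC.
rewrite (leq_size_uniq (enum_uniq _) sub) //.
rewrite -cardE card_foreign -count.
suff szL gs : {subset gs <= Fs} ->
    size (flatten [seq links F.1 ++ links F.2 | F <- gs]) = size gs * (m1 + m2).
  by rewrite szL.
elim: gs => //= F gs IH sub'; rewrite !size_cat IH => [|G Ggs]; last first.
  by apply: sub'; rewrite in_cons Ggs orbT.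
have [_ _ -> ->] := links_seated (sub' F (mem_head _ _)); lia.
Qed.

Lemma g_gt0 : 0 < g.
Proof. by case: g count => // /esym/eqP; rewrite !muln_eq0 /=; lia. Qed.

Let o : 'I_g := Ordinal g_gt0.

(** The parallel copies of an I-edge are spread over the nights, one for each. *)
Definition night (i : 'I_g) : {set medge T g} :=
  [set e : medge T g | (e.1 \in I) && (e.2 == i)] :|:
  [set e : medge T g | (e.1 \in links (F_ i).1 ++ links (F_ i).2) && (e.2 == o)].

Lemma mem_F_ (i : 'I_g) : F_ i \in Fs.
Proof. exact: mem_nth. Qed.

Lemma links_foreign (i : 'I_g) e :
  e \in links (F_ i).1 ++ links (F_ i).2 -> e \in foreign.
Proof.
have [sub1 sub2 _ _] := links_seated (mem_F_ i).
by rewrite mem_cat => /orP[/sub1|/sub2].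
Qed.

Lemma nth_all_links (i : 'I_g) :
  nth [::] all_links i = links (F_ i).1 ++ links (F_ i).2.
Proof. exact: (nth_map ([::], [::])). Qed.

Lemma nights_partition :
  partition [set night i | i : 'I_g] (complete_plus g I).
Proof.
have I0 : exists e, e \in I.
  have := card_factor factorI; rewrite cardT => /eqP; rewrite eqn_pmul2l //.
  move=> /eqP cI; have : 0 < #|I| by lia.
  by move/card_gt0P.
have dis : forall i j, i \in 'I_g -> j \in 'I_g -> j != i ->
    [disjoint night i & night j].
  move=> i j _ _ ij; apply/pred0P=> e /=; apply/negbTE/negP.
  rewrite !inE; case/andP=> /orP[]/andP[e1 /eqP e2] /orP[]/andP[e3 /eqP e4].
  - by rewrite -e2 -e4 eqxx in ij.
  - by have := links_foreign e3; rewrite inE e1.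
  - by have := links_foreign e1; rewrite inE e3.
  - case/eqP: ij; apply: ord_inj.
    apply: (@uniq_flatten_index _ all_links j i e.1 links_uniq);
      rewrite ?size_map ?ltn_ord ?nth_all_links //.
have n0 : set0 \notin [set night i | i : 'I_g].
  apply/imsetP=> -[i _ /esym E]; case: I0 => e eI.
  by have := in_set0 ((e, i) : medge T g); rewrite -E !inE /= eI eqxx.
have [triv _] := trivIimset dis n0.
rewrite /partition triv n0 !andbT; apply/eqP/setP=> e.
rewrite cover_imset; apply/bigcupP/idP => [[i _]|].
  rewrite !inE => /orP[]/andP[e1 /eqP e2].
    by rewrite e1 ((proj2 factorI) _ e1).
  by have := links_foreign e1; rewrite !inE e2 /= => /andP[_ ->]; rewrite orbT.
rewrite inE => /andP[c2]; case: (boolP (e.1 \in I)) => [eI _|neI /= e0].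
  by exists e.2; rewrite // !inE eI eqxx.
have eo : e.2 == o by apply/eqP/val_inj/eqP.
have /cards2P [u [v [uv def]]] := c2.
have : e.1 \in foreign by rewrite !inE neI.
rewrite def set2_foreign => /andP[vu vpu].
have /hasP[F FFs mF] := meetFs vu vpu.
have ltF : index F Fs < g by rewrite index_mem.
exists (Ordinal ltF) => //; rewrite !inE eo andbT; apply/orP; right.
rewrite /F_ /= nth_index // mem_cat def.
case/orP: mF => /orP[] m; apply/orP.
- by left; apply/mapP; exists (u, v).
- by left; apply/mapP; exists (v, u) => //; rewrite setUC.
- by right; apply/mapP; exists (u, v).
- by right; apply/mapP; exists (v, u) => //; rewrite setUC.
Qed.

Section Components.
Variable i : 'I_g.
Let us1 := (F_ i).1.
Let us2 := (F_ i).2.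
Let us := us1 ++ us2.
Let couple u := [set pt u; u].
Let rest := I :\: [set couple u | u in us].
Let D (x : 'I_s + 'I_(size [:: m1; m2])) : {set medge T g} :=
  match x with
  | inl k => [set (nth set0 (enum rest) k, i)]
  | inr j => [set:: tour_edges pt i o (nth [::] [:: us1; us2] j)]
  end.

Let seated : [/\ size us1 = m1, size us2 = m2 & uniq (us ++ map pt us)].
Proof. by have /and3P[/eqP ? /eqP ?] := allP seatsFs _ (mem_F_ i). Qed.

Let ptK := mateK factorI.
Let pt_neq := mate_neq factorI.
Let pairI := mate_pair factorI.

Lemma couple_inj : {in us &, injective couple}.
Proof.
case: seated => _ _; rewrite cat_uniq => /and3P[_ /hasPn nus _] u v uus vus E.
have := set22 (pt u) u; rewrite -/(couple u) E !inE => /orP[]/eqP // uv.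
by have := nus u; rewrite uv map_f // => /(_ isT); rewrite /= -uv uus.
Qed.

Lemma card_rest : #|rest| = s.
Proof.
have [sz1 sz2 U] := seated.
have sub : [set couple u | u in us] \subset I.
  by apply/subsetP=> _ /imsetP[u _ ->]; apply: pairI.
rewrite cardsD (setIidPr sub) (card_in_imset couple_inj).
have /card_uniqP -> : uniq us by move: U; rewrite cat_uniq => /andP[].
have := card_factor factorI; rewrite cardT size_cat sz1 sz2; lia.
Qed.

Lemma mem_nth_rest (k : 'I_s) : nth set0 (enum rest) k \in rest.
Proof. by rewrite -mem_enum mem_nth // -cardE card_rest. Qed.

Lemma seated_cycle (j : 'I_(size [:: m1; m2])) :
  let vs := nth [::] [:: us1; us2] j in
  [/\ size vs = nth 0 [:: m1; m2] j, {subset vs <= us},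
      uniq (vs ++ map pt vs) & {subset links vs <= foreign}].
Proof.
have [sz1 sz2] := seated; have [l1 l2 _ _] := links_seated (mem_F_ i).
rewrite !cat_uniq map_cat !has_cat !negb_or cat_uniq.
case/and3P=> /and3P[U1 _ U2] /andP[]; rewrite -!all_predC !all_predC.
move=> n1 n2 /and3P[V1 _ V2].
case: j => -[|[|//]] ltj /=; split=> //.
- by move=> v vv; rewrite mem_cat vv.
- rewrite cat_uniq U1 V1 andbT /=; apply: contra n1 => /hasP[v v1 v2].
  by apply/hasP; exists v; rewrite ?mem_cat // v2.
- by move=> v vv; rewrite mem_cat vv orbT.
- rewrite cat_uniq U2 V2 andbT /=; apply: contra n2 => /hasP[v v1 v2].
  by apply/hasP; exists v; rewrite ?mem_cat // v2 orbT.
Qed.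

Lemma darts1 (vs : seq T) u : u \in vs -> exists w, (u, w) \in darts pt vs.
Proof.
have {1}<- : unzip1 (darts pt vs) = vs.
  by rewrite unzip1_zip // size_map size_rot.
by case/mapP=> -[u' w] uw ->; exists w.
Qed.

Lemma mem_dart12 (vs : seq T) d :
  d \in darts pt vs -> (d.1 \in vs) && (pt d.2 \in vs).
Proof.
case: d => u w uw; apply/andP; split => /=.
  by rewrite -(@unzip1_zip _ _ vs (map pt (rot 1 vs))) ?size_map ?size_rot //
             (map_f fst uw).
have : w \in unzip2 (darts pt vs) by apply: (map_f snd uw).
rewrite unzip2_zip ?size_map ?size_rot // => /mapP[v].
by rewrite mem_rot => vvs ->; rewrite ptK.
Qed.

Lemma couple_edge (vs : seq T) u :
  u \in vs -> (couple u, i) \in [set:: tour_edges pt i o vs].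
Proof.
move=> uvs; have [w uw] := darts1 uvs.
rewrite inE mem_tour_edges; apply/hasP; exists (u, w) => //.
by apply/orP; left; apply/eqP.
Qed.

Lemma verts_cycle (vs : seq T) x :
  (x \in verts [set:: tour_edges pt i o vs]) = (x \in vs) || (pt x \in vs).
Proof.
apply/bigcupP/orP => [[e]|].
  rewrite inE mem_tour_edges => /hasP[d /mem_dart12 /andP[d1 d2]].
  case/orP=> /eqP -> /=; rewrite !inE => /orP[]/eqP ->; rewrite ?ptK; auto.
by case=> /couple_edge ee; eexists; try exact: ee; rewrite /= !inE ?ptK eqxx ?orbT.
Qed.

Lemma rest_alone k u : u \in us ->
  (u \notin nth set0 (enum rest) (k : 'I_s))
  /\ (pt u \notin nth set0 (enum rest) k).
Proof.
have := mem_nth_rest k; set e := nth _ _ _; rewrite inE => /andP[ne eI] uus.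
have nu : couple u != e.
  by apply: contra ne => /eqP <-; apply: imset_f.
split; apply: contra nu => ue; rewrite (mem_factor factorI eI ue) //.
by rewrite ptK setUC.
Qed.

(** The couples of [rest], which no cycle visits, are exactly as many as there are
small tables. *)
Lemma night_components : factor_components D (night i).
Proof.
have [sz1 sz2 U] := seated.
have vD (x : 'I_s + 'I_(size [:: m1; m2])) v : v \in verts (D x) ->
    match x with
    | inl k => v \in nth set0 (enum rest) k
    | inr j => let vs := nth [::] [:: us1; us2] j in (v \in vs) || (pt v \in vs)
    end.
  by case: x => [k|j] /=; rewrite ?verts_cycle // /verts big_set1.
have Dv v : exists x, v \in verts (D x).
  have vr : [|| couple v \in rest, v \in us | pt v \in us].
    case: (boolP (couple v \in rest)) => //=.
    rewrite inE pairI andbT negbK => /imsetP[u uus E].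
    by have := set22 (pt v) v; rewrite -/(couple v) E !inE => /orP[]/eqP ->;
      rewrite ?ptK uus ?orbT.
  have [/nthP-/(_ set0) [k]|] := boolP (couple v \in enum rest).
    rewrite -cardE card_rest => ltk E; exists (inl (Ordinal ltk)).
    by rewrite /= /verts big_set1 /= E !inE eqxx orbT.
  rewrite mem_enum => /negbTE nr; rewrite nr /= !mem_cat in vr.
  have lt0 : 0 < size [:: m1; m2] by [].
  have lt1 : 1 < size [:: m1; m2] by [].
  have [v1|v1] := boolP ((v \in us1) || (pt v \in us1)).
    by exists (inr (Ordinal lt0)); rewrite /= verts_cycle.
  exists (inr (Ordinal lt1)); rewrite /= verts_cycle.
  by move: v1 vr => /norP[/negbTE -> /negbTE ->].
have szj (j : 'I_(size [:: m1; m2])) : 1 < nth 0 [:: m1; m2] j.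
  by case: j => -[|[|//]].
split.
- move=> k; exists (nth set0 (enum rest) k, i) => //=.
  by have := mem_nth_rest k; rewrite inE => /andP[_ /(proj2 factorI)].
- move=> j; have [sz _ Uj _] := seated_cycle j.
  set vs := nth _ _ _ in sz Uj; exists (tour pt vs), (tour_edges pt i o vs).
  by rewrite tour_traverses ?size_tour ?sz.
- move=> x y xy; apply/pred0P=> v /=; apply/negbTE/negP => /andP[/vD vx /vD vy].
  case: x xy vx => [k|j]; case: y vy => [k'|j'] vy xy vx.
  + have := mem_nth_rest k; have := mem_nth_rest k'.
    rewrite !inE => /andP[_ eI'] /andP[_ eI].
    case/eqP: xy; congr inl; apply: ord_inj; apply/eqP.
    rewrite -(nth_uniq set0 _ _ (enum_uniq rest)) -?cardE ?card_rest //.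
    by rewrite (mem_factor factorI eI vx) (mem_factor factorI eI' vy).
  + have [_ sub _ _] := seated_cycle j'.
    by case/orP: vy => /sub /(rest_alone k)[]; rewrite ?ptK vx.
  + have [_ sub _ _] := seated_cycle j.
    by case/orP: vx => /sub /(rest_alone k')[]; rewrite ?ptK vy.
  + have dis w : (w \in us1) || (pt w \in us1) ->
        (w \in us2) || (pt w \in us2) -> False.
      move: U; rewrite map_cat => U.
      have : uniq ((us1 ++ map pt us1) ++ (us2 ++ map pt us2)).
        by rewrite (perm_uniq (_ : perm_eq _ ((us1 ++ us2) ++ (map pt us1 ++ map pt us2)))) //
          -!catA perm_cat2l !catA perm_cat2r perm_catC.
      rewrite cat_uniq => /and3P[_ /hasPn dd _].
      have P vs : (w \in vs) || (pt w \in vs) -> w \in vs ++ map pt vs.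
        by rewrite mem_cat => /orP[-> //|pw]; rewrite -[w]ptK map_f ?orbT.
      by move=> /P w1 /P /dd; rewrite /= w1.
    case: j j' vx vy xy => [[|[|//]]] ltj [[|[|//]]] ltj' /= vx vy xy;
      try by [].
    * exact: (dis v).
    * exact: (dis v).
- apply/setP=> e; rewrite !inE; apply/orP/bigcupP.
  + have H vs (j : 'I_(size [:: m1; m2])) : vs = nth [::] [:: us1; us2] j ->
        e.1 \in links vs -> e.2 == o -> exists2 x, true & e \in D x.
      move=> -> /mapP[d dd e1] /eqP e2; exists (inr j) => //=.
      rewrite inE mem_tour_edges; apply/hasP; exists d => //.
      by rewrite -e1 -e2 -surjective_pairing eqxx orbT.
    case=> /andP[e1 e2].
      have [v ve] : exists v, v \in e.1.
        by apply/card_gt0P; rewrite ((proj2 factorI) _ e1).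
      have De : e = (couple v, i).
        by rewrite [e]surjective_pairing (eqP e2) (mem_factor factorI e1 ve).
      have [[k|j] /[dup] /vD /= vx _] := Dv v.
        exists (inl k) => //=; have := mem_nth_rest k; rewrite inE => /andP[_ kI].
        by rewrite inE De (mem_factor factorI kI vx).
      exists (inr j) => //=; case/orP: vx => [/couple_edge|/couple_edge].
        by rewrite De.
      by rewrite De (_ : couple (pt v) = couple v) // /couple ptK setUC.
    have lt0 : 0 < size [:: m1; m2] by [].
    have lt1 : 1 < size [:: m1; m2] by [].
    move: e1; rewrite mem_cat => /orP[] e1.
      exact: (H us1 (Ordinal lt0)).
    exact: (H us2 (Ordinal lt1)).
  + case=> -[k|j] _ /=.
      rewrite inE => /eqP ->; left; rewrite /= eqxx andbT.
      by have := mem_nth_rest k; rewrite inE => /andP[].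
    rewrite inE mem_tour_edges => /hasP[d dd /orP[]/eqP ->] /=.
      by left; rewrite pairI eqxx.
    right; rewrite eqxx andbT mem_cat.
    by case: j dd => -[|[|//]] ltj dd; apply/orP; [left|right]; apply/mapP; exists d.
- apply/setP=> v; rewrite inE; apply/bigcupP; exists (couple v, i).
    by rewrite !inE pairI eqxx.
  by rewrite /= !inE eqxx orbT.
Qed.

Lemma night_alternating : alternating_factor s [:: m1; m2] I (night i).
Proof.
split.
  apply/subsetP=> e; rewrite !inE => /orP[]/andP[e1 /eqP e2].
    by rewrite e1 ((proj2 factorI) _ e1).
  by have := links_foreign e1; rewrite !inE e2 => /andP[_ ->]; rewrite orbT.
exists D; split; first exact: night_components.
  move=> k e; rewrite inE => /eqP ->.
  by have := mem_nth_rest k; rewrite inE => /andP[].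
move=> j; have [sz _ Uj sub] := seated_cycle j.
have szj : 1 < nth 0 [:: m1; m2] j by case: (j) => -[|[|//]].
set vs := nth _ _ _ in sz Uj sub; exists (tour pt vs), (tour_edges pt i o vs).
rewrite tour_traverses ?sz // tour_alternates // => d dd.
by have := sub _ (map_f _ dd); rewrite inE => /andP[].
Qed.

End Components.

Lemma solution_exists : exists2 g : nat, 1 <= g &
  exists2 P : {set {set medge T g}}, partition P (complete_plus g I) &
  {in P, forall F, alternating_factor s [:: m1; m2] I F}.
Proof.
exists g; first exact: g_gt0.
exists [set night i | i : 'I_g]; first exact: nights_partition.
by move=> _ /imsetP[i _ ->]; apply: night_alternating.
Qed.

End Solution.

(** * Families of seatings *)

Section Coordinates.
Variables (V : finType) (sp : V -> V) (n : nat).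
Hypotheses (spK : involutive sp) (sp_neq : forall x, sp x != x).
Hypothesis cardV : #|V| = 2 * n.

Let first : {set V} := [set x | enum_rank x < enum_rank (sp x)].

Let first_sp x : (sp x \in first) = (x \notin first).
Proof.
rewrite !inE spK -leqNgt [RHS]leq_eqVlt.
case: eqP => //= E; have {}E := enum_rank_inj (ord_inj E).
by have := sp_neq x; rewrite E eqxx.
Qed.

Let card_first : #|first| = n.
Proof.
have E : sp @: first = ~: first.
  apply/setP=> x; rewrite inE -first_sp; apply/imsetP/idP => [[y yf ->]|xf].
    by rewrite spK.
  by exists (sp x); rewrite ?spK.
have := cardsC first; rewrite -E card_imset ?cardV; last exact: inv_inj.
by move=> c; lia.
Qed.

(** All fixed-point-free involutions of 2n points look alike.  So a family of
seatings may be built on any convenient set of people. *)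
Lemma couple_coordinates : exists h : V -> 'I_n * bool,
  bijective h /\ forall x, h (sp x) = ((h x).1, ~~ (h x).2).
Proof.
pose r x := if x \in first then x else sp x.
have rf x : r x \in first.
  by rewrite /r; case: ifP => // /negbT; rewrite -first_sp.
have lt_r x : index (r x) (enum first) < n.
  by rewrite -card_first cardE index_mem mem_enum.
pose h x := (Ordinal (lt_r x), x \notin first); exists h; split.
  have inj_h : injective h.
    move=> x y [/(congr1 (nth x (enum first)))].
    rewrite !nth_index ?mem_enum // /r.
    by do 2!case: (_ \in first) => //; move/(inv_inj spK).
  by apply: inj_card_bij; rewrite // card_prod card_ord card_bool cardV mulnC.
move=> x; rewrite /h /= first_sp negbK; congr (_, _); apply: val_inj => /=.
by rewrite /r first_sp spK; case: (x \in first).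
Qed.

End Coordinates.

Lemma joined_map (V W : eqType) (sp : V -> V) (sq : W -> W) (f : V -> W) us u v :
  (forall x, f (sp x) = sq (f x)) -> joined sp us u v ->
  joined sq (map f us) (f u) (f v).
Proof.
move=> fsp; have E : darts sq (map f us) = [seq (f d.1, f d.2) | d <- darts sp us].
  rewrite /darts -map_rot -map_comp; elim: us (rot 1 us) => [|x us IH] [|y vs] //=.
  by rewrite IH fsp.
rewrite /joined E => /orP[]d; apply/orP; [left|right].
  by apply/mapP; exists (u, v).
by apply/mapP; exists (v, u).
Qed.

Definition map2 (V W : Type) (f : V -> W) (F : seq V * seq V) :=
  (map f F.1, map f F.2).

Lemma meets_map (V W : eqType) (sp : V -> V) (sq : W -> W) (f : V -> W) F u v :
  (forall x, f (sp x) = sq (f x)) -> meets sp F u v ->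
  meets sq (map2 f F) (f u) (f v).
Proof.
by move=> fsp /orP[] /(joined_map fsp) j; apply/orP; [left|right].
Qed.

Lemma seats_map (V W : eqType) (sp : V -> V) (sq : W -> W) (f : V -> W) m1 m2 F :
  injective f -> (forall x, f (sp x) = sq (f x)) ->
  seats sp m1 m2 F -> seats sq m1 m2 (map2 f F).
Proof.
move=> inj_f fsp /and3P[s1 s2 U]; rewrite /seats /= !size_map s1 s2 /=.
suff -> : (map f F.1 ++ map f F.2) ++ map sq (map f F.1 ++ map f F.2) =
          map f ((F.1 ++ F.2) ++ map sp (F.1 ++ F.2)) by rewrite map_inj_uniq.
by rewrite -map_cat [RHS]map_cat -!map_comp (eq_map (f := f \o sp) (g := sq \o f) fsp).
Qed.

Theorem family_solves (V : finType) (sp : V -> V) s m1 m2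
    (Fs : seq (seq V * seq V)) (n := s + (m1 + m2)) :
  involutive sp -> (forall x, sp x != x) -> #|V| = 2 * n ->
  1 < m1 -> 1 < m2 -> size Fs * (m1 + m2) = 2 * n * n.-1 ->
  all (seats sp m1 m2) Fs ->
  (forall u v, v != u -> v != sp u -> has (fun F => meets sp F u v) Fs) ->
  HOP_solvable s [:: m1; m2].
Proof.
move=> spK sp_neq cardV m1_gt1 m2_gt1 count seatsFs meetFs I factorI.
have [h [[h' hK h'K] hsp]] := couple_coordinates spK sp_neq cardV.
have cardT : #|'I_(2 * (s + sumn [:: m1; m2]))| = 2 * n.
  by rewrite card_ord /= addn0.
have [k [[k' kK k'K] kpt]] :=
  couple_coordinates (mateK factorI) (mate_neq factorI) cardT.
pose f x := k' (h x); pose f' y := h' (k y).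
have fK : cancel f f' by move=> x; rewrite /f /f' k'K hK.
have f'K : cancel f' f by move=> x; rewrite /f /f' h'K kK.
have fsp x : f (sp x) = mate I (f x).
  by apply: (can_inj kK); rewrite kpt /f !k'K hsp.
apply: (@solution_exists _ I s m1 m2 (map (map2 f) Fs)) => //.
- by rewrite size_map count.
- rewrite all_map; apply: sub_all seatsFs => F.
  exact: (seats_map (can_inj fK) fsp).
- move=> u v vu vpu; rewrite has_map.
  have : has (fun F => meets sp F (f' u) (f' v)) Fs.
    apply: meetFs; first by rewrite (can_eq f'K).
    by apply: contra vpu => /eqP E; rewrite -[v]f'K E fsp f'K.
  apply: sub_has => F /= /(meets_map fsp).
  by rewrite !f'K.
Qed.

Local Open Scope ring_scope.

(** * Rotation of base arrangements *)

Section Rotation.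
Variable G : finZmodType.
Local Notation V := (G * bool)%type.

Definition spouse (x : V) : V := (x.1, ~~ x.2).

Lemma spouseK : involutive spouse.
Proof. by case=> x b; rewrite /spouse /= negbK. Qed.

Lemma spouse_neq x : spouse x != x.
Proof. by case: x => x []; rewrite xpair_eqE eqxx. Qed.

(** Up to rotation a crossing is known by the difference of its couples and by the
two ends that it joins. *)
Definition linked (c : seq V) (d : G) (a b : bool) : Prop :=
  exists x, joined spouse c (x, a) (x + d, b).

Definition covers (cs : seq (seq V)) (d : G) : Prop :=
  forall a b, exists2 c, c \in cs & linked c d a b.

Lemma joined_linked c x y a b :
  joined spouse c (x, a) (y, b) -> linked c (y - x) a b.
Proof. by exists x; rewrite addrC subrK. Qed.

Lemma linkedN c d a b : linked c d a b -> linked c (- d) b a.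
Proof. by case=> x j; exists (x + d); rewrite addrK joinedC. Qed.

Lemma coversN cs d : covers cs d -> covers cs (- d).
Proof. by move=> C a b; have [c cin /linkedN] := C b a; exists c. Qed.

Lemma covers_sub cs cs' d : {subset cs <= cs'} -> covers cs d -> covers cs' d.
Proof. by move=> sub C a b; have [c /sub] := C a b; exists c. Qed.

Definition shift (t : G) (x : V) : V := (x.1 + t, x.2).

Lemma shift_inj t : injective (shift t).
Proof. by case=> x a [y b] [/addIr -> ->]. Qed.

Lemma shift_spouse t x : shift t (spouse x) = spouse (shift t x).
Proof. by []. Qed.

Definition orbits (Bs : seq (seq V * seq V)) :=
  [seq map2 (shift t) F | F <- Bs, t <- enum G].

Definition cycles (Bs : seq (seq V * seq V)) : seq (seq V) :=
  [seq F.1 | F <- Bs] ++ [seq F.2 | F <- Bs].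

Lemma size_orbits Bs : size (orbits Bs) = (size Bs * #|G|)%N.
Proof. by rewrite size_allpairs cardE. Qed.

Lemma seats_orbits m1 m2 Bs :
  all (seats spouse m1 m2) Bs -> all (seats spouse m1 m2) (orbits Bs).
Proof.
move=> ok; apply/allP=> _ /allpairsP[[F t] [/= /(allP ok) s _ ->]].
exact: (seats_map (@shift_inj t) (shift_spouse t)).
Qed.

Lemma meets_orbits Bs x y a b : covers (cycles Bs) (y - x) ->
  has (fun F => meets spouse F (x, a) (y, b)) (orbits Bs).
Proof.
move=> C; have [c cin [z j]] := C a b.
have [F FB cF] : exists2 F, F \in Bs & c = F.1 \/ c = F.2.
  by move: cin; rewrite mem_cat => /orP[]/mapP[F FB ->]; exists F; auto.
apply/hasP; exists (map2 (shift (x - z)) F).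
  by apply/allpairsP; exists (F, x - z); rewrite mem_enum.
have -> : (x, a) = shift (x - z) (z, a) by rewrite /shift /= addrC subrK.
have -> : (y, b) = shift (x - z) (z + (y - x), b).
  by rewrite /shift /= [z + _]addrC -addrA [z + (x - z)]addrC subrK subrK.
apply: (meets_map (shift_spouse _)); rewrite /meets.
by case: cF => <-; rewrite j ?orbT.
Qed.

(** Comparing couples is enough, because an end of one couple and an end of
another are never spouses. *)
Lemma seats_uniq m1 m2 (F : seq V * seq V) :
  size F.1 = m1 -> size F.2 = m2 -> uniq (map fst (F.1 ++ F.2)) ->
  seats spouse m1 m2 F.
Proof.
move=> <- <- U; rewrite /seats !eqxx /= cat_uniq (map_uniq U).
rewrite (map_inj_uniq (inv_inj spouseK)) (map_uniq U) andbT /=.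
apply/hasPn=> _ /mapP[u uF ->]; apply/negP => suF.
have := @nth_uniq _ u.1 _ (index (spouse u) (F.1 ++ F.2)) (index u (F.1 ++ F.2)).
move/(_ (map fst (F.1 ++ F.2))); rewrite !size_map !index_mem => /(_ suF uF U).
rewrite !(nth_map u) ?index_mem // !nth_index // eqxx => /esym/eqP E.
by have := spouse_neq u; rewrite -[spouse u](nth_index u suF) E nth_index // eqxx.
Qed.

End Rotation.

(** * Ladders *)

Lemma split_pair (A : Type) (x0 : A) (s : seq A) i : (i.+1 < size s)%N ->
  s = take i s ++ nth x0 s i :: nth x0 s i.+1 :: drop i.+2 s.
Proof. by move=> lt; rewrite -!drop_nth ?cat_take_drop // ltnW. Qed.

Section Ladder.
Variable G : finZmodType.
Local Notation V := (G * bool)%type.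
Implicit Types (ts : seq G) (vs : seq (bool * bool)) (E S : seq V).

(** The path [ts] is followed upwards, its translate by [c] downwards.  Nothing is
inserted at a turn with a rung, one couple at a turn with a cap.  The ends [v.2]
are negated because the second arm is run through backwards: with this convention
both arms make the same steps with the ends [v.1] and [v.2] in the same roles
([ladder_arms]). *)
Definition ladder (c : G) ts vs E S : seq V :=
  zip ts (map fst vs) ++ E ++
  rev (zip [seq t + c | t <- ts] [seq ~~ v.2 | v <- vs]) ++ S.

Lemma size_ladder c ts vs E S : size ts = size vs ->
  size (ladder c ts vs E S) = (2 * size ts + size E + size S)%N.
Proof.
move=> sz; rewrite !size_cat size_rev !size_zip !size_map -sz minnn; lia.
Qed.

Lemma ladder_couples c ts vs E S : size ts = size vs ->
  map fst (ladder c ts vs E S) =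
  ts ++ map fst E ++ rev [seq t + c | t <- ts] ++ map fst S.
Proof.
by move=> sz; rewrite !map_cat map_rev -!/(unzip1 _) !unzip1_zip // !size_map sz.
Qed.

Lemma joined_dart (c : seq V) u v :
  (u, spouse v) \in darts (@spouse G) c -> joined (@spouse G) c u (spouse v).
Proof. by rewrite /joined => ->. Qed.

Section Edges.
Variables (c : G) (ts : seq G) (vs : seq (bool * bool)) (E S : seq V).
Hypothesis sz : size ts = size vs.
Local Notation v_ i := (nth (false, false) vs i).
Local Notation t_ i := (nth 0 ts i).
Local Notation J := (joined (@spouse G) (ladder c ts vs E S)).

Let low_nth i : nth (0, false) (zip ts (map fst vs)) i = (t_ i, (v_ i).1).
Proof.
rewrite nth_zip ?size_map //; congr (_, _).
have [lt|ge] := ltnP i (size vs); first by rewrite (nth_map (false, false)).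
by rewrite !nth_default ?size_map.
Qed.

Let upp := zip [seq t + c | t <- ts] [seq ~~ v.2 | v <- vs].

Let upp_nth i : (i < size ts)%N -> nth (0, false) upp i = (t_ i + c, ~~ (v_ i).2).
Proof.
move=> lt; rewrite nth_zip ?size_map // (nth_map 0) //.
by rewrite (nth_map (false, false)) -?sz.
Qed.

Lemma ladder_arms i : (i.+1 < size ts)%N ->
  J (t_ i, (v_ i).1) (t_ i.+1, ~~ (v_ i.+1).1) /\
  J (t_ i + c, (v_ i).2) (t_ i.+1 + c, ~~ (v_ i.+1).2).
Proof.
move=> lt; split.
  apply: (@joined_dart _ _ (t_ i.+1, (v_ i.+1).1)).
  rewrite /ladder (@split_pair _ (0, false) (zip ts _) i); last first.
    by rewrite size_zip size_map -sz minnn.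
  by rewrite !low_nth -catA; apply: dart_next.
rewrite joinedC; have := @joined_dart (ladder c ts vs E S) (t_ i.+1 + c, ~~ (v_ i.+1).2)
  (t_ i + c, ~~ (v_ i).2).
rewrite /spouse /= negbK; apply.
rewrite /ladder -/upp (@split_pair _ (0, false) upp i); last first.
  by rewrite size_zip !size_map -sz minnn.
rewrite !upp_nth ?(ltnW lt) // rev_cat !rev_cons -!cats1 -!catA /=.
have := @dart_next V (@spouse G) (zip ts (map fst vs) ++ E ++ rev (drop i.+2 upp))
  (t_ i.+1 + c, ~~ (v_ i.+1).2) (t_ i + c, ~~ (v_ i).2) (rev (take i upp) ++ S).
by rewrite /spouse /= negbK -!catA.
Qed.

End Edges.

Section Ends.
Variables (c t : G) (ts : seq G) (v : bool * bool) (vs : seq (bool * bool)).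
Hypothesis sz : size ts = size vs.
Local Notation te := (last t ts).
Local Notation ve := (last v vs).
Local Notation J E S := (joined (@spouse G) (ladder c (t :: ts) (v :: vs) E S)).

Let low_last : exists l,
  zip (t :: ts) (map fst (v :: vs)) = rcons l (te, ve.1).
Proof.
elim: ts vs t v sz => [|t' ts' IH] [|v' vs'] //= t1 v1 => [_|[]].
  by exists [::].
by move/(IH _ t' v') => [l /= ->]; exists ((t1, v1.1) :: l).
Qed.

Let upp_last : exists l,
  zip [seq t + c | t <- t :: ts] [seq ~~ v.2 | v <- v :: vs]
  = rcons l (te + c, ~~ ve.2).
Proof.
elim: ts vs t v sz => [|t' ts' IH] [|v' vs'] //= t1 v1 => [_|[]].
  by exists [::].
by move/(IH _ t' v') => [l /= ->]; exists ((t1 + c, ~~ v1.2) :: l).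
Qed.

Lemma ladder_rung_end S : J [::] S (te, ve.1) (te + c, ve.2).
Proof.
have [l El] := low_last; have [u Eu] := upp_last.
have := @dart_next V (@spouse G) l (te, ve.1) (te + c, ~~ ve.2) (rev u ++ S).
rewrite /ladder El Eu rev_rcons -cats1 -catA /=.
by move/joined_dart; rewrite /spouse /= negbK.
Qed.

Lemma ladder_rung_start E : J E [::] (t, ~~ v.1) (t + c, ~~ v.2).
Proof.
rewrite joinedC /ladder /= rev_cons -!cats1 cats0.
set u := rev _; set l := zip _ _.
have := @dart_last V (@spouse G) (t, v.1) (l ++ E ++ u ++ [:: (t + c, ~~ v.2)]).
by rewrite !last_cat /= => /joined_dart.
Qed.

Lemma ladder_cap_end z b S :
  J [:: (z, b)] S (te, ve.1) (z, ~~ b) /\ J [:: (z, b)] S (z, b) (te + c, ve.2).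
Proof.
have [l El] := low_last; have [u Eu] := upp_last.
rewrite /ladder El Eu rev_rcons -cats1 -catA /=; split.
  have := @dart_next V (@spouse G) l (te, ve.1) (z, b)
    ((te + c, ~~ ve.2) :: rev u ++ S).
  by move/joined_dart.
have := @dart_next V (@spouse G) (rcons l (te, ve.1)) (z, b) (te + c, ~~ ve.2) (rev u ++ S).
by rewrite -cats1 -catA /= => /joined_dart; rewrite /spouse /= negbK.
Qed.

Lemma ladder_cap_start z b E :
  J E [:: (z, b)] (t + c, ~~ v.2) (z, ~~ b) /\ J E [:: (z, b)] (z, b) (t, ~~ v.1).
Proof.
rewrite /ladder /= rev_cons -!cats1 -!catA /=.
set u := rev _; set l := zip _ _; split.
  have := @dart_next V (@spouse G) ((t, v.1) :: l ++ E ++ u) (t + c, ~~ v.2) (z, b) [::].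
  by rewrite /= -!catA => /joined_dart.
have := @dart_last V (@spouse G) (t, v.1) (l ++ E ++ u ++ [:: (t + c, ~~ v.2); (z, b)]).
by rewrite !last_cat /= => /joined_dart.
Qed.

End Ends.

End Ladder.

(** * Choices of ends *)

(** The ends used at one position of a path by both arms of a ladder, in each of
two nights that share the path. *)
Definition vec := ((bool * bool) * (bool * bool))%type.

(** A step from a position labelled [u] to one labelled [v] is made four times, by
two arms in two nights; these four crossings have to join the ends in all ways. *)
Definition orth (u v : vec) : bool :=
  all (fun ab => ab \in [:: (u.1.1, ~~ v.1.1); (u.1.2, ~~ v.1.2);
                            (u.2.1, ~~ v.2.1); (u.2.2, ~~ v.2.2)])
      [:: (false, false); (false, true); (true, false); (true, true)].

Definition Vec (a b c d : bool) : vec := ((a, b), (c, d)).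

(** Vectors that are [orth] have two bits of each kind and group the four
coordinates into two pairs in different ways.  There are three such groupings, so
that a third one is left for the vector in between. *)
Lemma orth_between (u v : vec) : orth u v -> exists2 w, orth u w & orth w v.
Proof.
case: u => [[u1 u2] [u3 u4]]; case: v => [[v1 v2] [v3 v4]].
case: u1; case: u2; case: u3; case: u4; case: v1; case: v2; case: v3; case: v4
  => //= _;
  first [ by exists (Vec false false true true)
        | by exists (Vec false true false true)
        | by exists (Vec false true true false)].
Qed.

Definition label_ends k (u v : vec) := if k is 0 then u == v else orth u v.

Lemma label_path k u v : label_ends k u v ->
  exists ws, [/\ size ws = k, last u ws = v & path orth u ws].
Proof.
elim: k u => [|[|k] IH] u /=.
- by move/eqP=> <-; exists [::].
- by move=> o; exists [:: v]; rewrite /= o.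
- move=> /orth_between[w uw /IH[ws [sz l p]]]; exists (w :: ws).
  by rewrite /= sz l uw p.
Qed.

Section Doubles.
Variable G : finZmodType.
Variables (c1 c2 : G) (ts : seq G) (ws : seq vec) (E1 S1 E2 S2 : seq (G * bool)).
Hypothesis sz : size ts = size ws.

Lemma doubles_cover i : sorted orth ws -> (i.+1 < size ts)%N ->
  covers [:: ladder c1 ts (map fst ws) E1 S1; ladder c2 ts (map snd ws) E2 S2]
    (nth 0 ts i.+1 - nth 0 ts i).
Proof.
move=> o lt a b.
have lt' : (i.+1 < size ws)%N by rewrite -sz.
pose z := Vec false false false false.
have /allP/(_ (a, b)) := sortedP z o i lt'.
have -> : (a, b) \in [:: (false, false); (false, true); (true, false); (true, true)].
  by case: (a) (b) => [] [].
have sz1 : size ts = size (map fst ws) by rewrite size_map.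
have sz2 : size ts = size (map snd ws) by rewrite size_map.
have [J1 J2] := ladder_arms c1 E1 S1 sz1 lt.
have [J3 J4] := ladder_arms c2 E2 S2 sz2 lt.
have lti : (i < size ws)%N by apply: ltnW.
rewrite !(nth_map z) // in J1 J2 J3 J4.
have D (c : G) : nth 0 ts i.+1 + c - (nth 0 ts i + c) = nth 0 ts i.+1 - nth 0 ts i.
  by rewrite opprD addrACA subrr addr0.
move/(_ isT); rewrite !inE; case/or4P=> /eqP[-> ->].
- by eexists; [apply: mem_head | apply: joined_linked J1].
- by eexists; [apply: mem_head | rewrite -(D c1); apply: joined_linked J2].
- by eexists; [apply: mem_last | apply: joined_linked J3].
- by eexists; [apply: mem_last | rewrite -(D c2); apply: joined_linked J4].
Qed.

End Doubles.

(** * Zigzag paths *)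

Fixpoint zig (v : int) (up : bool) (D : seq nat) : seq int :=
  v :: if D is d :: D' then zig (if up then v + d%:Z else v - d%:Z) (~~ up) D'
       else [::].

Lemma size_zig v up D : size (zig v up D) = (size D).+1.
Proof. by elim: D v up => //= d D IH v up; rewrite IH. Qed.

Lemma zig_diff v up D d : d \in D -> exists2 i, (i.+1 < size (zig v up D))%N &
  nth 0 (zig v up D) i.+1 - nth 0 (zig v up D) i = d%:Z \/
  nth 0 (zig v up D) i.+1 - nth 0 (zig v up D) i = - d%:Z.
Proof.
elim: D v up => //= e D IH v up; rewrite in_cons; case: eqVneq => [-> _|_ /= dD].
  exists 0%N => /=; first by case: D {IH}.
  by case: up; case: D {IH} => [|f D] /=; [left|left|right|right]; lia.
have [i lt H] := IH (if up then v + e%:Z else v - e%:Z) (~~ up) dD.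
by exists i.+1.
Qed.

(** Deleting a step [g] splits a zigzag into two paths that share one window: these
will belong to the two cycles of a night. *)
Lemma zig_cat v up X g Y : exists v',
  zig v up (X ++ g :: Y) = zig v up X ++ zig v' (up (+) ~~ odd (size X)) Y.
Proof.
elim: X v up => [|d X IH] v up /=.
  by exists (if up then v + g%:Z else v - g%:Z); rewrite addbT.
have [v' ->] := IH (if up then v + d%:Z else v - d%:Z) (~~ up).
by exists v'; rewrite addNb -addbN.
Qed.

Lemma zig_rcons v up D d (te := last v (zig v up D)) :
  zig v up (rcons D d) =
  rcons (zig v up D) (if up (+) odd (size D) then te + d%:Z else te - d%:Z).
Proof.
rewrite {}/te; elim: D v up => [|e D IH] v up /=; first by rewrite addbF.
rewrite IH addNb -addbN; congr (_ :: rcons _ _).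
by case: D {IH} => [|e' D] /=.
Qed.

Lemma zig_last v v0 up D : last v0 (zig v up D) = last v (zig v up D).
Proof. by case: D. Qed.

(** The final 0 makes all the entries positive. *)
Definition descending (D : seq nat) := sorted gtn (rcons D 0%N).

Lemma descending_gt0 D d : descending D -> d \in D -> (0 < d)%N.
Proof.
rewrite /descending; elim: D d => //= e D IH d dD.
have [le0 dD'] : (0 < e)%N /\ sorted gtn (rcons D 0%N).
  case: D dD IH => [|f D] /=; first by case/andP.
  move=> /andP[fe dD] IH; split=> //.
  by apply: leq_ltn_trans fe; apply: ltnW; apply: (IH f) => //; rewrite mem_head.
by rewrite in_cons => /orP[/eqP -> //|]; apply: IH.
Qed.

(** As the swings become shorter, the path never leaves the interval bounded by its
first step. *)
Lemma zig_window v up D x : descending D -> x \in zig v up D ->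
  if up then (v <= x <= v + (head 0%N D)%:Z)%R
  else (v - (head 0%N D)%:Z <= x <= v)%R.
Proof.
elim: D v up => [|d D IH] v up /=; first by rewrite inE => _ /eqP ->; case: up; lia.
rewrite in_cons => dD; case/orP => [/eqP ->|xD]; first by case: up; lia.
have dD' : descending D by move: dD; rewrite /descending; case: (D) => //= e D' /andP[].
have le_d : (head 0 D < d)%N by move: dD; rewrite /descending; case: (D) => [|e D'] /= /andP[].
by have := IH _ _ dD' xD; case: up {xD} => /=; lia.
Qed.

Lemma zig_uniq v up D : descending D -> uniq (zig v up D).
Proof.
elim: D v up => [|d D IH] v up //= dD.
have dD' : descending D by move: dD; rewrite /descending; case: (D) => //= e D' /andP[].
have le_d : (head 0 D < d)%N by move: dD; rewrite /descending; case: (D) => [|e D'] /= /andP[].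
rewrite IH // andbT; apply/negP => /(zig_window dD').
by case: up => /=; lia.
Qed.

(** * Base nights modulo n *)

Lemma seats_swap (V : finType) (sp : V -> V) m1 m2 F :
  seats sp m1 m2 F -> seats sp m2 m1 (F.2, F.1).
Proof.
case/and3P=> s1 s2 U; rewrite /seats s1 s2 /=.
by rewrite (perm_uniq (perm_cat (permEl (perm_catC _ _)) (perm_map sp (permEl (perm_catC _ _))))).
Qed.

Lemma family_solves_both (V : finType) (sp : V -> V) s m1 m2
    (Fs : seq (seq V * seq V)) (n := (s + (m1 + m2))%N) :
  involutive sp -> (forall x, sp x != x) -> #|V| = (2 * n)%N ->
  (1 < m1)%N -> (1 < m2)%N -> (size Fs * (m1 + m2) = 2 * n * n.-1)%N ->
  all (seats sp m1 m2) Fs ->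
  (forall u v, v != u -> v != sp u -> has (fun F => meets sp F u v) Fs) ->
  HOP_solvable s [:: m1; m2] /\ HOP_solvable s [:: m2; m1].
Proof.
move=> spK sp_neq cardV m1_gt1 m2_gt1 count seatsFs meetFs; split.
  exact: family_solves spK sp_neq cardV m1_gt1 m2_gt1 count seatsFs meetFs.
apply: (family_solves spK sp_neq _ m2_gt1 m1_gt1 (Fs := [seq (F.2, F.1) | F <- Fs])).
- by rewrite [(m2 + m1)%N]addnC.
- by rewrite size_map [(m2 + m1)%N]addnC.
- by rewrite all_map; apply: sub_all seatsFs => F; apply: seats_swap.
- move=> u v vu vpu; rewrite has_map; apply: sub_has (meetFs u v vu vpu) => F /=.
  by rewrite /meets orbC.
Qed.

Section Residues.
Variable n : nat.
Hypothesis n_gt1 : (1 < n)%N.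
Local Notation Z := 'Z_n.
Local Notation V := (Z * bool)%type.
Local Notation sp := (@spouse Z).

Lemma Zp_intr_eq0 (x : int) : x%:~R = 0 :> Z -> (n %| `|x|)%N.
Proof.
have natr0 k : k%:R = 0 :> Z -> (n %| k)%N.
  by move/(congr1 val); rewrite /= val_Zp_nat // => /eqP.
case: x => k /=; first by rewrite -pmulrn => /natr0.
by rewrite NegzE mulrNz => /eqP; rewrite oppr_eq0 -pmulrn => /eqP/natr0.
Qed.

Lemma window_inj (lo x y : int) : lo <= x < lo + n%:Z -> lo <= y < lo + n%:Z ->
  x%:~R = y%:~R :> Z -> x = y.
Proof.
move=> wx wy /eqP; rewrite -subr_eq0 -intrB => /eqP/Zp_intr_eq0/dvdnP[[|k] E].
  by lia.
by have := leq_pmull n (ltn0Sn k); lia.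
Qed.

(** With [m1 = 0] this speaks of nights with a single cycle, to which a cycle of
length four is added by [with_digons]. *)
Definition base (r m1 m2 : nat) (Ds : seq nat) : Prop :=
  exists Bs : seq (seq V * seq V), [/\ size Bs = r, all (seats sp m1 m2) Bs
    & forall d, d \in Ds -> covers (cycles Bs) d%:R].

Lemma base_cat r r' m1 m2 Ds Ds' :
  base r m1 m2 Ds -> base r' m1 m2 Ds' -> base (r + r')%N m1 m2 (Ds ++ Ds').
Proof.
case=> Bs [sz ok C] [Bs' [sz' ok' C']]; exists (Bs ++ Bs').
rewrite size_cat sz sz' all_cat ok ok'; split=> // d.
rewrite mem_cat => /orP[/C|/C']; apply: covers_sub => c;
  by rewrite !mem_cat !map_cat !mem_cat; case/orP=> ->; rewrite ?orbT.
Qed.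

Lemma base_iter K r m1 m2 (Ds : nat -> seq nat) :
  (forall j, (j < K)%N -> base r m1 m2 (Ds j)) ->
  base (K * r)%N m1 m2 (flatten [seq Ds j | j <- iota 0 K]).
Proof.
elim: K => [|K IH] H; first by exists [::]; rewrite mul0n.
rewrite -addn1 iotaD map_cat flatten_cat mulnDl mul1n add0n /=.
apply: base_cat; first by apply: IH => j lt; apply: H; rewrite ltnW.
by rewrite cats0; apply: H.
Qed.

Lemma covers_intro (cs : seq (seq V)) d :
  (exists2 c, c \in cs & linked c d false false) ->
  (exists2 c, c \in cs & linked c d false true) ->
  (exists2 c, c \in cs & linked c d true false) ->
  (exists2 c, c \in cs & linked c d true true) -> covers cs d.
Proof. by move=> ? ? ? ? [] []. Qed.

Lemma mem_cycles1 F Bs : F \in Bs -> F.1 \in @cycles Z Bs.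
Proof. by move=> FB; rewrite mem_cat map_f. Qed.

Lemma mem_cycles2 F Bs : F \in Bs -> F.2 \in @cycles Z Bs.
Proof. by move=> FB; rewrite mem_cat orbC map_f. Qed.

Definition res (zs : seq int) : seq Z := [seq z%:~R | z <- zs].

Lemma nth_res zs i : (i < size zs)%N -> nth 0 (res zs) i = (nth 0 zs i)%:~R.
Proof. by move=> lt; rewrite (nth_map 0). Qed.

Lemma res_uniq (lo : int) zs : uniq zs ->
  {in zs, forall z, lo <= z < lo + n%:Z} -> uniq (res zs).
Proof.
move=> U w; rewrite map_inj_in_uniq // => x y xz yz.
by apply: (window_inj (w x xz) (w y yz)).
Qed.

(** All the couples of a night are given by integers in one window of length [n];
distinct integers then stay distinct modulo [n]. *)
Lemma ladder_pair (lo : int) (c : int) zs1 zs2 vs1 vs2 E1 S1 E2 S2 e1 s1 e2 s2 :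
    size zs1 = size vs1 -> size zs2 = size vs2 ->
    map fst E1 = res e1 -> map fst S1 = res s1 ->
    map fst E2 = res e2 -> map fst S2 = res s2 ->
    let all := (zs1 ++ zs2) ++ [seq z + c | z <- zs1 ++ zs2]
               ++ e1 ++ s1 ++ e2 ++ s2 in
    uniq all -> {in all, forall z, lo <= z < lo + n%:Z} ->
  seats sp (2 * size zs1 + size e1 + size s1)%N
    (2 * size zs2 + size e2 + size s2)%N
    (ladder c%:~R (res zs1) vs1 E1 S1, ladder c%:~R (res zs2) vs2 E2 S2).
Proof.
move=> sz1 sz2 hE1 hS1 hE2 hS2 L U w.
have szm A (f : A -> Z) l l' : map f l = res l' -> size l = size l'.
  by move/(congr1 size); rewrite !size_map.
apply: seats_uniq => /=.
- by rewrite size_ladder ?size_map // (szm _ _ _ _ hE1) (szm _ _ _ _ hS1).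
- by rewrite size_ladder ?size_map // (szm _ _ _ _ hE2) (szm _ _ _ _ hS2).
rewrite map_cat !ladder_couples ?size_map // hE1 hS1 hE2 hS2.
have shiftE zs : [seq t + c%:~R | t <- res zs] = res [seq z + c | z <- zs].
  by rewrite /res -!map_comp; apply: eq_map => z /=; rewrite intrD.
rewrite !shiftE /res -!map_rev -!map_cat -/(res _).
have P : perm_eq ((zs1 ++ e1 ++ [seq z + c | z <- rev zs1] ++ s1) ++
                 (zs2 ++ e2 ++ [seq z + c | z <- rev zs2] ++ s2)) L.
  by apply/permP=> a; rewrite /L !map_cat !count_cat !map_rev !count_rev; lia.
apply: (@res_uniq lo); first by rewrite (perm_uniq P).
by move=> z; rewrite (perm_mem P); apply: w.
Qed.

Lemma doubles_res c1 c2 v up D (ws : seq vec) E1 S1 E2 S2 d :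
    size ws = (size D).+1 -> sorted orth ws -> d \in D ->
  covers [:: ladder c1 (res (zig v up D)) (map fst ws) E1 S1;
             ladder c2 (res (zig v up D)) (map snd ws) E2 S2] d%:R.
Proof.
move=> sz o dD; have [i lt H] := zig_diff v up dD.
have szr : size (res (zig v up D)) = size ws by rewrite size_map size_zig.
have lt' : (i.+1 < size (res (zig v up D)))%N by rewrite size_map.
have := doubles_cover c1 c2 E1 S1 E2 S2 szr o lt'.
rewrite !nth_res // ?(ltnW lt) // -intrB; case: H => -> //.
by rewrite mulrNz => /coversN; rewrite opprK.
Qed.

End Residues.

(** * Nights with two even cycles *)

(** Differences [d] and [n - d] are those of the same pairs, read in the two
directions. *)
Theorem cyclic_solution M n K s m1 m2 Ds :
  (0 < M)%N -> n = (2 * M + 1)%N -> (1 < m1)%N -> (1 < m2)%N ->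
  (s + (m1 + m2) = n)%N -> (K * (m1 + m2) = 4 * M)%N ->
  base n K m1 m2 Ds -> (forall d, (0 < d <= M)%N -> (d \in Ds) || ((n - d)%N \in Ds)) ->
  HOP_solvable s [:: m1; m2] /\ HOP_solvable s [:: m2; m1].
Proof.
move=> M_gt0 nE m1_gt1 m2_gt1 sE count [Bs [szB okB covB]] DsP.
have n_gt1 : (1 < n)%N by lia.
have cardZ : #|'Z_n| = n by rewrite card_ord Zp_cast.
apply: (family_solves_both (sp := @spouse 'Z_n) (Fs := orbits Bs)) => //.
- exact: spouseK.
- exact: spouse_neq.
- by rewrite card_prod card_bool cardZ sE mulnC.
- by rewrite size_orbits szB cardZ sE mulnAC count; lia.
- exact: seats_orbits.
move=> [x a] [y b] vu vpu; apply: meets_orbits.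
have xy : y - x != 0.
  rewrite subr_eq0; apply: contraNneq vu => E; subst y.
  by move: vpu; rewrite /spouse /= !xpair_eqE eqxx; case: (a) (b) => [] [].
set r := y - x in xy *.
have lt_r : (r < n)%N by rewrite -[X in (_ < X)%N](Zp_cast n_gt1).
have r_gt0 : (0 < r)%N by rewrite lt0n.
have neg d : (d <= n)%N -> covers (cycles Bs) (n - d)%:R -> covers (cycles Bs) d%:R.
  move=> le C; rewrite -[d%:R]opprK; apply: coversN.
  by rewrite (_ : - d%:R = (n - d)%:R :> 'Z_n) // natrB // pchar_Zp // sub0r.
have both d : (0 < d <= M)%N -> covers (cycles Bs) d%:R.
  by move=> dM; case/orP: (DsP d dM) => /covB // /neg; apply; lia.
have [le|gt] := leqP r M.
  by rewrite -[r]natr_Zp; apply: both; rewrite r_gt0.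
by rewrite -[r]natr_Zp; apply: neg; [exact: ltnW | apply: both; lia].
Qed.

Section LadderLinks.
Variable G : finZmodType.
Local Notation V := (G * bool)%type.
Local Notation sp := (@spouse G).

Lemma rung_linked (c t : G) (cs : seq V) a b :
  joined sp cs (t, a) (t + c, b) -> linked cs c a b.
Proof. by move/joined_linked; rewrite addrC addKr. Qed.

Lemma subset2 (c1 c2 : seq V) (cs : seq (seq V)) :
  c1 \in cs -> c2 \in cs -> {subset [:: c1; c2] <= cs}.
Proof. by move=> i1 i2 x; rewrite in_cons mem_seq1 => /orP[]/eqP ->. Qed.

Section Labels.
Variables (f : vec -> bool * bool) (c : G) (ts : seq G) (u : vec) (ws : seq vec).
Hypothesis sz : size ts = (size ws).+1.
Local Notation e := (f (last u ws)).

Lemma linked_rung_end S :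
  linked (ladder c ts (map f (u :: ws)) [::] S) c e.1 e.2.
Proof.
case: ts sz => // t ts' [sz']; rewrite /= -(last_map f); apply: rung_linked.
by apply: ladder_rung_end; rewrite size_map.
Qed.

Lemma linked_rung_start E :
  linked (ladder c ts (map f (u :: ws)) E [::]) c (~~ (f u).1) (~~ (f u).2).
Proof.
case: ts sz => // t ts' [sz']; apply: rung_linked.
by apply: ladder_rung_start; rewrite size_map.
Qed.

Lemma linked_cap_end z b S : let te := last 0 ts in
  let C := ladder c ts (map f (u :: ws)) [:: (z, b)] S in
  linked C (z - te) e.1 (~~ b) /\ linked C (te + c - z) b e.2.
Proof.
case: ts sz => // t ts' [sz']; rewrite /= -(last_map f).
have sz'' : size ts' = size (map f ws) by rewrite size_map.
by have [/joined_linked ? /joined_linked ?] := ladder_cap_end c t (f u) sz'' z b S.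
Qed.

Lemma linked_cap_start z b E : let t0 := head 0 ts in
  let C := ladder c ts (map f (u :: ws)) E [:: (z, b)] in
  linked C (z - (t0 + c)) (~~ (f u).2) (~~ b) /\ linked C (t0 - z) b (~~ (f u).1).
Proof.
case: ts sz => // t ts' [sz'] /=.
by have [/joined_linked ? /joined_linked ?] :=
  ladder_cap_start c t ts' (f u) (map f ws) z b E.
Qed.

End Labels.

End LadderLinks.

Lemma zones_uniq (zs : seq int) (h c : nat) : uniq zs ->
  {in zs, forall z, 0 <= z <= h%:Z} -> (h < c)%N ->
  uniq (zs ++ [seq z + c%:Z | z <- zs]).
Proof.
move=> U w lt; rewrite cat_uniq U (map_inj_uniq (addIr _)) U andbT /=.
apply/hasPn=> _ /mapP[z zz ->]; apply/negP=> /w.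
by have := w z zz; lia.
Qed.

Section Blocks.
Variable n : nat.
Hypothesis n_gt1 : (1 < n)%N.
Local Notation Z := 'Z_n.
Local Notation V := (Z * bool)%type.
Local Notation sp := (@spouse Z).
Local Notation res := (@res n).

(** Two nights share the pieces of a zigzag whose step [g] is deleted.  A night
with shift [c] has four rungs of difference [c], and these cover it in all ways. *)
Lemma block_even_even (X : seq nat) g (Y : seq nat) c e (h := head 0%N (X ++ g :: Y)) :
    X != [::] -> Y != [::] -> descending (X ++ g :: Y) ->
    (h < c)%N -> (h < e)%N -> (c + h < n)%N -> (e + h < n)%N ->
  base n 2 (2 * (size X).+1)%N (2 * (size Y).+1)%N (c :: e :: X ++ Y).
Proof.
move=> X0 Y0 dD hc he cn en.
have [v' zE] := zig_cat 0 true X g Y; set up' := true (+) _ in zE.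
have UT := zig_uniq 0 true dD.
have wT x : x \in zig 0 true X ++ zig v' up' Y -> 0 <= x <= h%:Z.
  by rewrite -zE => /(zig_window dD); rewrite add0r.
rewrite zE in UT.
have lab W u v : W != [::] :> seq nat -> orth u v ->
    exists ws, [/\ size ws = size W, last u ws = v & path orth u ws].
  by move=> W0 o; apply: label_path; case: W W0.
have [ws1 [sz1 last1 o1]] := lab X (Vec false false true true) (Vec false true false true) X0 isT.
have [ws2 [sz2 last2 o2]] := lab Y (Vec true true false false) (Vec true false true false) Y0 isT.
set u1 := Vec _ _ _ _ in last1 o1; set u2 := Vec _ _ _ _ in last2 o2.
pose A f := ladder (f : nat)%:Z%:~R (res (zig 0 true X)).
pose B f := ladder (f : nat)%:Z%:~R (res (zig v' up' Y)).
pose F1 := (A c (map fst (u1 :: ws1)) [::] [::], B c (map fst (u2 :: ws2)) [::] [::]).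
pose F2 := (A e (map snd (u1 :: ws1)) [::] [::], B e (map snd (u2 :: ws2)) [::] [::]).
have szX : size (zig 0 true X) = (size ws1).+1 by rewrite size_zig sz1.
have szY : size (zig v' up' Y) = (size ws2).+1 by rewrite size_zig sz2.
exists [:: F1; F2]; split=> //.
  have ok f vs1 vs2 : size vs1 = (size X).+1 -> size vs2 = (size Y).+1 ->
      (h < f)%N -> (f + h < n)%N ->
      seats sp (2 * (size X).+1)%N (2 * (size Y).+1)%N (A f vs1 [::] [::], B f vs2 [::] [::]).
    move=> s1 s2 hf fn.
    have := @ladder_pair n n_gt1 0 f (zig 0 true X) (zig v' up' Y) vs1 vs2
      [::] [::] [::] [::] [::] [::] [::] [::].
    rewrite !size_zig /= !addn0; apply=> //; rewrite ?cats0.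
      exact: zones_uniq UT wT hf.
    by move=> z; rewrite mem_cat => /orP[/wT|/mapP[y /wT ? ->]]; lia.
  by rewrite /= andbT; apply/andP; split; apply: ok; rewrite //= size_map ?sz1 ?sz2.
have szr1 : size (res (zig 0 true X)) = (size ws1).+1 by rewrite size_map.
have szr2 : size (res (zig v' up' Y)) = (size ws2).+1 by rewrite size_map.
have c11 : F1.1 \in cycles [:: F1; F2] by rewrite !inE eqxx.
have c21 : F2.1 \in cycles [:: F1; F2] by rewrite !inE eqxx ?orbT.
have c12 : F1.2 \in cycles [:: F1; F2] by rewrite !inE eqxx ?orbT.
have c22 : F2.2 \in cycles [:: F1; F2] by rewrite !inE eqxx ?orbT.
move=> d; rewrite !in_cons mem_cat => /or4P[/eqP ->|/eqP ->|dX|dY].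
- have E1 := linked_rung_end fst c%:Z%:~R u1 szr1 [::]; rewrite last1 /= in E1.
  have S1 := linked_rung_start fst c%:Z%:~R u1 szr1 [::]; rewrite /= in S1.
  have E2 := linked_rung_end fst c%:Z%:~R u2 szr2 [::]; rewrite last2 /= in E2.
  have S2 := linked_rung_start fst c%:Z%:~R u2 szr2 [::]; rewrite /= in S2.
  apply: covers_intro; [exists F1.2|exists F1.1|exists F1.2|exists F1.1] => //.
- have E1 := linked_rung_end snd e%:Z%:~R u1 szr1 [::]; rewrite last1 /= in E1.
  have S1 := linked_rung_start snd e%:Z%:~R u1 szr1 [::]; rewrite /= in S1.
  have E2 := linked_rung_end snd e%:Z%:~R u2 szr2 [::]; rewrite last2 /= in E2.
  have S2 := linked_rung_start snd e%:Z%:~R u2 szr2 [::]; rewrite /= in S2.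
  apply: covers_intro; [exists F2.1|exists F2.1|exists F2.2|exists F2.2] => //.
- by apply: covers_sub (subset2 c11 c21) _; apply: doubles_res => //; rewrite /= sz1.
- by apply: covers_sub (subset2 c12 c22) _; apply: doubles_res => //; rewrite /= sz2.
Qed.

End Blocks.

(** * Nights with two odd cycles *)

Definition all4 (l : seq (bool * bool)) : bool :=
  all (fun ab => ab \in l)
      [:: (false, false); (false, true); (true, false); (true, true)].

Lemma four_covers (G : finZmodType) (cs : seq (seq (G * bool))) d
    ab1 ab2 ab3 ab4 k1 k2 k3 k4 :
  all4 [:: ab1; ab2; ab3; ab4] ->
  linked k1 d ab1.1 ab1.2 -> linked k2 d ab2.1 ab2.2 ->
  linked k3 d ab3.1 ab3.2 -> linked k4 d ab4.1 ab4.2 ->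
  {subset [:: k1; k2; k3; k4] <= cs} -> covers cs d.
Proof.
move=> /allP full L1 L2 L3 L4 sub a b.
have : (a, b) \in [:: ab1; ab2; ab3; ab4] by apply: full; case: a b => [] [].
rewrite !in_cons in_nil orbF => /or4P[]/eqP E; [exists k1|exists k2|exists k3|exists k4];
  rewrite ?sub ?in_cons ?eqxx ?orbT //.
- by rewrite -E in L1.
- by rewrite -E in L2.
- by rewrite -E in L3.
- by rewrite -E in L4.
Qed.

Lemma rung_labels k : exists u v : vec, label_ends k u v /\
  all4 [:: v.1; v.2; (~~ u.1.1, ~~ u.1.2); (~~ u.2.1, ~~ u.2.2)].
Proof.
case: k => [|k].
  by exists (Vec false false false true), (Vec false false false true).
by exists (Vec false true true false), (Vec false false true true).
Qed.

(** [u], [v] and [U], [V] label the ends of the two paths, [m1], [m2] and [n1], [n2]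
are the ends used in the caps of the first and the second ladder, in two nights.
The conditions say that rungs and caps cover the differences a, p and p + a.  It
depends on the direction of the last step, [low], on which side of its cap the
second ladder has the edge of difference p. *)
Definition odd_odd_spec (x y : nat) (low : bool) (u v U V : vec) (m1 m2 n1 n2 : bool) :=
  [/\ label_ends x u v, label_ends y U V,
      all4 [:: v.1; v.2; (~~ U.1.1, ~~ U.1.2); (~~ U.2.1, ~~ U.2.2)]
    & if low then
        all4 [:: (m1, ~~ u.1.1); (m2, ~~ u.2.1); (V.1.2, n1); (V.2.2, n2)] &&
        all4 [:: (~~ m1, ~~ u.1.2); (~~ m2, ~~ u.2.2); (V.1.1, ~~ n1); (V.2.1, ~~ n2)]
      else
        all4 [:: (m1, ~~ u.1.1); (m2, ~~ u.2.1); (~~ n1, V.1.1); (~~ n2, V.2.1)] &&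
        all4 [:: (~~ m1, ~~ u.1.2); (~~ m2, ~~ u.2.2); (n1, V.1.2); (n2, V.2.2)]].

(** A finite search: for a path with at least one step, [label_path] only asks for
[orth] labels at its ends. *)
Lemma odd_odd_labels x y low : ~~ [&& x == 0%N, y == 0%N & low] ->
  exists u v U V m1 m2 n1 n2, odd_odd_spec x y low u v U V m1 m2 n1 n2.
Proof.
pose V0001 := Vec false false false true; pose V0011 := Vec false false true true.
pose V0110 := Vec false true true false; pose V0101 := Vec false true false true.
case: x => [|x]; case: y => [|y]; case: low => //= _.
- by exists V0001, V0001, V0001, V0001, false, true, true, false.
- by exists V0011, V0011, V0110, V0011, false, true, false, true.
- by exists V0011, V0011, V0110, V0011, false, false, false, false.
- by exists V0011, V0110, V0011, V0011, false, true, false, true.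
- by exists V0011, V0110, V0011, V0011, false, false, false, false.
- by exists V0011, V0110, V0011, V0101, false, false, false, true.
- by exists V0011, V0110, V0011, V0110, false, false, false, false.
Qed.

Section Blocks.
Variable n : nat.
Hypothesis n_gt1 : (1 < n)%N.
Local Notation Z := 'Z_n.
Local Notation V := (Z * bool)%type.
Local Notation sp := (@spouse Z).
Local Notation res := (@res n).

Lemma res_last zs z : last (z%:~R) (res zs) = (last z zs)%:~R.
Proof. exact: last_map. Qed.

Lemma res_head v up D : head 0 (res (zig v up D)) = v%:~R.
Proof. by case: D. Qed.

Lemma res_zig_last v up D :
  last 0 (res (zig v up D)) = (last v (zig v up D))%:~R.
Proof. by rewrite -[0](mulr0z 1) res_last zig_last. Qed.

Lemma seats_caps zs1 zs2 (h c : nat) (lo w : int) (low : bool) vs1 vs2 (m m' : bool)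
    (mid := if low then w + c%:Z else w) :
    uniq (zs1 ++ rcons zs2 w) -> {in zs1 ++ rcons zs2 w, forall z, 0 <= z <= h%:Z} ->
    (h < c)%N -> lo < 0 -> c%:Z + h%:Z - n%:Z < lo ->
    size vs1 = size zs1 -> size vs2 = size zs2 ->
  seats sp (2 * size zs1 + 1)%N (2 * size zs2 + 1)%N
    (ladder c%:Z%:~R (res zs1) vs1 [::] [:: (lo%:~R : Z, m)],
     ladder c%:Z%:~R (res zs2) vs2 [:: (mid%:~R : Z, m')] [::]).
Proof.
rewrite -cats1 catA cats1 => U w0 hc lo0 hlo s1 s2.
have := @ladder_pair n n_gt1 lo c zs1 zs2 vs1 vs2
  [::] [:: (lo%:~R : Z, m)] [:: (mid%:~R : Z, m')] [::]
  [::] [:: lo] [:: mid] [::].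
rewrite /= !addn0.
have w1 x : x \in zs1 ++ zs2 -> 0 <= x <= h%:Z.
  by move=> xz; apply: w0; rewrite mem_rcons in_cons xz orbT.
have ww : 0 <= w <= h%:Z by apply: w0; rewrite mem_rcons mem_head.
move: U; rewrite rcons_uniq => /andP[nw U1].
have midw : mid = w + c%:Z \/ mid = w by rewrite /mid; case: (low); auto.
apply=> //.
  have -> : (zs1 ++ zs2) ++ [seq z + c%:Z | z <- zs1 ++ zs2] ++ [:: lo; mid] =
      rcons (rcons ((zs1 ++ zs2) ++ [seq z + c%:Z | z <- zs1 ++ zs2]) lo) mid.
    by rewrite -!cats1 -!catA.
  rewrite !rcons_uniq mem_rcons in_cons negb_or (zones_uniq U1 w1 hc) andbT.
  rewrite -andbA; apply/and3P; split.
  - by clear -midw ww lo0; lia.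
  - apply/negP; rewrite mem_cat; case: midw => ->.
      case/orP=> [/w1|/mapP[x xz /addIr E]]; first by clear -ww hc; lia.
      by rewrite E xz in nw.
    by rewrite (negPf nw) /= => /mapP[x /w1]; clear -ww hc; lia.
  - apply/negP; rewrite mem_cat => /orP[/w1|/mapP[x /w1 wx E]]; first by clear -lo0; lia.
    by clear -lo0 wx E; lia.
move=> x; rewrite mem_cat => /orP[/w1|]; first by clear -lo0 hlo; lia.
rewrite mem_cat => /orP[/mapP[y /w1 wy ->]|]; first by clear -lo0 hlo wy hc; lia.
rewrite !in_cons orbF => /orP[]/eqP ->; first by clear -lo0 hlo ww hc; lia.
by clear -midw lo0 hlo ww hc; lia.
Qed.

(** Two nights with shift [a] have four rungs of difference [a] and four caps, with
an edge of difference [p] and one of difference [p + a] each.  The cap of the first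
ladder is [p] below the start of the zigzag.  The cap of the second ladder prolongs
its zigzag by a step [p], which is made on the upper arm if it leads upwards. *)
Lemma block_odd_odd (X : seq nat) g (Y : seq nat) p a (h := head 0%N (X ++ g :: Y)) :
    descending (X ++ g :: rcons Y p) -> (h < a)%N -> (p + a + h < n)%N ->
  base n 2 (2 * size X + 3)%N (2 * size Y + 3)%N (p :: a :: (p + a)%N :: X ++ Y).
Proof.
move=> dD ha hn.
have p_gt0 : (0 < p)%N.
  by apply: (descending_gt0 dD); rewrite mem_cat in_cons mem_rcons mem_head !orbT.
have [v' zE] := zig_cat 0 true X g (rcons Y p); set up' := true (+) _ in zE.
have hE : h = head 0%N (X ++ g :: rcons Y p) by rewrite /h; case: (X).
move: zE; rewrite zig_rcons; set te := last v' _; set w := if _ then _ else _.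
set zs1 := zig 0 true X; set zs2 := zig v' up' Y => zE.
have U0 := zig_uniq 0 true dD.
have w0 x : x \in zs1 ++ rcons zs2 w -> 0 <= x <= h%:Z.
  by rewrite hE -zE => /(zig_window dD); rewrite add0r.
rewrite zE in U0; pose low := up' (+) odd (size Y).
have [|u [v [U [V' [m1 [m2 [n1 [n2 [lx ly fa fpb]]]]]]]]] := @odd_odd_labels (size X) (size Y) low.
  by rewrite /low /up'; case: (X) (Y) => [|? ?] [|? ?].
have [ws1 [sz1 last1 o1]] := label_path lx.
have [ws2 [sz2 last2 o2]] := label_path ly.
pose mid := if low then w + a%:Z else w.
have szX : size zs1 = (size ws1).+1 by rewrite size_zig sz1.
have szY : size zs2 = (size ws2).+1 by rewrite size_zig sz2.
pose A vs m := ladder a%:Z%:~R (res zs1) vs [::] [:: ((- p%:Z)%:~R : Z, m)].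
pose B vs m := ladder a%:Z%:~R (res zs2) vs [:: (mid%:~R : Z, m)] [::].
pose F1 := (A (map fst (u :: ws1)) m1, B (map fst (U :: ws2)) n1).
pose F2 := (A (map snd (u :: ws1)) m2, B (map snd (U :: ws2)) n2).
exists [:: F1; F2]; split=> //.
  have ok vs1 vs2 m m0 : size vs1 = (size X).+1 -> size vs2 = (size Y).+1 ->
      seats sp (2 * size X + 3)%N (2 * size Y + 3)%N (A vs1 m, B vs2 m0).
    move=> s1 s2; have X2 : (2 * size X + 3 = 2 * size zs1 + 1)%N by rewrite size_zig; clear; lia.
    have Y2 : (2 * size Y + 3 = 2 * size zs2 + 1)%N by rewrite size_zig; clear; lia.
    rewrite X2 Y2; apply: (@seats_caps zs1 zs2 h a (- p%:Z) w low vs1 vs2 m m0 U0 w0) => //;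
      rewrite ?size_zig //.
      by clear -p_gt0; lia.
    by clear -hn; lia.
  by rewrite /= andbT; apply/andP; split; apply: ok; rewrite //= size_map ?sz1 ?sz2.
have szr1 : size (res zs1) = (size ws1).+1 by rewrite size_map.
have szr2 : size (res zs2) = (size ws2).+1 by rewrite size_map.
have c11 : F1.1 \in cycles [:: F1; F2] by rewrite !inE eqxx.
have c21 : F2.1 \in cycles [:: F1; F2] by rewrite !inE eqxx ?orbT.
have c12 : F1.2 \in cycles [:: F1; F2] by rewrite !inE eqxx ?orbT.
have c22 : F2.2 \in cycles [:: F1; F2] by rewrite !inE eqxx ?orbT.
have neg (C : seq V) (z : int) (k : nat) (b1 b2 : bool) :
    z = - k%:Z -> linked C z%:~R b1 b2 -> linked C k%:R b2 b1.
  by move=> -> /linkedN; rewrite -intrN opprK.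
have pos (C : seq V) (z : int) (k : nat) (b1 b2 : bool) :
    z = k%:Z -> linked C z%:~R b1 b2 -> linked C k%:R b1 b2.
  by move=> ->.
have capA f m : let C := A (map f (u :: ws1)) m in
    linked C p%:R m (~~ (f u).1) /\ linked C (p + a)%:R (~~ m) (~~ (f u).2).
  have [] := linked_cap_start f a%:Z%:~R u szr1 (- p%:Z)%:~R m [::].
  rewrite res_head -!intrD -!intrB => L1 L2; split.
    by apply: pos L2; clear; lia.
  by apply: neg L1; clear; lia.
have capB f m : let C := B (map f (U :: ws2)) m in
    if low then linked C p%:R (f V').2 m /\ linked C (p + a)%:R (f V').1 (~~ m)
    else linked C p%:R (~~ m) (f V').1 /\ linked C (p + a)%:R m (f V').2.
  have [] := linked_cap_end f a%:Z%:~R U szr2 mid%:~R m [::].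
  rewrite last2 res_zig_last -/te -!intrD -!intrB => L1 L2.
  have : if low then mid = te + p%:Z + a%:Z else mid = te - p%:Z.
    by rewrite /mid /w -/low; case: (low).
  case: (low) => midE; split.
  - by apply: neg L2; rewrite midE; clear; lia.
  - by apply: pos L1; rewrite midE; clear; lia.
  - by apply: neg L1; rewrite midE; clear; lia.
  - by apply: pos L2; rewrite midE; clear; lia.
have [P1 Q1] := capA fst m1; have [P2 Q2] := capA snd m2.
have := capB fst n1; have := capB snd n2.
have R1 := linked_rung_end fst a%:Z%:~R u szr1 [:: ((- p%:Z)%:~R : Z, m1)].
have R2 := linked_rung_end snd a%:Z%:~R u szr1 [:: ((- p%:Z)%:~R : Z, m2)].
have R3 := linked_rung_start fst a%:Z%:~R U szr2 [:: (mid%:~R : Z, n1)].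
have R4 := linked_rung_start snd a%:Z%:~R U szr2 [:: (mid%:~R : Z, n2)].
rewrite last1 in R1 R2.
have S4 : {subset [:: F1.1; F2.1; F1.2; F2.2] <= cycles [:: F1; F2]} by [].
move: fpb; case: (low) => /andP[fp fb] [P4 Q4] [P3 Q3];
  move=> d; rewrite !in_cons mem_cat => /or4P[/eqP ->|/eqP ->|/eqP ->|/orP[dX|dY]].
- exact: (four_covers fp P1 P2 P3 P4 S4).
- exact: (four_covers fa R1 R2 R3 R4 S4).
- exact: (four_covers fb Q1 Q2 Q3 Q4 S4).
- by apply: covers_sub (subset2 c11 c21) _; apply: doubles_res => //; rewrite /= sz1.
- by apply: covers_sub (subset2 c12 c22) _; apply: doubles_res => //; rewrite /= sz2.
- exact: (four_covers fp P1 P2 P3 P4 S4).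
- exact: (four_covers fa R1 R2 R3 R4 S4).
- exact: (four_covers fb Q1 Q2 Q3 Q4 S4).
- by apply: covers_sub (subset2 c11 c21) _; apply: doubles_res => //; rewrite /= sz1.
- by apply: covers_sub (subset2 c12 c22) _; apply: doubles_res => //; rewrite /= sz2.
Qed.

End Blocks.

(** * Nights with an odd and an even cycle *)

(** As in [odd_odd_spec], for two pairs of nights: primes mark the second pair, and
capital letters the even ladder.  The conditions belong to the differences a,
p + a, a', p + a' and p in this order. *)
Definition odd_even_spec (s e S E s' e' S' E' : vec) (m1 m2 m3 m4 : bool) :=
  [&& all4 [:: e.1; E.1; (~~ S.1.1, ~~ S.1.2); (~~ s'.1.1, m3)],
      all4 [:: e'.1; E'.1; (~~ S'.1.1, ~~ S'.1.2); (~~ m1, ~~ s.1.2)],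
      all4 [:: e.2; E.2; (~~ S.2.1, ~~ S.2.2); (~~ s'.2.1, m4)],
      all4 [:: e'.2; E'.2; (~~ S'.2.1, ~~ S'.2.2); (~~ m2, ~~ s.2.2)]
    & all4 [:: (m1, ~~ s.1.1); (m2, ~~ s.2.1); (~~ m3, ~~ s'.1.2); (~~ m4, ~~ s'.2.2)]].

Lemma odd_even_labels x : exists s e S E s' e' S' E' m1 m2 m3 m4,
  [/\ label_ends x s e, label_ends x s' e', orth S E, orth S' E'
    & odd_even_spec s e S E s' e' S' E' m1 m2 m3 m4].
Proof.
pose V0001 := Vec false false false true; pose V0011 := Vec false false true true.
pose V0110 := Vec false true true false; pose V0101 := Vec false true false true.
pose V1010 := Vec true false true false; pose V1001 := Vec true false false true.
case: x => [|x].
  by exists V0001, V0001, V0011, V0110, V0101, V0101, V0101, V0011, false, true, false, true.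
by exists V0011, V0101, V0011, V1010, V1001, V0101, V0101, V0011, false, true, false, true.
Qed.

Section Blocks.
Variable n : nat.
Hypothesis n_gt1 : (1 < n)%N.
Local Notation Z := 'Z_n.
Local Notation V := (Z * bool)%type.
Local Notation sp := (@spouse Z).
Local Notation res := (@res n).

Lemma seats_cap_start zs1 zs2 (h c : nat) (mid : int) vs1 vs2 (m : bool) :
    uniq (zs1 ++ zs2) -> {in zs1 ++ zs2, forall z : int, 0 <= z <= h%:Z} ->
    (h < c)%N -> (c + h < n)%N -> c%:Z + h%:Z - n%:Z < mid < n%:Z ->
    mid \notin zs1 ++ zs2 -> mid - c%:Z \notin zs1 ++ zs2 ->
    size vs1 = size zs1 -> size vs2 = size zs2 ->
  seats sp (2 * size zs1 + 1)%N (2 * size zs2)%N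
    (ladder c%:Z%:~R (res zs1) vs1 [::] [:: (mid%:~R : Z, m)],
     ladder c%:Z%:~R (res zs2) vs2 [::] [::]).
Proof.
move=> U w hc cn hmid n1 n2 s1 s2.
have := @ladder_pair n n_gt1 (Num.min mid 0) c zs1 zs2 vs1 vs2
  [::] [:: (mid%:~R : Z, m)] [::] [::] [::] [:: mid] [::] [::].
rewrite /= !addn0; apply=> //.
  rewrite catA cats1 rcons_uniq (zones_uniq U w hc) andbT mem_cat negb_or n1 /=.
  by apply: contra n2 => /mapP[x xz ->]; rewrite addrK.
move=> x; rewrite catA mem_cat => /orP[|]; last first.
  by rewrite mem_seq1 => /eqP ->; clear -hmid; lia.
rewrite mem_cat => /orP[/w|/mapP[y /w wy ->]]; first by clear -cn hmid hc; lia.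
by move: wy; clear -hmid cn; lia.
Qed.

(** An odd ladder with cap [mid] over [zs1] and an even one over [zs2], both with
shift [c], visit different couples. *)
Definition fits (c : nat) (zs1 zs2 : seq int) (mid : int) : Prop :=
  forall vs1 vs2 m, size vs1 = size zs1 -> size vs2 = size zs2 ->
  seats sp (2 * size zs1 + 1)%N (2 * size zs2)%N
    (ladder c%:Z%:~R (res zs1) vs1 [::] [:: (mid%:~R : Z, m)],
     ladder c%:Z%:~R (res zs2) vs2 [::] [::]).

Lemma fits_window X g Y v up (h c : nat) (mid : int) :
    descending (X ++ g :: Y) -> (head 0%N (X ++ g :: Y) <= h)%N ->
    zig 0 true (X ++ g :: Y) = zig 0 true X ++ zig v up Y ->
    (h < c)%N -> (c + h < n)%N -> h%:Z < mid < c%:Z \/ c%:Z + h%:Z - n%:Z < mid < 0 ->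
  fits c (zig 0 true X) (zig v up Y) mid.
Proof.
move=> dD hD zE hc cn hmid vs1 vs2 m s1 s2.
have w x : x \in zig 0 true X ++ zig v up Y -> 0 <= x <= h%:Z.
  by rewrite -zE => /(zig_window dD); rewrite add0r; clear -hD; lia.
apply: (@seats_cap_start _ _ h) => //; first by rewrite -zE; apply: zig_uniq.
- by clear -hmid cn hc; lia.
- by apply/negP => /w; clear -hmid; lia.
- by apply/negP => /w; clear -hmid hc; lia.
Qed.

(** The nights have the shifts a, a', p + a and p + a'.  Each has three rungs and
one cap.  In the first two nights the cap is [p] below the start of the path and
has edges of differences p and p + a, or p and p + a'; in the others it is [a] or
[a'] above it and has edges of differences a and p, or a' and p.  So each shift is
the difference of three rungs and of one edge of a cap, and [p] is left with four
edges of caps. *)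
Lemma block_odd_even (X : seq nat) t up Y v up1 X' t' up' Y' v' up1' p a a' :
    size X' = size X -> size Y' = size Y -> Y != [::] ->
    (forall c, c \in [:: a; a'] -> fits c (zig t up X) (zig v up1 Y) (t - p%:Z)) ->
    (forall c, c \in [:: a; a'] ->
       fits (p + c)%N (zig t' up' X') (zig v' up1' Y') (t' + c%:Z)) ->
  base n 4 (2 * size X + 3)%N (2 * (size Y).+1)%N
    (p :: a :: (p + a)%N :: a' :: (p + a')%N :: (X ++ Y) ++ (X' ++ Y')).
Proof.
move=> szX' szY' Y0 fit fit'.
have [s [e [S [E [s' [e' [S' [E' [m1 [m2 [m3 [m4 []]]]]]]]]]]]] := odd_even_labels (size X).
move=> lx lx' oY oY' /and5P[fa fb fa' fb' fp].
have Yends S0 E0 : orth S0 E0 -> label_ends (size Y) S0 E0 by case: (Y) Y0.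
have [ws1 [sz1 last1 o1]] := label_path lx.
have [ws2 [sz2 last2 o2]] := label_path (Yends _ _ oY).
have [ws1' [sz1' last1' o1']] := label_path lx'.
have [ws2' [sz2' last2' o2']] := label_path (Yends _ _ oY').
set zs1 := zig t up X in fit; set zs2 := zig v up1 Y in fit.
set zs1' := zig t' up' X' in fit'; set zs2' := zig v' up1' Y' in fit'.
pose A (c : nat) zs vs (z : int) m := ladder c%:Z%:~R (res zs) vs [::] [:: (z%:~R : Z, m)].
pose B (c : nat) zs vs := ladder c%:Z%:~R (res zs) vs [::] [::].
pose F1 := (A a zs1 (map fst (s :: ws1)) (t - p%:Z) m1, B a zs2 (map fst (S :: ws2))).
pose F2 := (A a' zs1 (map snd (s :: ws1)) (t - p%:Z) m2, B a' zs2 (map snd (S :: ws2))).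
pose F3 := (A (p + a)%N zs1' (map fst (s' :: ws1')) (t' + a%:Z) m3,
            B (p + a)%N zs2' (map fst (S' :: ws2'))).
pose F4 := (A (p + a')%N zs1' (map snd (s' :: ws1')) (t' + a'%:Z) m4,
            B (p + a')%N zs2' (map snd (S' :: ws2'))).
have szr1 : size (res zs1) = (size ws1).+1 by rewrite size_map size_zig sz1.
have szr2 : size (res zs2) = (size ws2).+1 by rewrite size_map size_zig sz2.
have szr1' : size (res zs1') = (size ws1').+1 by rewrite size_map size_zig szX' sz1'.
have szr2' : size (res zs2') = (size ws2').+1 by rewrite size_map size_zig szY' sz2'.
exists [:: F1; F2; F3; F4]; split=> //.
  have X2 : (2 * size X + 3 = 2 * size zs1 + 1)%N by rewrite size_zig; clear; lia.
  have Y2 : (2 * (size Y).+1 = 2 * size zs2)%N by rewrite size_zig.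
  have X2' : (2 * size X + 3 = 2 * size zs1' + 1)%N by rewrite size_zig szX'; clear; lia.
  have Y2' : (2 * (size Y).+1 = 2 * size zs2')%N by rewrite size_zig szY'.
  rewrite /= !andbT {1 2}X2 {1 2}Y2 X2' Y2'.
  have [i1 i2] : a \in [:: a; a'] /\ a' \in [:: a; a'] by rewrite !in_cons !eqxx orbT.
  by apply/and4P; split; [apply: (fit _ i1)|apply: (fit _ i2)|apply: (fit' _ i1)|apply: (fit' _ i2)];
     rewrite /= size_map size_zig ?sz1 ?sz2 ?sz1' ?sz2' ?szX' ?szY'.
have cap (c : nat) zs v0 up0 D (f : vec -> bool * bool) u ws (z : int) m :
   size (res zs) = (size ws).+1 ->
   zs = zig v0 up0 D -> let C := A c zs (map f (u :: ws)) z m in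
   linked C (z - v0 - c%:Z)%:~R (~~ (f u).2) (~~ m) /\ linked C (v0 - z)%:~R m (~~ (f u).1).
  move=> sz zsE; have [] := linked_cap_start f c%:Z%:~R u sz z%:~R m [::].
  by rewrite (_ : head 0 (res zs) = v0%:~R) ?zsE ?res_head // -!intrD -!intrB opprD addrA.
have [Q1 P1] := cap a zs1 t up X fst s ws1 (t - p%:Z) m1 szr1 erefl.
have [Q2 P2] := cap a' zs1 t up X snd s ws1 (t - p%:Z) m2 szr1 erefl.
have [P3 Q3] := cap (p + a)%N zs1' t' up' X' fst s' ws1' (t' + a%:Z) m3 szr1' erefl.
have [P4 Q4] := cap (p + a')%N zs1' t' up' X' snd s' ws1' (t' + a'%:Z) m4 szr1' erefl.
have neg (C : seq V) (z : int) (k : nat) (x y : bool) :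
    z = - k%:Z -> linked C z%:~R x y -> linked C k%:R y x.
  by move=> -> /linkedN; rewrite -intrN opprK.
have pos (C : seq V) (z : int) (k : nat) (x y : bool) :
    z = k%:Z -> linked C z%:~R x y -> linked C k%:R x y.
  by move=> ->.
have sub cs : all (fun c => c \in [:: F1.1; F2.1; F3.1; F4.1; F1.2; F2.2; F3.2; F4.2]) cs ->
    {subset cs <= cycles [:: F1; F2; F3; F4]} by move/allP.
have RA (f : vec -> bool * bool) u ws zs (c : nat) cap0 : size (res zs) = (size ws).+1 ->
    linked (ladder c%:Z%:~R (res zs) (map f (u :: ws)) [::] cap0) c%:R
      (f (last u ws)).1 (f (last u ws)).2.
  by move=> sz; apply: linked_rung_end.
have RB (f : vec -> bool * bool) u ws zs (c : nat) : size (res zs) = (size ws).+1 ->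
    linked (ladder c%:Z%:~R (res zs) (map f (u :: ws)) [::] [::]) c%:R
      (~~ (f u).1) (~~ (f u).2).
  by move=> sz; apply: linked_rung_start.
have R1 := RA fst s ws1 zs1 a [:: ((t - p%:Z)%:~R : Z, m1)] szr1.
have R2 := RA snd s ws1 zs1 a' [:: ((t - p%:Z)%:~R : Z, m2)] szr1.
have R3 := RA fst s' ws1' zs1' (p + a)%N [:: ((t' + a%:Z)%:~R : Z, m3)] szr1'.
have R4 := RA snd s' ws1' zs1' (p + a')%N [:: ((t' + a'%:Z)%:~R : Z, m4)] szr1'.
have E1 := RA fst S ws2 zs2 a [::] szr2; have S1 := RB fst S ws2 zs2 a szr2.
have E2 := RA snd S ws2 zs2 a' [::] szr2; have S2 := RB snd S ws2 zs2 a' szr2.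
have E3 := RA fst S' ws2' zs2' (p + a)%N [::] szr2'.
have S3 := RB fst S' ws2' zs2' (p + a)%N szr2'.
have E4 := RA snd S' ws2' zs2' (p + a')%N [::] szr2'.
have S4 := RB snd S' ws2' zs2' (p + a')%N szr2'.
rewrite last1 in R1 R2; rewrite last1' in R3 R4.
rewrite last2 in E1 E2; rewrite last2' in E3 E4.
move=> d; rewrite !in_cons => /or4P[/eqP ->|/eqP ->|/eqP ->|].
- apply: (four_covers fp (k1 := F1.1) (k2 := F2.1) (k3 := F3.1) (k4 := F4.1)).
  + by apply: pos P1; clear; lia.
  + by apply: pos P2; clear; lia.
  + by apply: neg P3; clear; lia.
  + by apply: neg P4; clear; lia.
  + by apply: sub; rewrite /= !inE !eqxx !orbT.
- apply: (four_covers fa R1 E1 S1 (neg _ _ _ _ _ _ Q3)); first by clear; clear; lia.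
  by apply: sub; rewrite /= !inE !eqxx !orbT.
- apply: (four_covers fb R3 E3 S3 (neg _ _ _ _ _ _ Q1)); first by clear; lia.
  by apply: sub; rewrite /= !inE !eqxx !orbT.
case/or3P=> [/eqP ->|/eqP ->|].
- apply: (four_covers fa' R2 E2 S2 (neg _ _ _ _ _ _ Q4)); first by clear; lia.
  by apply: sub; rewrite /= !inE !eqxx !orbT.
- apply: (four_covers fb' R4 E4 S4 (neg _ _ _ _ _ _ Q2)); first by clear; lia.
  by apply: sub; rewrite /= !inE !eqxx !orbT.
rewrite !mem_cat => /orP[/orP[]|/orP[]] dd.
- apply: (@covers_sub _ [:: F1.1; F2.1]); first by apply: sub; rewrite /= !inE !eqxx !orbT.
  by apply: doubles_res => //; rewrite /= sz1.
- apply: (@covers_sub _ [:: F1.2; F2.2]); first by apply: sub; rewrite /= !inE !eqxx !orbT.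
  by apply: doubles_res => //; rewrite /= sz2.
- apply: (@covers_sub _ [:: F3.1; F4.1]); first by apply: sub; rewrite /= !inE !eqxx !orbT.
  by apply: doubles_res => //; rewrite /= sz1' szX'.
- apply: (@covers_sub _ [:: F3.2; F4.2]); first by apply: sub; rewrite /= !inE !eqxx !orbT.
  by apply: doubles_res => //; rewrite /= sz2' szY'.
Qed.

End Blocks.

(** * Descending intervals *)

Fixpoint down (u l : nat) : seq nat :=
  if l is l'.+1 then (u + l)%N :: down u l' else [::].

Lemma size_down u l : size (down u l) = l.
Proof. by elim: l => //= l ->. Qed.

Lemma mem_down u l d : (d \in down u l) = (u < d <= u + l)%N.
Proof.
elim: l => [|l IH]; first by rewrite addn0; case: ltngtP.
by rewrite /= in_cons IH; lia.
Qed.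

Lemma descending_cons g D : (head 0%N D < g)%N -> descending D -> descending (g :: D).
Proof. by rewrite /descending; case: D => [|d D] /= -> //. Qed.

Lemma descending_down u l D : ((0 < l)%N -> (head 0%N D <= u)%N) -> descending D ->
  descending (down u l ++ D).
Proof.
move=> hu dD; elim: l hu => //= l IH hu.
apply: descending_cons; last by apply: IH => _; apply: hu.
by case: l {IH} hu => [|l] /= hu; have := hu isT; lia.
Qed.

Lemma head_down u l D h : (l = 0%N -> head 0%N D <= h)%N -> ((0 < l)%N -> u + l <= h)%N ->
  (head 0%N (down u l ++ D) <= h)%N.
Proof. by case: l => [|l] //= h0 h1; [apply: h0 | apply: h1]. Qed.

Lemma descending_down0 u l : descending (down u l).
Proof. by rewrite -[down u l]cats0; apply: descending_down. Qed.

Lemma head_down0 u l : (head 0%N (down u l) <= u + l)%N.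
Proof. by case: l. Qed.

Section Blocks.
Variable n : nat.
Hypothesis n_gt1 : (1 < n)%N.
Local Notation Z := 'Z_n.
Local Notation V := (Z * bool)%type.
Local Notation sp := (@spouse Z).
Local Notation res := (@res n).

(** * Cycles of length four *)

Lemma digon_linked (t f : Z) b : let D : seq V := [:: (t, false); (t + f, b)] in
  linked D f false (~~ b) /\ linked D f true b.
Proof.
split.
  have := @dart_next V sp [::] (t, false) (t + f, b) [::].
  by move/joined_dart => /rung_linked.
have := @dart_last V sp (t, false) [:: (t + f, b)].
by move/joined_dart; rewrite joinedC => /rung_linked.
Qed.

(** The digon has to avoid the couples of [B] and their translates by [- f], which
are fewer than [n]. *)
Lemma seats_digon (B : seq V) m2 (f : Z) b : f != 0 -> (2 * m2 < n)%N ->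
  seats sp 0 m2 ([::], B) ->
  exists t, seats sp 2 m2 ([:: (t, false); (t + f, b)], B).
Proof.
move=> f0 lt /and3P[_ /eqP /= szB UB].
pose bad := [set x in map fst B] :|: [set x - f | x in map fst B].
have [t tP] : exists t, t \in ~: bad.
  have cardZ : #|'Z_n| = n by rewrite card_ord Zp_cast.
  apply/card_gt0P; rewrite cardsCs setCK subn_gt0 cardZ.
  apply: leq_ltn_trans lt; apply: leq_trans (leq_card_setU _ _) _.
  rewrite mul2n -addnn -szB -(size_map fst B) leq_add //.
    by rewrite cardsE card_size.
  by apply: leq_trans (leq_imset_card _ _) (card_size _).
move: tP; rewrite in_setC in_setU inE negb_or => /andP[nt ntf].
have {}ntf : t + f \notin map fst B.
  by apply: contra ntf => tf; apply/imsetP; exists (t + f); rewrite ?addrK.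
exists t; rewrite /seats szB !eqxx /=.
have out x c : x \notin map fst B -> ((x, c) \in B ++ map sp B) = false.
  move=> nx; apply/negP; rewrite mem_cat => /orP[|/mapP[y yB [E _]]].
    by move/(map_f fst) => /=; apply/negP.
  by rewrite E map_f in nx.
have tf : (t == t + f) = false by rewrite -subr_eq0 opprD addrA subrr sub0r oppr_eq0 (negPf f0).
have P : perm_eq ((t, false) :: (t + f, b) :: B ++ sp (t, false) :: sp (t + f, b) :: map sp B)
   ((t, false) :: sp (t, false) :: (t + f, b) :: sp (t + f, b) :: B ++ map sp B).
  by apply/permP=> x; rewrite /= !count_cat /= !addnA; clear;
     move: (nat_of_bool _) (nat_of_bool _) (nat_of_bool _) (nat_of_bool _) => *; lia.
apply: etrans (perm_uniq P) _; rewrite /= UB !in_cons !out // !orbF.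
rewrite /spouse /= !xpair_eqE /= tf eqxx andbT /=.
by rewrite eqxx; case: (b).
Qed.

(** Each [f] is given to two nights, whose digons use the ends in the two possible
ways. *)
Lemma with_digons r m2 Ds fs :
    (2 * m2 < n)%N -> size fs = r -> {in fs, forall f, (0 < f < n)%N} ->
  base n (2 * r) 0 m2 Ds -> base n (2 * r) 2 m2 (fs ++ Ds).
Proof.
move=> lt szf fP [Bs [szB ok C]].
pose G i := (nth ([::], [::]) Bs i).2.
have fok i : (i < 2 * r)%N -> exists t : Z,
    seats sp 2 m2 ([:: (t, false); (t + (nth 0%N fs i./2)%:R, odd i)], G i).
  move=> lti; apply: seats_digon => //.
    have /fP/andP[f0 fn] : nth 0%N fs i./2 \in fs by rewrite mem_nth // szf; lia.
    apply/negP => /eqP/(congr1 val); rewrite /= val_Zp_nat // modn_small //; lia.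
  have : nth ([::], [::]) Bs i \in Bs by rewrite mem_nth ?szB.
  move/(allP ok); rewrite /G; case: (nth _ _ _) => A B /= s.
  have A0 : A = [::] by apply: size0nil; case/and3P: s => /eqP.
  by rewrite -A0.
pose t i : Z := odflt 0 [pick t : Z | seats sp 2 m2
   ([:: (t, false); (t + (nth 0%N fs i./2)%:R, odd i)], G i)].
pose F i : seq V * seq V := ([:: (t i, false); (t i + (nth 0%N fs i./2)%:R, odd i)], G i).
exists (mkseq F (2 * r)%N); rewrite size_mkseq; split=> //.
  apply/allP=> _ /mapP[i li ->]; move: li; rewrite mem_iota add0n => /andP[_ /fok [t0 ht0]].
  by rewrite /F /t; case: pickP => [t1 ok1|/(_ t0)]; [exact: ok1 | rewrite ht0].
move=> d; rewrite mem_cat => /orP[df|dD].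
  pose j := index d fs.
  have ltj : (j < r)%N by rewrite -szf index_mem.
  have dj : nth 0%N fs j = d by rewrite nth_index.
  have dig i : (i < 2 * r)%N -> i./2 = j -> exists2 c, c \in cycles (mkseq F (2 * r)%N)
      & linked c d%:R false (~~ odd i) /\ linked c d%:R true (odd i).
    move=> lti ij; exists (F i).1; first by apply: mem_cycles1; rewrite map_f // mem_iota.
    by rewrite /F ij dj; apply: digon_linked.
  have [||c0 c0in [L1 L2]] := dig (2 * j)%N; [by lia|by lia|].
  have [||c1 c1in [L3 L4]] := dig (2 * j).+1; [by lia|by lia|].
  rewrite /= mul2n odd_double in L1 L2 L3 L4.
  by apply: covers_intro; [exists c1|exists c0|exists c0|exists c1].
move=> a b; have [c cin lc] := C d dD a b; exists c => //.
move: cin lc; rewrite mem_cat => /orP[]/mapP[B BB ->].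
  case/and3P: (allP ok _ BB) => /nilP -> _ _ [x].
  by rewrite /joined.
move=> _; have ltB : (index B Bs < 2 * r)%N by rewrite -szB index_mem.
rewrite (_ : B.2 = (F (index B Bs)).2); last by rewrite /= /G nth_index.
by apply: mem_cycles2; rewrite map_f // mem_iota.
Qed.

(** * Nights with a single ladder *)

(** In two nights, the two rungs join the ends in all ways. *)
Lemma block_even (Y : seq nat) c (h := head 0%N Y) :
    descending Y -> (h < c)%N -> (c + h < n)%N ->
  base n 2 0 (2 * (size Y).+1)%N (c :: Y).
Proof.
move=> dY hc hn.
have [u [v [luv f4]]] := rung_labels (size Y).
have [ws [sz lw o]] := label_path luv.
set zs := zig 0 true Y.
pose B vs : seq V := ladder c%:Z%:~R (res zs) vs [::] [::].
have szr : size (res zs) = (size ws).+1 by rewrite size_map size_zig sz.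
pose F1 : seq V * seq V := ([::], B (map fst (u :: ws))).
pose F2 : seq V * seq V := ([::], B (map snd (u :: ws))).
have wz x : x \in zs -> 0 <= x <= h%:Z.
  by move=> /(zig_window dY); rewrite add0r.
exists [:: F1; F2]; split=> //.
  have ok vs : size vs = (size Y).+1 -> seats sp 0 (2 * (size Y).+1)%N ([::], B vs).
    move=> sv; have := @ladder_pair n n_gt1 0 c [::] zs [::] vs [::] [::] [::] [::]
      [::] [::] [::] [::].
    rewrite /= !addn0 !cats0 size_zig; apply=> //.
      by apply: zones_uniq wz hc; apply: zig_uniq.
    by move=> z; rewrite mem_cat => /orP[/wz|/mapP[y /wz wy ->]]; [|move: wy]; clear -hn hc; lia.
  by rewrite /= andbT; apply/andP; split; apply: ok; rewrite /= size_map sz.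
have m1 : F1.2 \in cycles [:: F1; F2] by apply: mem_cycles2; rewrite mem_head.
have m2 : F2.2 \in cycles [:: F1; F2] by apply: mem_cycles2; rewrite !in_cons eqxx orbT.
have E1 := linked_rung_end fst c%:Z%:~R u szr [::]; rewrite lw in E1.
have E2 := linked_rung_end snd c%:Z%:~R u szr [::]; rewrite lw in E2.
have S1 := linked_rung_start fst c%:Z%:~R u szr [::].
have S2 := linked_rung_start snd c%:Z%:~R u szr [::].
move=> d; rewrite in_cons => /orP[/eqP ->|dY'].
  apply: (four_covers f4 E1 E2 S1 S2); apply/allP.
  by rewrite /= m1 m2.
by apply: covers_sub (subset2 m1 m2) _; apply: doubles_res => //; rewrite /= sz.
Qed.

(** Four nights with the same shift: each has one rung and one cap, hence one edge
of each of the differences a, p and p + a. *)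
Lemma block_odd (X X' : seq nat) p a h :
    size X' = size X -> descending X -> descending X' -> (0 < p)%N ->
    (head 0 X <= h)%N -> (head 0 X' <= h)%N -> (h < a)%N -> (p + a + h < n)%N ->
  base n 4 0 (2 * size X + 3)%N (p :: a :: (p + a)%N :: X ++ X').
Proof.
move=> szX' dX dX' p_gt0 hX hX' ha hn.
have [s [e [s' [e' [m1 [m2 [m3 [m4]]]]]]]] : exists s e s' e' : vec,
    exists m1 m2 m3 m4 : bool, [/\ label_ends (size X) s e, label_ends (size X) s' e',
    all4 [:: e.1; e.2; e'.1; e'.2],
    all4 [:: (m1, ~~ s.1.1); (m2, ~~ s.2.1); (m3, ~~ s'.1.1); (m4, ~~ s'.2.1)]
  & all4 [:: (~~ m1, ~~ s.1.2); (~~ m2, ~~ s.2.2); (~~ m3, ~~ s'.1.2); (~~ m4, ~~ s'.2.2)]].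
  case: (size X) => [|x].
    by exists (Vec false false false true), (Vec false false false true),
       (Vec true false true true), (Vec true false true true), false, true, true, false.
  by exists (Vec false true true false), (Vec false false true true),
       (Vec false false true true), (Vec false true true false), true, true, false, false.
case=> l l' fa fp fb.
have [ws [sz lw o]] := label_path l; have [ws' [sz' lw' o']] := label_path l'.
set zs := zig 0 true X; set zs' := zig 0 true X'.
pose A z vs m : seq V := ladder a%:Z%:~R (res z) vs [::] [:: ((- p%:Z)%:~R : Z, m)].
pose F1 : seq V * seq V := ([::], A zs (map fst (s :: ws)) m1).
pose F2 : seq V * seq V := ([::], A zs (map snd (s :: ws)) m2).
pose F3 : seq V * seq V := ([::], A zs' (map fst (s' :: ws')) m3).
pose F4 : seq V * seq V := ([::], A zs' (map snd (s' :: ws')) m4).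
have szr : size (res zs) = (size ws).+1 by rewrite size_map size_zig sz.
have szr' : size (res zs') = (size ws').+1 by rewrite size_map size_zig szX' sz'.
exists [:: F1; F2; F3; F4]; split=> //.
  have ok D vs m : descending D -> (head 0 D <= h)%N -> size D = size X ->
      size vs = (size X).+1 ->
      seats sp 0 (2 * size X + 3)%N ([::], A (zig 0 true D) vs m).
    move=> dD hD szD szv; apply: (@seats_swap _ _ _ _ (_, _)).
    have := @seats_cap_start n n_gt1 (zig 0 true D) [::] h a (- p%:Z) vs [::] m.
    have -> : (2 * size X + 3 = 2 * size (zig 0 true D) + 1)%N.
      by rewrite size_zig szD; clear; lia.
    rewrite cats0; have w z : z \in zig 0 true D -> 0 <= z <= h%:Z.
      by move=> /(zig_window dD); rewrite add0r; clear -hD; lia.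
    apply=> //; rewrite ?size_zig ?szD //; first exact: zig_uniq.
    - by clear -hn; lia.
    - by clear -hn p_gt0; lia.
    - by apply/negP => /w; clear -p_gt0; lia.
    - by apply/negP => /w; clear -p_gt0; lia.
  rewrite /= andbT; apply/and4P; split; apply: ok => //=; by rewrite size_map ?sz ?sz' ?szX'.
have S4 : {subset [:: F1.2; F2.2; F3.2; F4.2] <= cycles [:: F1; F2; F3; F4]}.
  by move=> c cin; rewrite mem_cat; apply/orP; right.
have cap D (f : vec -> bool * bool) u us m : size (res (zig 0 true D)) = (size us).+1 ->
    let C := A (zig 0 true D) (map f (u :: us)) m in
    linked C p%:R m (~~ (f u).1) /\ linked C (p + a)%:R (~~ m) (~~ (f u).2).
  move=> szD; have [] := linked_cap_start f a%:Z%:~R u szD (- p%:Z)%:~R m [::].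
  rewrite res_head mulr0z add0r sub0r -intrB -intrN opprK => L1 L2; split=> //.
  move/linkedN: L1; rewrite -intrN.
  by rewrite (_ : - (- p%:Z - a%:Z) = (p + a)%N) //; clear; lia.
have [P1 Q1] := cap X fst s ws m1 szr; have [P2 Q2] := cap X snd s ws m2 szr.
have [P3 Q3] := cap X' fst s' ws' m3 szr'; have [P4 Q4] := cap X' snd s' ws' m4 szr'.
have R1 := linked_rung_end fst a%:Z%:~R s szr [:: ((- p%:Z)%:~R : Z, m1)].
have R2 := linked_rung_end snd a%:Z%:~R s szr [:: ((- p%:Z)%:~R : Z, m2)].
have R3 := linked_rung_end fst a%:Z%:~R s' szr' [:: ((- p%:Z)%:~R : Z, m3)].
have R4 := linked_rung_end snd a%:Z%:~R s' szr' [:: ((- p%:Z)%:~R : Z, m4)].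
rewrite lw in R1 R2; rewrite lw' in R3 R4.
move=> d; rewrite !in_cons => /or4P[/eqP ->|/eqP ->|/eqP ->|].
- exact: (four_covers fp P1 P2 P3 P4 S4).
- exact: (four_covers fa R1 R2 R3 R4 S4).
- exact: (four_covers fb Q1 Q2 Q3 Q4 S4).
rewrite mem_cat => /orP[] dd.
- apply: (@covers_sub _ [:: F1.2; F2.2]).
    by move=> c; rewrite !inE => /orP[]/eqP ->; rewrite eqxx !orbT.
  by apply: doubles_res => //; rewrite /= sz.
- apply: (@covers_sub _ [:: F3.2; F4.2]).
    by move=> c; rewrite !inE => /orP[]/eqP ->; rewrite eqxx !orbT.
  by apply: doubles_res => //; rewrite /= sz' szX'.
Qed.

End Blocks.

(** * Skolem sequences *)

Local Close Scope ring_scope.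

Ltac split_ifs := repeat (case: ifP => ?); lia.
(* On each interval of values one formula gives the difference that uses it. *)
Ltac upto q lo t p :=
  let h := fresh in
  case: (leqP q t) => h;
  [exists p; [lia | simpl; split_ifs] | clear lo; rename h into lo].

(** A hooked Skolem sequence of order 4s + 2, with position 8s + 4 left empty. *)
Lemma skolem_hooked s : 0 < s -> exists a : nat -> nat,
  [/\ forall p, 0 < p <= 4 * s + 2 -> 0 < a p /\ p + a p <= 8 * s + 5,
      1 < a (4 * s + 2)
    & forall q, 0 < q <= 8 * s + 5 -> q != 8 * s + 4 -> exists2 p, 0 < p <= 4 * s + 2
      & (q == a p) || (q == p + a p)].
Proof.
move=> s0.
exists (fun p => if ~~ odd p then (if p == 4 * s + 2 then 4 * s + 3 else 2 * s + 1 - p./2)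
  else if p == 1 then 7 * s + 3
  else if p == 4 * s + 1 then 2 * s + 1
  else if p == 2 * s + 1 then 4 * s + 2
  else if 2 * s + 1 < p then 4 * s + 3 + (4 * s + 1 - p)./2
  else 5 * s + 2 + (2 * s + 1 - p)./2); split.
- by move=> p; split_ifs.
- by split_ifs.
move=> q /andP[lo hi] nh.
upto q lo (2 * s) (2 * (2 * s + 1 - q)).
upto q lo (2 * s + 1) (4 * s + 1).
upto q lo (4 * s + 1) (2 * (q - (2 * s + 1))).
upto q lo (4 * s + 2) (2 * s + 1).
upto q lo (4 * s + 3) (4 * s + 2).
upto q lo (5 * s + 2) (4 * s + 1 - 2 * (q - (4 * s + 3))).
upto q lo (6 * s + 1) (2 * s + 1 - 2 * (q - (5 * s + 2))).
upto q lo (6 * s + 2) (4 * s + 1).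
upto q lo (6 * s + 3) (2 * s + 1).
upto q lo (7 * s + 2) (2 * s + 1 - 2 * (7 * s + 3 - q)).
upto q lo (7 * s + 4) 1.
upto q lo (8 * s + 3) (4 * s + 1 - 2 * (8 * s + 4 - q)).
by exists (4 * s + 2); [lia | split_ifs].
Qed.

(** A Skolem sequence of order 4s. *)
Lemma skolem_even s : 1 < s -> exists a : nat -> nat,
  [/\ forall p, 0 < p <= 4 * s -> 0 < a p /\ p + a p <= 8 * s,
      1 < a (4 * s)
    & forall q, 0 < q <= 8 * s -> exists2 p, 0 < p <= 4 * s
      & (q == a p) || (q == p + a p)].
Proof.
move=> s0.
exists (fun p => if ~~ odd p then 6 * s - p./2
  else if p == 1 then s
  else if p == 2 * s - 1 then 2 * s
  else if p == 2 * s + 1 then s - 1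
  else if p == 4 * s - 1 then 2 * s + 1
  else if 2 * s + 1 < p then (4 * s - 1 - p)./2
  else s + 1 + (2 * s - 1 - p)./2); split.
- by move=> p; split_ifs.
- by split_ifs.
move=> q /andP[lo hi].
upto q lo (s - 2) (4 * s - 1 - 2 * q).
upto q lo (s - 1) (2 * s + 1).
upto q lo (s + 1) 1.
upto q lo (2 * s - 1) (4 * s + 1 - 2 * q).
upto q lo (2 * s) (2 * s - 1).
upto q lo (2 * s + 1) (4 * s - 1).
upto q lo (3 * s - 1) (2 * q - 4 * s - 1).
upto q lo (3 * s) (2 * s + 1).
upto q lo (4 * s - 2) (2 * q - 4 * s + 1).
upto q lo (4 * s - 1) (2 * s - 1).
upto q lo (6 * s - 1) (2 * (6 * s - q)).
upto q lo (6 * s) (4 * s - 1).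
by exists (2 * (q - 6 * s)); [lia | split_ifs].
Qed.

(** If [k] is odd, then the order 2k is 2 modulo 4 and the sequence is hooked: it
uses the position 4k + 1 instead of 4k. *)
Lemma skolem k : 0 < k -> exists a : nat -> nat,
  [/\ forall p, 0 < p <= 2 * k -> 0 < a p /\ p + a p <= 4 * k + 1,
      1 < a (2 * k)
    & forall q, 0 < q <= 4 * k -> exists2 p, 0 < p <= 2 * k &
      [|| q == a p, q == p + a p | (q == 4 * k) && (p + a p == 4 * k + 1)]].
Proof.
move=> k0; have [od|ev] := boolP (odd k).
  have [k1|k1] := eqVneq k 1.
    exists (fun p => if p == 1 then 1 else 3); rewrite k1; split=> //.
      by move=> p; split_ifs.
    move=> q qP; have [?|?] := leqP q 2; first by exists 1 => //=; lia.
    by exists 2 => //=; lia.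
  have [|a [ran top cov]] := @skolem_hooked k./2; first by lia.
  exists a; have kE : 2 * k = 4 * k./2 + 2 by lia.
  split=> [p pk||q qk].
  - by have := ran p; lia.
  - by rewrite kE.
  have [q4|q4] := eqVneq q (4 * k).
    have [||p pk ap] := cov (4 * k + 1); [by lia | by lia |].
    by have := ran p pk; exists p; first lia; apply/or3P/Or33; lia.
  have [||p pk ap] := cov q; [by lia | by lia |].
  by exists p; first lia; case/orP: ap => ->; rewrite ?orbT.
have [k2|k2] := eqVneq k 2.
  exists (fun p => if p == 1 then 1 else if p == 2 then 4 else if p == 3 then 5 else 3).
  rewrite k2; split=> //; first by move=> p; split_ifs.
  move=> q qP; have [?|?] := leqP q 2; first by exists 1 => //=; lia.
  have [?|?] := boolP ((q == 4) || (q == 6)); first by exists 2 => //=; lia.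
  have [?|?] := boolP ((q == 5) || (q == 8)); first by exists 3 => //=; lia.
  by exists 4 => //=; lia.
have [|a [ran top cov]] := @skolem_even k./2; first by lia.
exists a; have kE : 2 * k = 4 * k./2 by lia.
split=> [p pk||q qk].
- by have := ran p; lia.
- by rewrite kE.
have [|p pk ap] := cov q; first by lia.
by exists p; first lia; case/orP: ap => ->; rewrite ?orbT.
Qed.

(** Up to the difference [k], pairs of the same parity are nested.  The centres of the two
nests of even differences stay free, and they form a pair of difference [k]. *)
Lemma twofold_odd j : let k := 2 * j + 1 in exists a a' : nat -> nat,
  [/\ forall p, 0 < p <= k ->
        [/\ 0 < a p, 0 < a' p, p + a p <= 4 * k & p + a' p <= 4 * k],
      0 < j -> 1 < 4 * k + 1 - (k + a k) /\ 1 < 4 * k + 1 - (k + a' k)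
    & forall q, 0 < q <= 4 * k -> exists2 p, 0 < p <= k &
      [|| q == a p, q == p + a p, q == a' p | q == p + a' p]].
Proof.
move=> k.
exists (fun p => if p == k then 1 else if odd p then j + 1 - p./2 else 5 * j + 3 - p./2).
exists (fun p => if p == k then 5 * j + 3
                 else if odd p then 3 * j + 2 - p./2 else 7 * j + 4 - p./2).
rewrite /k {k}; split.
- by move=> p pk; split; split_ifs.
- by move=> j0; split; split_ifs.
move=> q /andP[lo hi].
upto q lo 1 (2 * j + 1).
upto q lo (j + 1) (2 * (j + 1 - q) + 1).
upto q lo (2 * j + 1) (2 * (q - (j + 1)) - 1).
upto q lo (2 * j + 2) (2 * j + 1).
upto q lo (3 * j + 2) (2 * (3 * j + 2 - q) + 1).
upto q lo (4 * j + 2) (2 * (q - (3 * j + 2)) - 1).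
upto q lo (5 * j + 2) (2 * (5 * j + 3 - q)).
upto q lo (5 * j + 3) (2 * j + 1).
upto q lo (6 * j + 3) (2 * (q - (5 * j + 3))).
upto q lo (7 * j + 3) (2 * (7 * j + 4 - q)).
upto q lo (7 * j + 4) (2 * j + 1).
by exists (2 * (q - (7 * j + 4))); [lia | split_ifs].
Qed.

(** As in [twofold_odd], the free centres of the two nests of even differences form
a pair of difference [k]. *)
Lemma twofold_even j : 0 < j -> let k := 2 * j in exists a a' : nat -> nat,
  [/\ forall p, 0 < p <= k ->
        [/\ 0 < a p, 0 < a' p, p + a p <= 4 * k & p + a' p <= 4 * k],
      1 < a k /\ 1 < a' k
    & forall q, 0 < q <= 4 * k -> exists2 p, 0 < p <= k &
      [|| q == a p, q == p + a p, q == a' p | q == p + a' p]].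
Proof.
move=> j0 k.
exists (fun p => if p == k then 4 * j + 1 else if odd p then j - p./2 else 5 * j + 1 - p./2).
exists (fun p => if p == k then 5 * j + 1
                 else if odd p then 3 * j - p./2 else 7 * j + 1 - p./2).
rewrite /k {k}; split.
- by move=> p pk; split; split_ifs.
- by split; split_ifs.
move=> q /andP[lo hi].
upto q lo j (2 * (j - q) + 1).
upto q lo (2 * j) (2 * (q - j) - 1).
upto q lo (3 * j) (2 * (3 * j - q) + 1).
upto q lo (4 * j) (2 * (q - 3 * j) - 1).
upto q lo (4 * j + 1) (2 * j).
upto q lo (5 * j) (2 * (5 * j + 1 - q)).
upto q lo (5 * j + 1) (2 * j).
upto q lo (6 * j) (2 * (q - (5 * j + 1))).
upto q lo (6 * j + 1) (2 * j).
upto q lo (7 * j) (2 * (7 * j + 1 - q)).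
upto q lo (7 * j + 1) (2 * j).
by exists (2 * (q - (7 * j + 1))); [lia | split_ifs].
Qed.

(** For odd [k] the sequence is read backwards, which makes the pairs of difference
[k] avoid the first position. *)
Lemma twofold_skolem k : 0 < k -> exists a a' : nat -> nat,
  [/\ forall p, 0 < p <= k ->
        [/\ 0 < a p, 0 < a' p, p + a p <= 4 * k & p + a' p <= 4 * k],
      1 < k -> 1 < a k /\ 1 < a' k
    & forall q, 0 < q <= 4 * k -> exists2 p, 0 < p <= k &
      [|| q == a p, q == p + a p, q == a' p | q == p + a' p]].
Proof.
move=> k0; have [od|ev] := boolP (odd k); last first.
  have [|a [a' [ran top cov]]] := @twofold_even k./2; first by lia.
  have kE : 2 * k./2 = k by lia.
  by rewrite kE in ran top cov; exists a, a'.
have [b [b' [ran top cov]]] := twofold_odd k./2.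
have kE : 2 * k./2 + 1 = k by lia.
rewrite kE in ran top cov.
exists (fun p => 4 * k + 1 - (p + b p)), (fun p => 4 * k + 1 - (p + b' p)).
split; first by move=> p pk; have [? ? ? ?] := ran p pk; split; lia.
  by move=> k1; apply: top; lia.
move=> q qk; have [|p pk pq] := cov (4 * k + 1 - q); first by lia.
by exists p => //; have [] := ran p pk; move: (b p) (b' p) pq; lia.
Qed.

(** * Couples modulo 2mk + 1 *)

Lemma down_tile u y K d : u < d <= u + K * y ->
  exists2 j, j < K & d \in down (u + j * y) y.
Proof.
move=> ud; have y_gt0 : 0 < y by case: y ud => //; lia.
exists ((d - u).-1 %/ y); first by rewrite ltn_divLR //; lia.
have := divn_eq (d - u).-1 y; have := ltn_pmod (d - u).-1 y_gt0.
by rewrite mem_down; lia.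
Qed.

Lemma mem_flatten_iota (Ds : nat -> seq nat) K j d : j < K -> d \in Ds j ->
  d \in flatten [seq Ds j | j <- iota 0 K].
Proof.
move=> jK dD; apply/flattenP; exists (Ds j) => //.
by apply/mapP; exists j; rewrite // mem_iota.
Qed.

Lemma tile_end j K y : j < K -> j * y + y <= K * y.
Proof. by move=> lt; rewrite addnC -mulSn leq_mul2r lt orbT. Qed.

(** From below, the differences are those of steps, rungs and digons. *)
Lemma cyclic_digon_even s y k : 0 < k ->
  s + (2 + 2 * y.+1) = 2 * ((2 * y + 4) * k) + 1 ->
  HOP_solvable s [:: 2; 2 * y.+1] /\ HOP_solvable s [:: 2 * y.+1; 2].
Proof.
move=> k_gt0 sE; set n := 2 * _ + 1 in sE.
have n_gt1 : 1 < n by rewrite /n; lia.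
pose Y j := down (0 + j * y) y; pose c j := 2 * k * y + j.+1.
have blocks : base n (2 * (2 * k)) 0 (2 * y.+1)
    (flatten [seq c j :: Y j | j <- iota 0 (2 * k)]).
  rewrite mulnC; apply: base_iter => j lt; have := tile_end y lt => le.
  have := head_down0 (0 + j * y) y => hY.
  have := @block_even n n_gt1 (Y j) (c j); rewrite size_down; apply.
  - exact: descending_down0.
  - by rewrite /c /Y; lia.
  - by rewrite /c /Y /n; lia.
pose fs := iota (2 * k * y + 2 * k).+1 (2 * k).
have small : 2 * (2 * y.+1) < n by rewrite /n; nia.
have fsP : {in fs, forall f, 0 < f < n} by move=> f; rewrite mem_iota /n; nia.
have B := with_digons n_gt1 small (size_iota _ _) fsP blocks.
apply: (@cyclic_solution ((2 * y + 4) * k) _ _ _ _ _ _ _ _ _ _ sE _ B) => //; [by nia | by lia | by lia |].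
move=> d dM; apply/orP; left; rewrite mem_cat mem_iota.
case: (ltnP (2 * k * y + 2 * k) d) => h1; first by apply/orP; left; nia.
apply/orP; right; case: (leqP d (2 * k * y)) => h2.
  have [|j jK dj] := @down_tile 0 y (2 * k) d; first by lia.
  by apply: (mem_flatten_iota jK); rewrite in_cons dj orbT.
apply: (@mem_flatten_iota _ _ (d - 2 * k * y).-1); first by lia.
by rewrite in_cons /c; apply/orP; left; apply/eqP; lia.
Qed.

(** Up to 3k, the odd differences below 2k are those of caps and the others those of
digons.  Then come the steps, and on top the pairs a, p + a, nested in each
other. *)
Lemma cyclic_digon_odd s x k : 0 < k ->
  s + (2 + (2 * x + 3)) = 2 * ((2 * x + 5) * k) + 1 ->
  HOP_solvable s [:: 2; 2 * x + 3] /\ HOP_solvable s [:: 2 * x + 3; 2].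
Proof.
move=> k_gt0 sE; set n := 2 * _ + 1 in sE.
have n_gt1 : 1 < n by rewrite /n; lia.
pose X i := down (3 * k + i * x) x; pose p i := 2 * i + 1.
pose a i := 2 * k * x + 4 * k - i.
have blocks : base n (2 * (2 * k)) 0 (2 * x + 3)
    (flatten [seq [:: p i, a i, p i + a i & X (2 * i) ++ X (2 * i).+1] | i <- iota 0 k]).
  rewrite (_ : 2 * (2 * k) = k * 4); last by lia.
  apply: base_iter => i lt.
  have lt2 : (2 * i).+1 < 2 * k by lia.
  have := tile_end x lt2 => le2; have := tile_end x (ltnW lt2) => le1.
  have := head_down0 (3 * k + (2 * i) * x) x => h1.
  have := head_down0 (3 * k + (2 * i).+1 * x) x => h2.
  have := @block_odd n n_gt1 (X (2 * i)) (X (2 * i).+1) (p i) (a i) (3 * k + 2 * k * x).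
  rewrite !size_down; apply=> //; try exact: descending_down0; rewrite /X /p /a /n; lia.
pose fs := [seq 2 * i.+1 | i <- iota 0 k] ++ iota (2 * k).+1 k.
have szf : size fs = 2 * k by rewrite size_cat size_map !size_iota; lia.
have small : 2 * (2 * x + 3) < n by rewrite /n; nia.
have fsP : {in fs, forall f, 0 < f < n}.
  by move=> f; rewrite mem_cat => /orP[/mapP[i]|]; rewrite mem_iota /n; nia.
have B := with_digons n_gt1 small szf fsP blocks.
apply: (@cyclic_solution ((2 * x + 5) * k) _ _ _ _ _ _ _ _ _ _ sE _ B) => //; [by nia | by lia | by lia |].
move=> d dM; apply/orP; left; rewrite mem_cat.
case: (leqP d (3 * k)) => h1.
  case: (leqP d (2 * k)) => h2; last first.
    by apply/orP; left; rewrite mem_cat mem_iota; apply/orP; right; lia.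
  case: (boolP (odd d)) => od.
    apply/orP; right; apply: (@mem_flatten_iota _ _ d./2); first by lia.
    by rewrite in_cons /p; apply/orP; left; apply/eqP; lia.
  apply/orP; left; rewrite mem_cat; apply/orP; left; apply/mapP; exists (d./2).-1; last by lia.
  by rewrite mem_iota; lia.
apply/orP; right; case: (leqP d (3 * k + 2 * k * x)) => h2.
  have [|j jK dj] := @down_tile (3 * k) x (2 * k) d; first by lia.
  apply: (@mem_flatten_iota _ _ j./2); first by lia.
  rewrite !in_cons mem_cat; apply/orP; right; apply/orP; right; apply/orP; right.
  have [E|E] : j = 2 * j./2 \/ j = (2 * j./2).+1 by lia.
    by rewrite /X -E dj.
  by rewrite /X -E dj orbT.
case: (leqP d (2 * k * x + 4 * k)) => h3.
  apply: (@mem_flatten_iota _ _ (2 * k * x + 4 * k - d)); first by lia.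
  by rewrite !in_cons /a; apply/orP; right; apply/orP; left; apply/eqP; lia.
apply: (@mem_flatten_iota _ _ (d - (2 * k * x + 4 * k)).-1); first by nia.
rewrite !in_cons /a /p; apply/orP; right; apply/orP; right; apply/orP; left.
by apply/eqP; nia.
Qed.

(** From below, the differences are those of the steps of the second and of the
first paths, and the shifts. *)
Lemma cyclic_even_even s x y k : 0 < x -> 0 < y -> 0 < k ->
  s + (2 * x.+1 + 2 * y.+1) = 2 * ((2 * x + 2 * y + 4) * k) + 1 ->
  HOP_solvable s [:: 2 * x.+1; 2 * y.+1] /\ HOP_solvable s [:: 2 * y.+1; 2 * x.+1].
Proof.
move=> x0 y0 k0 sE; set n := 2 * _ + 1 in sE.
have n_gt1 : 1 < n by rewrite /n; lia.
pose Y j := down (0 + j * y) y; pose X j := down (2 * k * y + j * x) x.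
pose c j := 2 * k * x + 2 * k * y + 2 * j + 1.
have blocks : base n (2 * k * 2) (2 * x.+1) (2 * y.+1)
    (flatten [seq c j :: (c j).+1 :: X j ++ Y j | j <- iota 0 (2 * k)]).
  apply: base_iter => j lt; have leX := tile_end x lt; have leY := tile_end y lt.
  have hg : j * y + y < 2 * k * y + j * x.
    have [E|ne] := eqVneq j.+1 (2 * k).
      have : 1 * 1 <= j * x by rewrite leq_mul //; lia.
      have : j.+1 * y = 2 * k * y by rewrite E.
      by lia.
    have lt' : j.+1 < 2 * k by lia.
    by have := tile_end y lt'; lia.
  have dD : descending (X j ++ (j * y + y).+1 :: Y j).
    apply: descending_down => //=; apply: descending_cons (descending_down0 _ _).
    by have := head_down0 (0 + j * y) y; rewrite /Y; lia.
  have hD : head 0 (X j ++ (j * y + y).+1 :: Y j) <= 2 * k * x + 2 * k * y.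
    by apply: head_down; lia.
  have := @block_even_even n n_gt1 (X j) (j * y + y).+1 (Y j) (c j) (c j).+1.
  rewrite !size_down; apply=> //.
  - by rewrite -size_eq0 size_down -lt0n.
  - by rewrite -size_eq0 size_down -lt0n.
  - by move: hD; rewrite /c; lia.
  - by move: hD; rewrite /c; lia.
  - by move: hD; rewrite /c /n; lia.
  - by move: hD; rewrite /c /n; lia.
apply: (@cyclic_solution ((2 * x + 2 * y + 4) * k) _ _ _ _ _ _ _ _ _ _ sE _ blocks) => //.
- by nia.
- by lia.
- by lia.
- by lia.
move=> d dM; apply/orP; left.
case: (leqP d (2 * k * y)) => h1.
  have [|j jK dj] := @down_tile 0 y (2 * k) d; first by lia.
  by apply: (mem_flatten_iota jK); rewrite !in_cons mem_cat dj !orbT.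
case: (leqP d (2 * k * y + 2 * k * x)) => h2.
  have [|j jK dj] := @down_tile (2 * k * y) x (2 * k) d; first by lia.
  by apply: (mem_flatten_iota jK); rewrite !in_cons mem_cat dj !orbT.
apply: (@mem_flatten_iota _ _ (d - (2 * k * y + 2 * k * x)).-1./2); first by lia.
by rewrite !in_cons /c; lia.
Qed.

(** From below, the differences are p = 1, ..., 2k, those of the steps, and the pairs
a, p + a of a Skolem sequence on the last 4k of them.  If the sequence is hooked,
then its last pair uses mk + 1, which is - mk modulo n. *)
Lemma cyclic_odd_odd s x y k : 0 < k ->
  s + ((2 * x + 3) + (2 * y + 3)) = 2 * ((2 * x + 2 * y + 6) * k) + 1 ->
  HOP_solvable s [:: 2 * x + 3; 2 * y + 3] /\ HOP_solvable s [:: 2 * y + 3; 2 * x + 3].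
Proof.
move=> k0 sE; set n := 2 * _ + 1 in sE.
have n_gt1 : 1 < n by rewrite /n; lia.
have [a [ran top cov]] := skolem k0.
pose Y j := down (2 * k + j * y) y; pose X j := down (2 * k + 2 * k * y + j * x) x.
pose u := 2 * k + 2 * k * y + 2 * k * x.
have blocks : base n (2 * k * 2) (2 * x + 3) (2 * y + 3)
    (flatten [seq j.+1 :: u + a j.+1 :: j.+1 + (u + a j.+1) :: X j ++ Y j | j <- iota 0 (2 * k)]).
  apply: base_iter => j lt; have leX := tile_end x lt; have leY := tile_end y lt.
  have [|a0 an] := ran j.+1; first by lia.
  (* The deleted step may have any length above those of the steps after it. *)
  pose g := (head 0 (rcons (Y j) j.+1)).+1.
  have hg : g <= 2 * k + j * y + y + 1.
    by rewrite /g -cats1 addn1 ltnS; apply: head_down => /=; lia.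
  have gX : 0 < x -> g <= 2 * k + 2 * k * y + j * x.
    move=> x0; have [E|ne] := eqVneq j.+1 (2 * k).
      have : 1 * 1 <= j * x by rewrite leq_mul //; lia.
      have : j.+1 * y = 2 * k * y by rewrite E.
      by lia.
    have lt' : j.+1 < 2 * k by lia.
    have := tile_end y lt'; case: (posnP y) => y0; last by lia.
    by move: hg; rewrite /g /Y y0 /=; lia.
  have ga : g < u + a j.+1.
    have [E|ne] := eqVneq j.+1 (2 * k).
      have : j.+1 * y = 2 * k * y by rewrite E.
      by move: top; rewrite -E /u; lia.
    have lt' : j.+1 < 2 * k by lia.
    have := tile_end y lt'; case: (posnP y) => y0; last by rewrite /u; lia.
    by move: hg; rewrite /g /Y y0 /= /u; lia.
  have dY : descending (rcons (Y j) j.+1).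
    by rewrite -cats1; apply: descending_down => //=; lia.
  have dD : descending (X j ++ g :: rcons (Y j) j.+1).
    by apply: descending_down => //=; apply: descending_cons.
  have hD : head 0 (X j ++ g :: Y j) < u + a j.+1.
    case: (posnP x) => x0; first by rewrite /X x0.
    apply: (@leq_ltn_trans u); last by lia.
    by apply: head_down; rewrite /u; lia.
  have hD' : head 0 (X j ++ g :: Y j) <= u + 1.
    by apply: head_down => /=; rewrite /u; lia.
  have := @block_odd_odd n n_gt1 (X j) g (Y j) j.+1 (u + a j.+1).
  rewrite !size_down; apply=> //.
  by move: hD'; rewrite /u /n; lia.
apply: (@cyclic_solution ((2 * x + 2 * y + 6) * k) _ _ _ _ _ _ _ _ _ _ sE _ blocks) => //.
- by nia.
- by lia.
- by lia.
- by lia.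
move=> d dM.
case: (leqP d (2 * k)) => h0.
  apply/orP; left; apply: (@mem_flatten_iota _ _ d.-1); first by lia.
  by rewrite !in_cons; lia.
case: (leqP d (2 * k + 2 * k * y)) => h1.
  have [|j jK dj] := @down_tile (2 * k) y (2 * k) d; first by lia.
  by apply/orP; left; apply: (mem_flatten_iota jK); rewrite !in_cons mem_cat dj !orbT.
case: (leqP d u) => h2.
  have [|j jK dj] := @down_tile (2 * k + 2 * k * y) x (2 * k) d; first by move: h2; rewrite /u; lia.
  by apply/orP; left; apply: (mem_flatten_iota jK); rewrite !in_cons mem_cat dj !orbT.
have uE : u + 4 * k = (2 * x + 2 * y + 6) * k by rewrite /u; lia.
have [|p pk] := cov (d - u); first by lia.
have pE : p.-1.+1 = p by lia.
case/or3P=> ap; [apply/orP; left|apply/orP; left|apply/orP; right];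
  (apply: (@mem_flatten_iota _ _ p.-1); [by lia | rewrite !in_cons pE; lia]).
Qed.

Section OddEven.
Variable n : nat.
Hypothesis n_gt1 : 1 < n.

Lemma block_odd_even_window (X : seq nat) g Y (X' : seq nat) g' Y' p a a' h :
    size X' = size X -> size Y' = size Y -> Y != [::] -> 0 < p ->
    descending (X ++ g :: Y) -> descending (X' ++ g' :: Y') ->
    head 0 (X ++ g :: Y) <= h -> head 0 (X' ++ g' :: Y') <= h ->
    h < a -> h < a' -> p + a + h < n -> p + a' + h < n ->
  base n 4 (2 * size X + 3) (2 * (size Y).+1)
    [:: p, a, p + a, a', p + a' & (X ++ Y) ++ (X' ++ Y')].
Proof.
move=> szX szY Y0 p0 dD dD' hD hD' ha ha' hn hn'.
have [v zE] := zig_cat 0%R true X g Y; have [v' zE'] := zig_cat 0%R true X' g' Y'.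
apply: (block_odd_even szX szY Y0) => c; rewrite !in_cons orbF => cE.
  apply: (fits_window n_gt1 dD hD zE); [| |right]; move: cE; clear -ha ha' hn hn' p0; lia.
by apply: (fits_window n_gt1 dD' hD' zE'); [| |left]; move: cE; clear -ha ha' hn hn' p0; lia.
Qed.

End OddEven.

(** A zigzag over an interval closes in from both sides of its window and stops
early, leaving a hole in the middle. *)
Lemma zig_hole v w l x : x \in zig v true (down w l) ->
  (x <= v + l./2%:Z \/ v + w%:Z + l./2%:Z < x)%R.
Proof.
have [m] := ubnP l; elim: m l v => // m IH [|[|l]] v le /=.
- by rewrite inE => /eqP ->; lia.
- by rewrite !inE => /orP[]/eqP ->; lia.
rewrite !in_cons => /or3P[/eqP ->|/eqP ->|]; [lia|lia|].
by move/IH => /(_ ltac:(lia)); lia.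
Qed.

(** Here a shift comes right after the longest step.  Then the single couple of the
first path has no place below the second path, but it fits into the hole of the
zigzag, together with the couple just before it. *)
Lemma block_odd_even_hole n y a a' (u := 2 * y + 1) : 0 < y -> n = 4 * y + 11 ->
    u < a <= u + 3 -> u < a' <= u + 3 ->
  base n 4 3 (2 * y.+1)
    [:: 1, a, 1 + a, a', 1 + a' & down 1 y ++ down (y + 1) y].
Proof.
move=> y0 nE ha ha'; have n_gt1 : 1 < n by lia.
have [v zE] := zig_cat 0%R true [::] (y + 2) (down 1 y).
have dD : descending ([::] ++ (y + 2) :: down 1 y).
  by apply: descending_cons (descending_down0 _ _); have := head_down0 1 y; lia.
have szY : size (down (y + 1) y) = size (down 1 y) by rewrite !size_down.
have Y0 : down 1 y != [::] by rewrite -size_eq0 size_down -lt0n.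
pose t : int := (y./2 + 2)%:Z.
have := @block_odd_even n [::] 0%R true (down 1 y) v _ [::] t true (down (y + 1) y) 0%R true
  1 a a' erefl szY Y0.
rewrite size_down; apply=> c; rewrite !in_cons in_nil orbF => cE.
  apply: (fits_window n_gt1 dD (leqnn _) zE); [| |right]; rewrite /=; clear -cE ha ha' nE y0; lia.
have dY := descending_down0 (y + 1) y.
have wY x : x \in zig 0%R true (down (y + 1) y) -> (0 <= x <= u%:Z)%R.
  by move/(zig_window dY); have := head_down0 (y + 1) y; rewrite add0r /u; lia.
have hole (z : int) : (t - 1 <= z <= t)%R -> z \notin zig 0%R true (down (y + 1) y).
  by move=> hz; apply/negP => /zig_hole; move: hz; rewrite /t; clear -y0; lia.
move=> vs1 vs2 m s1 s2.
have cu : u < c <= u + 3 by clear -cE ha ha'; lia.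
apply: (@seats_cap_start n n_gt1 _ _ u) => //.
- rewrite /= zig_uniq // andbT; apply: hole; clear; lia.
- move=> x; rewrite mem_cat mem_seq1 => /orP[/eqP ->|/wY //].
  by rewrite /t /u; clear -y0; lia.
- by clear -cu; lia.
- by rewrite nE; clear -cu; rewrite /u in cu *; lia.
- by rewrite nE /t; clear -cu; rewrite /u in cu *; lia.
- rewrite mem_cat mem_seq1 negb_or; apply/andP; split; first by clear -cu; lia.
  by apply/negP => /wY; rewrite /t; clear -cu; lia.
rewrite mem_cat mem_seq1 negb_or; apply/andP; split; first by clear -cu; lia.
by apply: hole; clear; lia.
Qed.

(** From below, the differences are p = 1, ..., k, those of the steps, and on the last
4k of them two pairs a, p + a for each p. *)
Lemma cyclic_odd_even s x y k : 0 < y -> 0 < k ->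
  s + ((2 * x + 3) + 2 * y.+1) = 2 * ((2 * x + 2 * y + 5) * k) + 1 ->
  HOP_solvable s [:: 2 * x + 3; 2 * y.+1] /\ HOP_solvable s [:: 2 * y.+1; 2 * x + 3].
Proof.
move=> y0 k0 sE; set n := 2 * _ + 1 in sE.
have n_gt1 : 1 < n by rewrite /n; lia.
have [a [a' [ran top cov]]] := twofold_skolem k0.
pose Y i := down (k + i * y) y; pose X i := down (k + 2 * k * y + i * x) x.
pose u := k + 2 * k * y + 2 * k * x.
pose Ds j := [:: j.+1, u + a j.+1, j.+1 + (u + a j.+1), u + a' j.+1, j.+1 + (u + a' j.+1)
  & (X (2 * j) ++ Y (2 * j)) ++ (X (2 * j).+1 ++ Y (2 * j).+1)].
have blocks : base n (k * 4) (2 * x + 3) (2 * y.+1) (flatten [seq Ds j | j <- iota 0 k]).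
  apply: base_iter => j lt.
  have [|a0 a0' an an'] := ran j.+1; first by lia.
  have [/andP[/eqP x0 /eqP k1]|sp] := boolP ((x == 0) && (k == 1)).
    have j0 : j = 0 by lia.
    have := @block_odd_even_hole n y (u + a 1) (u + a' 1) y0.
    rewrite /Ds /X /Y /u x0 k1 j0 !muln0 !mul0n !mul1n !addn0 /= [1 + y]addnC.
    rewrite j0 k1 in a0 a0' an an'; apply.
    - by rewrite /n x0 k1; lia.
    - by lia.
    - by lia.
  (* Without first steps, the deleted step of the last block exceeds [u]. *)
  pose h := u + ((x == 0) && (j.+1 == k)).
  have lt2 : (2 * j).+1 < 2 * k by lia.
  have leX := tile_end x lt2; have leY := tile_end y lt2.
  have leX' := tile_end x (ltnW lt2); have leY' := tile_end y (ltnW lt2).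
  have yk : (x == 0) && (j.+1 == k) \/ (2 * j).+1 * y + y + 1 <= 2 * k * y + (2 * j).+1 * x.
    have [x0|x0] := posnP x; last by right; nia.
    by have [jk|jk] := eqVneq j.+1 k; [left; lia | right; nia].
  have desc i : i = 2 * j \/ i = (2 * j).+1 ->
      descending (X i ++ (k + i * y + y).+1 :: Y i) /\
      head 0 (X i ++ (k + i * y + y).+1 :: Y i) <= h.
    move=> iE; have ile : i * y + y + 1 <= 2 * k * y + i * x \/
       (x == 0) && (j.+1 == k) && (i * y + y <= 2 * k * y).
      by case: iE => ->; move: yk leY leX' leY' y0; clear; nia.
    have ilX : i * x + x <= 2 * k * x by case: iE => ->; lia.
    split.
      apply: descending_down => [x0|].
        by rewrite /=; move: ile x0; clear; lia.
      apply: descending_cons (descending_down0 _ _).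
      by have := head_down0 (k + i * y) y; rewrite /Y; lia.
    by apply: head_down => /=; move: ile ilX; rewrite /h /u; clear; lia.
  have [dD hD] := desc _ (or_introl erefl); have [dD' hD'] := desc _ (or_intror erefl).
  have htop : h < u + a j.+1 /\ h < u + a' j.+1.
    have [jk|jk] := eqVneq j.+1 k; last by rewrite /h (negPf jk) andbF; lia.
    have [x0|x0] := posnP x; last by rewrite /h eqn0Ngt x0; lia.
    have [|t t'] := top; first by move: sp; rewrite x0 /=; lia.
    by rewrite /h jk; lia.
  have hmax : h <= u + 1 by rewrite /h; case: (_ && _); lia.
  have := @block_odd_even_window n n_gt1 (X (2 * j)) _ (Y (2 * j)) (X (2 * j).+1) _
    (Y (2 * j).+1) j.+1 (u + a j.+1) (u + a' j.+1) h.
  rewrite !size_down; apply=> //.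
  - by rewrite -size_eq0 size_down -lt0n.
  - exact: dD.
  - exact: dD'.
  - exact: hD.
  - exact: hD'.
  - by case: htop.
  - by case: htop.
  - by rewrite /n; move: hmax; rewrite /u; lia.
  - by rewrite /n; move: hmax; rewrite /u; lia.
apply: (@cyclic_solution ((2 * x + 2 * y + 5) * k) _ _ _ _ _ _ _ _ _ _ sE _ blocks) => //.
- by nia.
- by lia.
- by lia.
- by lia.
move=> d dM; apply/orP; left.
case: (leqP d k) => h0.
  apply: (@mem_flatten_iota _ _ d.-1); first by lia.
  by rewrite /Ds !in_cons; lia.
have halves j : j = 2 * j./2 \/ j = (2 * j./2).+1 by lia.
case: (leqP d (k + 2 * k * y)) => h1.
  have [|j jK dj] := @down_tile k y (2 * k) d; first by lia.
  apply: (@mem_flatten_iota _ _ j./2); first by lia.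
  by rewrite /Ds !in_cons !mem_cat; case: (halves j) => E; rewrite /Y -E dj !orbT.
case: (leqP d u) => h2.
  have [|j jK dj] := @down_tile (k + 2 * k * y) x (2 * k) d; first by move: h2; rewrite /u; lia.
  apply: (@mem_flatten_iota _ _ j./2); first by lia.
  by rewrite /Ds !in_cons !mem_cat; case: (halves j) => E; rewrite /X -E dj !orbT.
have uE : u + 4 * k = (2 * x + 2 * y + 5) * k by rewrite /u; lia.
have [|p pk ap] := cov (d - u); first by lia.
have pE : p.-1.+1 = p by lia.
apply: (@mem_flatten_iota _ _ p.-1); first by lia.
by rewrite /Ds !in_cons pE; move: ap; lia.
Qed.

Theorem cyclic_case s m1 m2 k : 1 < m1 -> 1 < m2 -> 0 < k ->
  s + (m1 + m2) = 2 * ((m1 + m2) * k) + 1 -> HOP_solvable s [:: m1; m2].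
Proof.
have halves m : 1 < m -> [\/ m = 2, exists2 x, 0 < x & m = 2 * x.+1 | exists x, m = 2 * x + 3].
  move=> m_gt1; have [od|ev] := boolP (odd m).
    by apply: Or33; exists (m./2).-1; lia.
  have [->|ne] := eqVneq m 2; first exact: Or31.
  by apply: Or32; exists (m./2).-1; lia.
move=> /halves h1 /halves h2 k0.
case: h1 => [->|[x x0 ->]|[x ->]]; case: h2 => [->|[y y0 ->]|[y ->]] E.
- by have [] := @cyclic_digon_even s 0 k k0; first lia.
- by have [] := @cyclic_digon_even s y k k0; first lia.
- by have [] := @cyclic_digon_odd s y k k0; first lia.
- by have [] := @cyclic_digon_even s x k k0; first lia.
- by have [] := @cyclic_even_even s x y k x0 y0 k0; first lia.
- by have [] := @cyclic_odd_even s y x k x0 k0; first lia.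
- by have [] := @cyclic_digon_odd s x k k0; first lia.
- by have [] := @cyclic_odd_even s x y k y0 k0; first lia.
- by have [] := @cyclic_odd_odd s x y k k0; first lia.
Qed.

Local Open Scope ring_scope.

HB.instance Definition _ (G H : finZmodType) := GRing.Zmodule.on (G * H)%type.

(** * Layered zigzags *)

(** The second component is the layer: upward steps lead from layer 0 to layer 1. *)
Fixpoint zag (v : int) (up : bool) (D : seq nat) : seq (int * int) :=
  (v, (~~ up)%:Z) ::
  if D is d :: D' then zag (if up then v + d%:Z else v - d%:Z) (~~ up) D'
  else [::].

Lemma map_fst_zag v up D : map fst (zag v up D) = zig v up D.
Proof. by elim: D v up => //= d D IH v up; rewrite IH. Qed.

Lemma size_zag v up D : size (zag v up D) = (size D).+1.
Proof. by rewrite -(size_map fst) map_fst_zag size_zig. Qed.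

Lemma zag_uniq v up D : descending D -> uniq (zag v up D).
Proof. by move=> dD; apply: (@map_uniq _ _ fst); rewrite map_fst_zag zig_uniq. Qed.

Lemma intpairD (a b c d : int) : (a, b) + (c, d) = (a + c, b + d).
Proof. by []. Qed.

Lemma zag_diff v up D d : d \in D -> exists2 i, (i.+1 < size (zag v up D))%N &
  let z := nth (0, 0) (zag v up D) i in let z' := nth (0, 0) (zag v up D) i.+1 in
  z' = z + (d%:Z, 1) \/ z = z' + (d%:Z, 1).
Proof.
elim: D v up => //= e D IH v up; rewrite in_cons; case: eqVneq => [-> _|_ /= dD].
  exists 0%N => /=; first by case: D {IH}.
  by case: up; case: D {IH} => [|f D] /=; [left|left|right|right];
    rewrite intpairD; congr (_, _); lia.
have [i lt H] := IH (if up then v + e%:Z else v - e%:Z) (~~ up) dD.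
by exists i.+1.
Qed.

Lemma zag_layers v w l z i : (z, i) \in zag v true (down w l) ->
  (i = 0 /\ v <= z <= v + l./2%:Z) \/
  (i = 1 /\ v + w%:Z + l./2%:Z < z <= v + w%:Z + l%:Z).
Proof.
have [m] := ubnP l; elim: m l v => // m IH [|[|l]] v le /=.
- by rewrite inE => /eqP[-> ->]; left; lia.
- by rewrite !inE => /orP[]/eqP[-> ->]; [left|right]; lia.
rewrite !in_cons => /or3P[/eqP[-> ->]|/eqP[-> ->]|]; [left; lia|right; lia|].
by move/IH => /(_ ltac:(lia)); lia.
Qed.

Section Block.
Variables (m w j : nat).
Hypotheses (m_gt1 : (1 < m)%N) (w_gt1 : (1 < w)%N).
Local Notation G := ('Z_m * 'Z_w)%type.
Local Notation V := (G * bool)%type.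
Local Notation sp := (@spouse G).

(** Layers are multiples of [j] in the second component. *)
Definition emb (p : int * int) : G := (p.1%:~R, (p.2 * j%:Z)%:~R).

Lemma embD p q : emb (p + q) = emb p + emb q.
Proof. by rewrite /emb /= mulrDl !intrD. Qed.

Lemma embN p : emb (- p) = - emb p.
Proof. by rewrite /emb /= mulNr !intrN. Qed.

Lemma embB p q : emb (p - q) = emb p - emb q.
Proof. by rewrite embD embN. Qed.

Lemma seats_layers zs1 zs2 c1 c2 mid vs1 vs2 b :
    uniq (map emb (rcons ((zs1 ++ zs2) ++
      ([seq z + c1 | z <- zs1] ++ [seq z + c2 | z <- zs2])) mid)) ->
    size vs1 = size zs1 -> size vs2 = size zs2 ->
  seats sp (2 * size zs1 + 1)%N (2 * size zs2)%N
    (ladder (emb c1) (map emb zs1) vs1 [::] [:: (emb mid, b)],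
     ladder (emb c2) (map emb zs2) vs2 [::] [::]).
Proof.
move=> U s1 s2; apply: seats_uniq; rewrite /= ?size_ladder ?size_map //=; try by (clear; lia).
rewrite map_cat !ladder_couples ?size_map //= !cats0.
have sh c zs : [seq t + emb c | t <- map emb zs] = map emb [seq z + c | z <- zs].
  by rewrite -!map_comp; apply: eq_map => z /=; rewrite embD.
rewrite !sh -[[:: emb mid]]/(map emb [:: mid]) -!map_rev -!map_cat.
move: U; rewrite -cats1; congr is_true; apply: perm_uniq; apply: perm_map.
apply/permP=> a; rewrite !count_cat !map_rev !count_rev.
move: (count _ zs1) (count _ zs2) (count _ [:: _]) => n1 n2 n3.
by move: (count _ _) (count _ _) => n4 n5; clear; lia.
Qed.

Lemma doubles_layers c1 c2 v up D (ws : seq vec) E1 S1 E2 S2 d :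
    size ws = (size D).+1 -> sorted orth ws -> d \in D ->
  covers [:: ladder c1 (map emb (zag v up D)) (map fst ws) E1 S1;
             ladder c2 (map emb (zag v up D)) (map snd ws) E2 S2] (emb (d%:Z, 1)).
Proof.
move=> sz o dD; have [i lt H] := zag_diff v up dD.
have szr : size (map emb (zag v up D)) = size ws by rewrite size_map size_zag.
have lt' : (i.+1 < size (map emb (zag v up D)))%N by rewrite size_map.
have := doubles_cover c1 c2 E1 S1 E2 S2 szr o lt'.
rewrite !(nth_map (0, 0)) // ?(ltnW lt) //; case: H => ->.
  by rewrite embD addrC addrA addNr add0r.
by move/coversN; rewrite embD opprB addrC addrA addNr add0r.
Qed.

End Block.

(** * Disjointness of the layered ladders *)

Section Block.
Variables (m w j x y : nat).
Hypotheses (mE : m = (2 * (x + y) + 5)%N) (w_odd : odd w) (j_gt0 : (0 < j)%N)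
  (j_lt : (2 * j < w)%N).
Local Notation h := (x + y)%N.
Local Notation G := ('Z_m * 'Z_w)%type.
Local Notation V := (G * bool)%type.
Local Notation sp := (@spouse G).
Local Notation emb := (@emb m w j).

Let m_gt1 : (1 < m)%N. Proof. lia. Qed.
Let w_gt1 : (1 < w)%N. Proof. lia. Qed.

(** With this start, both paths and their translates occupy disjoint intervals in
each of the layers 0, 1 and 2. *)
Definition start2 : nat := (h + 3 + x./2 - y./2)%N.
Definition path1 : seq (int * int) := zag 0 true (down y x).
Definition path2 : seq (int * int) := zag start2%:Z true (down 0 y).
Definition shift1 : int * int := (h.+1%:Z, 1).
Definition shift2 : int * int := (h.+2%:Z, 1).
Definition places : seq (int * int) :=
  (path1 ++ path2) ++ ([seq z + shift1 | z <- path1] ++ [seq z + shift2 | z <- path2]).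

Lemma path1P z i : (z, i) \in path1 ->
  (i = 0 /\ 0 <= z <= x./2%:Z) \/ (i = 1 /\ y%:Z + x./2%:Z < z <= h%:Z).
Proof. by move/zag_layers; clear; lia. Qed.

Lemma path2P z i : (z, i) \in path2 ->
  (i = 0 /\ start2%:Z <= z <= h%:Z + 3 + x./2%:Z) \/
  (i = 1 /\ h%:Z + 3 + x./2%:Z < z <= start2%:Z + y%:Z).
Proof. by move/zag_layers; rewrite /start2; clear; lia. Qed.

Lemma mem_translate (p : int * int) zs z i : (z, i) \in [seq q + p | q <- zs] ->
  (z - p.1, i - p.2) \in zs.
Proof. by case/mapP=> -[a b] ab [-> ->] /=; rewrite !addrK. Qed.

Lemma placesP z i : (z, i) \in places ->
  [\/ i = 0 /\ 0 <= z <= h%:Z + 3 + x./2%:Z,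
      i = 1 /\ y%:Z + x./2%:Z < z <= 2 * h%:Z + 5 + x./2%:Z
    | i = 2 /\ h%:Z + 1 + y%:Z + x./2%:Z < z < m%:Z + x./2%:Z + y%:Z - y./2%:Z + 1 /\
      z != m%:Z].
Proof.
rewrite !mem_cat => /orP[/orP[/path1P|/path2P]|/orP[/mem_translate/path1P|/mem_translate/path2P]];
  rewrite /shift1 /shift2 /start2 /= mE; clear.
- by case=> -[-> H]; [apply: Or31 | apply: Or32]; lia.
- by case=> -[-> H]; [apply: Or31 | apply: Or32]; lia.
- by case=> -[E H]; [apply: Or32 | apply: Or33]; lia.
- by case=> -[E H]; [apply: Or32 | apply: Or33]; lia.
Qed.

Lemma places_uniq : uniq places.
Proof.
have U1 : uniq path1 by apply: zag_uniq; apply: descending_down0.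
have U2 : uniq path2 by apply: zag_uniq; apply: descending_down0.
rewrite !cat_uniq !(map_inj_uniq (addIr _)) U1 U2 !andbT /=.
apply/and3P; split.
- apply/hasPn=> -[z i] /path2P H2; apply/negP => /path1P H1.
  by move: H1 H2; rewrite /start2; clear; lia.
- apply/hasPn=> -[z i]; rewrite mem_cat => H; apply/negP; rewrite mem_cat.
  move: H => /orP[/mem_translate/path1P H3|/mem_translate/path2P H3] /orP[/path1P H1|/path2P H1];
  by move: H1 H3; rewrite /shift1 /shift2 /start2 /=; clear; lia.
apply/hasPn=> -[z i] /mem_translate/path2P H2; apply/negP => /mem_translate/path1P H1.
by move: H1 H2; rewrite /shift1 /shift2 /start2 /=; clear; lia.
Qed.

(** As [w] is odd and [2 * j < w], neither [j] nor [2 * j] vanishes modulo [w]. *)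
Lemma emb_layer (z i z' i' : int) : `|i - i'| <= 2 -> emb (z, i) = emb (z', i') ->
  i = i' /\ (m %| `|z - z'|)%N.
Proof.
move=> le [/eqP Ez /eqP Ei]; split; last first.
  by apply: (Zp_intr_eq0 m_gt1); apply/eqP; rewrite intrB subr_eq0.
have : (w %| absz ((i - i') * j%:Z)%R)%N.
  by apply: (Zp_intr_eq0 w_gt1); apply/eqP; rewrite mulrBl intrB subr_eq0.
case/dvdnP=> q E; have : absz (i - i') = 0%N \/ absz (i - i') = 1%N \/ absz (i - i') = 2%N by lia.
rewrite abszM absz_nat in E; case=> [|[]] d; first lia.
  by rewrite d mul1n in E; case: q E => [|q]; nia.
by rewrite d in E; case: q E => [|q]; nia.
Qed.

(** Couple 0 of layer 2 is named [m], which lies in the window of its layer. *)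
Lemma places_cap0_uniq : uniq (map emb (rcons places (m%:Z, 2))).
Proof.
have P z i : (z, i) \in rcons places (m%:Z, 2) ->
  [\/ i = 0 /\ 0 <= z <= h%:Z + 3 + x./2%:Z,
      i = 1 /\ y%:Z + x./2%:Z < z <= 2 * h%:Z + 5 + x./2%:Z
    | i = 2 /\ h%:Z + 1 + y%:Z + x./2%:Z < z < m%:Z + x./2%:Z + y%:Z - y./2%:Z + 1].
  rewrite mem_rcons in_cons => /orP[/eqP[-> ->]|/placesP[?|?|[? []]]];
    [apply: Or33|exact: Or31|exact: Or32|by constructor 3].
  by rewrite mE; clear; lia.
rewrite map_inj_in_uniq; last first.
  move=> [z i] [z' i'] /P Pz /P Pz' /emb_layer[|E].
    by case: Pz Pz' => -[-> _] [] [-> _].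
  rewrite -E in Pz' *; case/dvdnP=> q Eq; congr (_, _).
  have : `|z - z'| < m%:Z.
    by case: Pz => -[Ei H]; case: Pz' => -[Ei' H']; move: Ei Ei' H H'; clear -mE; lia.
  by case: q Eq => [|q]; [|rewrite mulSn]; clear; lia.
rewrite rcons_uniq places_uniq andbT; apply/negP => /placesP[[//]|[//]|[_ [_]]].
by rewrite eqxx.
Qed.

(** Layers -1 and 2 coincide if [w = 3 * j]; then the positions differ modulo [m]. *)
Lemma places_cap1_uniq : uniq (map emb (rcons places (h.+1%:Z, -1))).
Proof.
rewrite map_rcons rcons_uniq; apply/andP; split; last first.
  by have := places_cap0_uniq; rewrite map_rcons rcons_uniq => /andP[].
apply/negP=> /mapP[[z i] /placesP Pz Ez].
have i2 : i = 2.
  case: Pz => -[-> _] in Ez *; rewrite //; by have [] := emb_layer _ Ez.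
case: Pz => -[Ei]; [by rewrite i2 in Ei | by rewrite i2 in Ei | ].
case=> Pz _; case: Ez => /eqP Ez _.
have /dvdnP[q] : (m %| `|h.+1%:Z - z|)%N.
  by apply: (Zp_intr_eq0 m_gt1); apply/eqP; rewrite intrB subr_eq0.
by case: q => [|q]; [|rewrite mulSn]; move: Pz; clear -mE; lia.
Qed.

End Block.

(** * Nights between layers *)

(** The conditions belong to the differences (h + 1, j), (- (h + 1), j) and (0, 2j).
Primes mark the mirrored nights. *)
Definition layered_spec (s e s' e' : vec) (m1 m2 m3 m4 : bool) :=
  [&& all4 [:: e.1; e.2; (m3, ~~ s'.1.1); (m4, ~~ s'.2.1)],
      all4 [:: (~~ s.1.2, ~~ m1); (m2, ~~ s.2.1); e'.1; e'.2]
    & all4 [:: (~~ s.1.1, m1); (~~ m2, ~~ s.2.2); (~~ m3, ~~ s'.1.2); (~~ m4, ~~ s'.2.2)]].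

Lemma layered_labels k : exists s e s' e' : vec, exists m1 m2 m3 m4,
  [/\ label_ends k s e, label_ends k s' e' & layered_spec s e s' e' m1 m2 m3 m4].
Proof.
pose V0001 := Vec false false false true; pose V0011 := Vec false false true true.
pose V0110 := Vec false true true false; pose V0101 := Vec false true false true.
case: k => [|k].
  by exists V0001, V0001, V0011, V0011, true, false, true, true.
by exists V0101, V0110, V0011, V0110, true, true, true, false.
Qed.

Section Mirror.
Variables m w : nat.
Local Notation G := ('Z_m * 'Z_w)%type.
Local Notation V := (G * bool)%type.

Definition mirror (d : G) : G := (- d.1, d.2).
Definition mirror_seat (v : V) : V := (mirror v.1, v.2).

Lemma mirrorK : involutive mirror.
Proof. by case=> z i; rewrite /mirror /= opprK. Qed.

Lemma linked_mirror (c : seq V) d a b : linked c d a b ->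
  linked (map mirror_seat c) (mirror d) a b.
Proof.
case=> u; move/(joined_map (sp := @spouse G) (sq := @spouse G) (f := mirror_seat) (fun=> erefl)) => J.
exists (mirror u); move: J; congr joined; congr (_, _).
by rewrite /mirror /= opprD.
Qed.

Lemma covers_mirror (cs : seq (seq V)) d : covers cs d ->
  covers (map (map mirror_seat) cs) (mirror d).
Proof.
move=> C a b; have [c cin /linked_mirror] := C a b.
by exists (map mirror_seat c); rewrite ?map_f.
Qed.

Lemma seats_mirror m1 m2 (F : seq V * seq V) : seats (@spouse G) m1 m2 F ->
  seats (@spouse G) m1 m2 (map2 mirror_seat F).
Proof.
apply: seats_map => //; apply: (can_inj (g := mirror_seat)) => -[u a].
by rewrite /mirror_seat /= mirrorK.
Qed.

End Mirror.

(** Two nights cover the steps and the rungs of the even ladder, of differences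
(d, j), and two mirrored ones those of differences (- d, j).  The odd ladder has a
rung (h + 1, j), and a cap with edges (- (h + 1), j) and (0, 2j); in the mirrored
nights the first two are exchanged, so that all three are covered by four edges. *)
Lemma multipartite_block m w j x y (h := (x + y)%N) :
    m = (2 * h + 5)%N -> odd w -> (0 < j)%N -> (2 * j < w)%N ->
  exists Bs : seq (seq ('Z_m * 'Z_w * bool) * seq ('Z_m * 'Z_w * bool)),
  [/\ size Bs = 4%N, all (seats (@spouse _) (2 * x + 3)%N (2 * y.+1)%N) Bs,
      forall d, (0 < d <= h.+2)%N -> covers (cycles Bs) (d%:R, j%:R)
                                 /\ covers (cycles Bs) (- d%:R, j%:R)
    & covers (cycles Bs) (0, (2 * j)%:R)].
Proof.
move=> mE w_odd j_gt0 j_lt.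
set G := ('Z_m * 'Z_w)%type; pose V := (G * bool)%type.
have [s [e [s' [e' [m1 [m2 [m3 [m4 [lx lx' /and3P[fa fp fb]]]]]]]]]] := layered_labels x.
have [S [E [ly fB]]] := rung_labels y.
have [ws [sz last1 o1]] := label_path lx; have [ws' [sz' last1' o1']] := label_path lx'.
have [us [szu last2 o2]] := label_path ly.
pose em := @emb m w j.
pose T1 : seq G := map em (path1 x y); pose T2 : seq G := map em (path2 x y).
pose c1 : G := em (shift1 x y); pose c2 : G := em (shift2 x y).
pose A vs (z : int * int) b : seq V := ladder c1 T1 vs [::] [:: (em z : G, b)].
pose B vs : seq V := ladder c2 T2 vs [::] [::].
pose cap0 : int * int := (m%:Z, 2); pose cap1 : int * int := (h.+1%:Z, -1).
pose F1 := (A (map fst (s :: ws)) cap0 m1, B (map fst (S :: us))).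
pose F2 := (A (map snd (s :: ws)) cap1 m2, B (map snd (S :: us))).
pose F3 := (A (map fst (s' :: ws')) cap1 m3, B (map fst (S :: us))).
pose F4 := (A (map snd (s' :: ws')) cap1 m4, B (map snd (S :: us))).
have szp1 : size (path1 x y) = x.+1 by rewrite size_zag size_down.
have szp2 : size (path2 x y) = y.+1 by rewrite size_zag size_down.
have seatF vs1 vs2 z b : size vs1 = x.+1 -> size vs2 = y.+1 -> z = cap0 \/ z = cap1 ->
    seats (@spouse G) (2 * x + 3)%N (2 * y.+1)%N (A vs1 z b, B vs2).
  move=> s1 s2 zE; rewrite (_ : (2 * x + 3)%N = (2 * size (path1 x y) + 1)%N); last first.
    by rewrite szp1; clear; lia.
  rewrite -{1}szp2; apply: (@seats_layers m w j (path1 x y) (path2 x y) (shift1 x y) (shift2 x y) z);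
    rewrite ?szp1 ?szp2 //.
  case: zE => ->; first exact: places_cap0_uniq.
  exact: places_cap1_uniq.
pose M := map2 (@mirror_seat m w).
exists [:: F1; F2; M F3; M F4].
set Bs := [:: F1; F2; M F3; M F4].
have okB : all (seats (@spouse _) (2 * x + 3)%N (2 * y.+1)%N) Bs.
  rewrite /= andbT; apply/and4P; split; rewrite ?seats_mirror //;
    by apply: seatF; rewrite /= ?size_map ?sz ?sz' ?szu //; first [by left | by right].
have szr : size T1 = (size ws).+1 by rewrite size_map szp1 sz.
have szr' : size T1 = (size ws').+1 by rewrite size_map szp1 sz'.
have szr2 : size T2 = (size us).+1 by rewrite size_map szp2 szu.
have sub cs : all (fun c => c \in [:: F1.1; F2.1; (M F3).1; (M F4).1;
    F1.2; F2.2; (M F3).2; (M F4).2]) cs -> {subset cs <= cycles Bs} by move/allP.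
have headT : head 0 T1 = 0 by rewrite /T1 /path1; case: (down y x) => *;
  rewrite /= /em /emb /= mul0r mulr0z.
have cap (f : vec -> bool * bool) u us0 z b : size T1 = (size us0).+1 ->
    let C := A (map f (u :: us0)) z b in
    linked C (em z - c1) (~~ (f u).2) (~~ b) /\ linked C (- em z) b (~~ (f u).1).
  move=> szT; have [] := linked_cap_start f c1 u szT (em z) b [::].
  by rewrite headT add0r sub0r.
have emE (a b : int) : em (a, b) = (a%:~R, (b * j%:Z)%:~R) by [].
have negE (a b : int) : - em (a, b) = em (- a, - b) by rewrite -embN.
have m0 (a b : int) : em (m%:Z + a, b) = em (a, b).
  rewrite !emE; congr (_, _); rewrite intrD -[m%:Z%:~R]/(m%:R) pchar_Zp ?add0r //.
  by rewrite mE; clear; lia.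
pose p : G := em (- h.+1%:Z, 1); pose b2 : G := em (0, 2).
have mirE a b : mirror (em (a, b)) = em (- a, b) by rewrite !emE /mirror /= intrN.
have [P1 Q1] := cap fst s ws cap0 m1 szr; have [Q2 P2] := cap snd s ws cap1 m2 szr.
have [Q3 P3] := cap fst s' ws' cap1 m3 szr'; have [Q4 P4] := cap snd s' ws' cap1 m4 szr'.
have E0 : em cap0 - c1 = p.
  by rewrite -embB /p -m0; congr (em (_, _)); rewrite /=; clear; lia.
have E0' : - em cap0 = - b2 by rewrite /cap0 -[m%:Z]addr0 m0.
have E1 : em cap1 - c1 = - b2.
  by rewrite -embB negE; congr (em (_, _)); rewrite /=; clear; lia.
have E1' : - em cap1 = p by rewrite negE.
rewrite E0 in P1; rewrite E0' in Q1; rewrite E1 in Q2 Q3 Q4; rewrite E1' in P2 P3 P4.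
move/linkedN: Q1; rewrite opprK => Q1; move/linkedN: Q2; rewrite opprK => Q2.
move/linkedN: Q3; rewrite opprK => Q3; move/linkedN: Q4; rewrite opprK => Q4.
move/linked_mirror: P3; move/linked_mirror: P4; move/linked_mirror: Q3; move/linked_mirror: Q4.
rewrite !mirE oppr0 opprK => Q4 Q3 P4 P3.
have R1 := linked_rung_end fst c1 s szr [:: (em cap0 : G, m1)].
have R2 := linked_rung_end snd c1 s szr [:: (em cap1 : G, m2)].
have R3 := linked_mirror (linked_rung_end fst c1 s' szr' [:: (em cap1 : G, m3)]).
have R4 := linked_mirror (linked_rung_end snd c1 s' szr' [:: (em cap1 : G, m4)]).
rewrite last1 in R1 R2; rewrite last1' mirE in R3 R4.
have B1 := linked_rung_end fst c2 S szr2 [::]; have B2 := linked_rung_end snd c2 S szr2 [::].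
have B3 := linked_rung_start fst c2 S szr2 [::]; have B4 := linked_rung_start snd c2 S szr2 [::].
rewrite last2 in B1 B2.
have natE (d : nat) : em (d%:Z, 1) = (d%:R, j%:R) by rewrite emE mul1r.
have natE' (d : nat) : em (- d%:Z, 1) = (- d%:R, j%:R) by rewrite emE mul1r intrN.
have C1 d : d \in down y x -> covers (cycles Bs) (em (d%:Z, 1)) /\ covers (cycles Bs) (em (- d%:Z, 1)).
  move=> dx; split.
    apply: (@covers_sub _ [:: F1.1; F2.1]); first by apply: sub; rewrite /= !inE !eqxx !orbT.
    apply: doubles_layers => //.
    by rewrite /= sz size_down.
  rewrite -mirE; have C := @covers_mirror m w [:: F3.1; F4.1] (em (d%:Z, 1)).
  apply: (@covers_sub _ [:: (M F3).1; (M F4).1]); first by apply: sub; rewrite /= !inE !eqxx !orbT.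
  apply: C; apply: doubles_layers => //.
  by rewrite /= sz' size_down.
have C2 d : d \in down 0 y -> covers (cycles Bs) (em (d%:Z, 1)) /\ covers (cycles Bs) (em (- d%:Z, 1)).
  move=> dy; split.
    apply: (@covers_sub _ [:: F1.2; F2.2]); first by apply: sub; rewrite /= !inE !eqxx !orbT.
    apply: doubles_layers => //.
    by rewrite /= szu size_down.
  rewrite -mirE; have C := @covers_mirror m w [:: F3.2; F4.2] (em (d%:Z, 1)).
  apply: (@covers_sub _ [:: (M F3).2; (M F4).2]); first by apply: sub; rewrite /= !inE !eqxx !orbT.
  apply: C; apply: doubles_layers => //.
  by rewrite /= szu size_down.
have Cb : covers (cycles Bs) (em (0, 2)).
  by apply: (four_covers fb Q1 Q2 Q3 Q4); apply: sub; rewrite /= !inE !eqxx !orbT.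
split=> //.
move=> d dh; rewrite -natE -natE'.
have [d1|d1] := eqVneq d h.+1.
  rewrite d1; split.
    by apply: (four_covers fa R1 R2 P3 P4); apply: sub; rewrite /= !inE !eqxx !orbT.
  by apply: (four_covers fp P1 P2 R3 R4); apply: sub; rewrite /= !inE !eqxx !orbT.
have [d2|d2] := eqVneq d h.+2.
  rewrite d2; split.
    by apply: (four_covers fB B1 B2 B3 B4); apply: sub; rewrite /= !inE !eqxx !orbT.
  rewrite -mirE.
  by apply: (four_covers fB (linked_mirror B1) (linked_mirror B2) (linked_mirror B3)
    (linked_mirror B4)); apply: sub; rewrite /= !inE !eqxx !orbT.
have [dy|dy] := leqP d y; first by apply: C2; rewrite mem_down; move: dh; clear -dy; lia.
by apply: C1; rewrite mem_down; move: dh d1 d2; rewrite /h; clear -dy; lia.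
Qed.

(** * Couples modulo m and 2k + 1 *)

Definition complete_family (V : finType) (sp : V -> V) m1 m2 N : Prop :=
  exists Fs : seq (seq V * seq V), [/\ size Fs = N, all (seats sp m1 m2) Fs
    & forall u v, v != u -> v != sp u -> has (fun F => meets sp F u v) Fs].

Lemma family_transport (V W : finType) (sp : V -> V) (sq : W -> W) n m1 m2 N :
  involutive sp -> (forall x, sp x != x) -> #|V| = (2 * n)%N ->
  involutive sq -> (forall x, sq x != x) -> #|W| = (2 * n)%N ->
  complete_family sp m1 m2 N -> complete_family sq m1 m2 N.
Proof.
move=> spK sp_neq cardV sqK sq_neq cardW [Fs [sz ok cov]].
have [f [[f' fK f'K] fsp]] := couple_coordinates spK sp_neq cardV.
have [g [[g' gK g'K] gsp]] := couple_coordinates sqK sq_neq cardW.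
have inj : injective (g' \o f) by apply: inj_comp; [exact: can_inj g'K | exact: can_inj fK].
have com x : (g' \o f) (sp x) = sq ((g' \o f) x).
  by apply: (can_inj gK); rewrite gsp /= !g'K fsp.
exists [seq map2 (g' \o f) F | F <- Fs]; split; first by rewrite size_map.
  by rewrite all_map; apply: sub_all ok => F; apply: seats_map.
move=> u v vu vpu; rewrite has_map.
have back x : (g' \o f) (f' (g x)) = x by rewrite /= f'K gK.
have /sub_has : has (fun F => meets sp F (f' (g u)) (f' (g v))) Fs.
  apply: cov; first by apply: contra vu => /eqP E; rewrite -[v]back E back.
  by apply: contra vpu => /eqP E; rewrite -[v]back E com back.
by apply=> F /(meets_map com); rewrite !back.
Qed.

Lemma multipartite_base m w k x y (h := (x + y)%N) :
    m = (2 * h + 5)%N -> w = (2 * k + 1)%N ->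
  exists Bs : seq (seq ('Z_m * 'Z_w * bool) * seq ('Z_m * 'Z_w * bool)),
  [/\ size Bs = (k * 4)%N, all (seats (@spouse _) (2 * x + 3)%N (2 * y.+1)%N) Bs
    & forall j, (0 < j <= k)%N ->
      (forall d, (0 < d <= h.+2)%N -> covers (cycles Bs) (d%:R, j%:R)
                                 /\ covers (cycles Bs) (- d%:R, j%:R))
    /\ covers (cycles Bs) (0, (2 * j)%:R)].
Proof.
move=> mE wE.
suff H K : (K <= k)%N -> exists Bs : seq (seq ('Z_m * 'Z_w * bool) * seq ('Z_m * 'Z_w * bool)),
  [/\ size Bs = (K * 4)%N, all (seats (@spouse _) (2 * x + 3)%N (2 * y.+1)%N) Bs
    & forall j, (0 < j <= K)%N ->
      (forall d, (0 < d <= h.+2)%N -> covers (cycles Bs) (d%:R, j%:R)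
                                 /\ covers (cycles Bs) (- d%:R, j%:R))
    /\ covers (cycles Bs) (0, (2 * j)%:R)] by apply: H.
elim: K => [|K IH] leK; first by exists [::]; split=> // j; lia.
have [Bs [sz ok cov]] := IH (ltnW leK).
have [|||Bs' [sz' ok' cov' cov0]] := @multipartite_block m w K.+1 x y mE; [lia|lia|lia|].
exists (Bs ++ Bs'); split; first by rewrite size_cat sz sz'; lia.
  by rewrite all_cat ok ok'.
have sub1 : {subset cycles Bs <= cycles (Bs ++ Bs')}.
  by move=> c; rewrite !mem_cat !map_cat !mem_cat; case/orP=> ->; rewrite ?orbT.
have sub2 : {subset cycles Bs' <= cycles (Bs ++ Bs')}.
  by move=> c; rewrite !mem_cat !map_cat !mem_cat; case/orP=> ->; rewrite ?orbT.
move=> j jK; have [->|ne] := eqVneq j K.+1.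
  split=> [d /cov' [C1 C2]|]; last exact: covers_sub cov0.
  by split; apply: covers_sub sub2 _.
have [|C1 C2] := cov j; first lia.
split=> [d /C1 [C3 C4]|]; last exact: covers_sub C2.
by split; apply: covers_sub sub1 _.
Qed.

(** As 2k + 1 is odd, every nonzero residue is 2j up to sign for some j = 1, ..., k, as
well as j up to sign.  Hence the blocks cover all differences with a nonzero second
component. *)
Theorem multipartite_solution s m k x y (h := (x + y)%N) :
    m = (2 * h + 5)%N -> (0 < k)%N -> (s + m = m * (2 * k + 1))%N ->
  complete_family (@spouse 'Z_m) (2 * x + 3)%N (2 * y.+1)%N (2 * m.-1)%N ->
  HOP_solvable s [:: (2 * x + 3)%N; (2 * y.+1)%N] /\
  HOP_solvable s [:: (2 * y.+1)%N; (2 * x + 3)%N].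
Proof.
move=> mE k0 sE [Sp [szS okS covS]]; set w := (2 * k + 1)%N in sE.
have m_gt1 : (1 < m)%N by lia.
have w_gt1 : (1 < w)%N by lia.
have [Bs [szB okB covB]] := @multipartite_base m w k x y mE erefl.
have cardZ n : (1 < n)%N -> #|'Z_n| = n by move=> n1; rewrite card_ord Zp_cast.
pose put (i : 'Z_w) (u : 'Z_m * bool) : 'Z_m * 'Z_w * bool := ((u.1, i), u.2).
have putI i : injective (put i) by case=> z a [z' b] [-> ->].
pose Fs := [seq map2 (put i) F | F <- Sp, i <- enum 'Z_w] ++ orbits Bs.
apply: (family_solves_both (sp := @spouse ('Z_m * 'Z_w)%type) (Fs := Fs)).
- exact: spouseK.
- exact: spouse_neq.
- by rewrite !card_prod card_bool !cardZ //; lia.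
- by lia.
- by lia.
- rewrite size_cat size_allpairs size_orbits card_prod szS szB -cardE !cardZ //.
  rewrite (_ : 2 * x + 3 + 2 * y.+1 = m)%N; last by lia.
  by rewrite sE /w; nia.
- rewrite all_cat seats_orbits // andbT; apply/allP=> _ /allpairsP[[F i] [/= FS _ ->]].
  exact: (seats_map (@putI i) _ (allP okS _ FS)).
move=> [[z i] a] [[z' i'] b] vu vpu; rewrite has_cat; apply/orP.
have [Ei|ne] := eqVneq i' i.
  left; rewrite Ei in vu vpu *.
  have /hasP[F FS mF] : has (fun F => meets (@spouse 'Z_m) F (z, a) (z', b)) Sp.
    apply: covS; first by apply: contra vu => /eqP[-> ->].
    by apply: contra vpu => /eqP[-> ->].
  apply/hasP; exists (map2 (put i) F); first by apply/allpairsP; exists (F, i); rewrite mem_enum.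
  exact: (meets_map (f := put i) (sq := @spouse _) _ mF).
right; apply: meets_orbits; rewrite (_ : (z', i') - (z, i) = (z' - z, i' - i)) //.
have : i' - i != 0 by rewrite subr_eq0.
move: (i' - i) (z' - z) {vu vpu ne} => r d r0.
have half n (c : 'Z_n) : (1 < n)%N -> odd n -> c != 0 -> exists2 e,
    (0 < e <= n./2)%N & c = e%:R \/ c = - e%:R.
  move=> n1 on c0; have c_gt0 : (0 < val c)%N by rewrite lt0n.
  have c_lt : (val c < n)%N by rewrite -[X in (_ < X)%N](Zp_cast n1); exact: ltn_ord.
  have [le|gt] := leqP (val c) n./2.
    by exists (val c); [rewrite c_gt0 | left; rewrite natr_Zp].
  exists (n - val c)%N; first by move: c_lt gt; clear -on; lia.
  by right; rewrite natrB ?(ltnW c_lt) // pchar_Zp // natr_Zp sub0r opprK.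
have pairN (p : 'Z_m) (q : 'Z_w) : (- p, - q) = - (p, q) by [].
have [d0|d0] := eqVneq d 0.
  have [r' rE] : exists2 j, (0 < j <= k)%N & r = (2 * j)%:R \/ r = - (2 * j)%:R.
    have r_gt0 : (0 < val r)%N by rewrite lt0n.
    have r_lt : (val r < w)%N by rewrite -[X in (_ < X)%N](Zp_cast w_gt1); exact: ltn_ord.
    pose q := val r; have qE : r = q%:R by rewrite natr_Zp.
    rewrite -/q in r_gt0 r_lt.
    have [od|ev] := boolP (odd q); last first.
      exists q./2; first by move: r_gt0 r_lt ev; rewrite /w; move: (q); clear; lia.
      by left; rewrite qE; congr _%:R; move: ev; move: (q); clear; lia.
    exists (w - q)./2; first by move: r_gt0 r_lt od; rewrite /w; move: (q); clear; lia.
    right; rewrite (_ : (2 * _)%N = (w - q)%N); last by move: od r_lt; rewrite /w; move: (q); clear; lia.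
    by rewrite natrB ?(ltnW r_lt) // pchar_Zp // -qE sub0r opprK.
  have [_ C] := covB r' rE; rewrite d0; case=> ->; first exact: C.
  by rewrite -{1}oppr0 pairN; apply: coversN.
have [||e eP dE] := half m d m_gt1; [by rewrite mE; clear; lia | exact: d0 |].
have [||j jP rE] := half w r w_gt1; [by rewrite /w; clear; lia | exact: r0 |].
have [|C _] := covB j; first by move: jP; rewrite /w; clear; lia.
have [|C1 C2] := C e; first by move: eP; rewrite mE; clear; lia.
case: dE rE => -> [] -> //; first by rewrite -[e%:R]opprK pairN; apply: coversN.
by rewrite pairN; apply: coversN.
Qed.

(** * Starters on a circle *)

Definition adj (T : Type) (s : seq T) (u v : T) : Prop :=
  exists s1 s2, s = s1 ++ u :: v :: s2.

Section Starter.
Variable N : nat.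
Hypothesis N_gt0 : (0 < N)%N.
Local Notation Z := 'Z_(2 * N).
Local Notation V := (Z + bool)%type.

Let n_gt1 : (1 < 2 * N)%N. Proof. by lia. Qed.

Definition partner (u : V) : V :=
  match u with inl z => inl (z + N%:R) | inr b => inr (~~ b) end.

Lemma half_half : N%:R + N%:R = 0 :> Z.
Proof. by rewrite -natrD addnn -mul2n pchar_Zp. Qed.

Lemma half_neq0 : N%:R != 0 :> Z.
Proof.
apply/negP => /eqP/(congr1 val); rewrite /= val_Zp_nat // modn_small; lia.
Qed.

Lemma partnerK : involutive partner.
Proof. by case=> [z|b] /=; rewrite ?negbK // -addrA half_half addr0. Qed.

Lemma partner_neq u : partner u != u.
Proof.
case: u => [z|[]] //=; apply: contra half_neq0 => /eqP[].
by rewrite -{2}[z]addr0 => /addrI ->.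
Qed.

Lemma card_points : #|{: V}| = (2 * N.+1)%N.
Proof. by rewrite card_sum card_bool card_ord Zp_cast //; lia. Qed.

Definition turn (t : Z) (u : V) : V :=
  match u with inl z => inl (z + t) | inr b => inr b end.

Lemma turn_inj t : injective (turn t).
Proof.
apply: (can_inj (g := fun u : V => match u with inl z => inl (z - t) | inr b => inr b end)).
by case=> // z; rewrite /= addrK.
Qed.

Lemma turn_partner t u : turn t (partner u) = partner (turn t u).
Proof. by case: u => //= z; rewrite addrAC. Qed.

Definition point (u : nat * bool) : Z := u.1%:R + (if u.2 then N%:R else 0).

Definition dist (x y : nat) : nat := (x - y + (y - x))%N.

(** Couple x < N has the ends x and x + N.  This is the circular length of the
crossing from the end [u] to the spouse of the end [v]. *)
Definition class (u v : nat * bool) : nat :=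
  (if u.2 (+) v.2 then dist u.1 v.1 else N - dist u.1 v.1)%N.

Lemma point_inj u v : (u.1 < N)%N -> (v.1 < N)%N -> point u = point v -> u = v.
Proof.
case: u v => [x e] [y f] /= xN yN.
have pE z (g : bool) : point (z, g) = (z + (if g then N else 0))%:R.
  by rewrite /point /= natrD; case: g.
rewrite !pE => /(congr1 val); rewrite /= !val_Zp_nat // !modn_small;
  try (case: (e); lia); last by case: (f); lia.
by case: e; case: f => /= E; congr (_, _); lia.
Qed.

Lemma pointE u : point u = ((u.1 + (if u.2 then N else 0))%N : int)%:~R.
Proof. by rewrite /point -[RHS]/((_ + _)%N%:R) natrD; case: u.2. Qed.

Lemma eq_mod_full (p q k : int) : p = q + k * (2 * N)%N%:Z -> p%:~R = q%:~R :> Z.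
Proof.
by move=> ->; rewrite intrD intrM -[(2 * N)%N%:Z%:~R]/((2 * N)%:R) pchar_Zp // mulr0 addr0.
Qed.

Lemma point_class u v : (u.1 < N)%N -> (v.1 < N)%N ->
  let d := (class u v)%:R : Z in
  point v + N%:R = point u + d \/ point u = point v + N%:R + d.
Proof.
case: u v => [x e] [y f] /= xN yN; rewrite !pointE /class /=.
rewrite -[N%:R]/(N%:Z%:~R); set D := (if e (+) f then _ else _); rewrite -[D%:R]/(D%:Z%:~R) -!intrD.
have [le|lt] := leqP x y; rewrite /D /dist {D}; case: e; case: f => /=.
- by right; apply: (@eq_mod_full _ _ (-1)); lia.
- by left; apply: (@eq_mod_full _ _ 0); lia.
- by left; apply: (@eq_mod_full _ _ 1); lia.
- by right; apply: (@eq_mod_full _ _ (-1)); lia.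
- by left; apply: (@eq_mod_full _ _ 0); lia.
- by right; apply: (@eq_mod_full _ _ 0); lia.
- by right; apply: (@eq_mod_full _ _ (-1)); lia.
- by left; apply: (@eq_mod_full _ _ 0); lia.
Qed.

Lemma meets_sym F u v : meets partner F u v = meets partner F v u.
Proof. by rewrite /meets !(joinedC _ _ u). Qed.

Definition seat (u : nat * bool) : V := inl (point u).

Lemma dart_joined (c : seq V) u v : (u, v) \in darts partner c -> joined partner c u v.
Proof. by rewrite /joined => ->. Qed.

Lemma adj_joined L tl u v : adj L u v ->
  joined partner (map seat L ++ tl) (seat u) (partner (seat v)).
Proof.
case=> s1 [s2 ->]; apply: dart_joined; rewrite map_cat /= -catA; exact: dart_next.
Qed.

Lemma closing_joined v L : joined partner (map seat (v :: L)) (seat (last v L)) (partner (seat v)).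
Proof.
by apply: dart_joined; have := dart_last partner (seat v) (map seat L); rewrite last_map.
Qed.

Definition spans (c : seq V) (d : nat) : Prop := exists z z', joined partner c (inl z) (inl z')
  /\ (z' = z + d%:R \/ z = z' + d%:R).

Lemma spans_class c u v : (u.1 < N)%N -> (v.1 < N)%N ->
  joined partner c (seat u) (partner (seat v)) -> spans c (class u v).
Proof. by move=> uN vN J; exists (point u), (point v + N%:R); split=> //; apply: point_class. Qed.

Lemma joined_turn c t u v : joined partner c u v ->
  joined partner (map (turn t) c) (turn t u) (turn t v).
Proof. exact: joined_map (turn_partner t). Qed.

Lemma spans_all c d a : spans c d ->
  exists t, joined partner (map (turn t) c) (inl a) (inl (a + d%:R)).
Proof.
case=> z [z' [J [E|E]]].
  exists (a - z); move/(joined_turn (a - z)): J; rewrite /turn E.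
  by congr joined; congr inl; ring.
exists (a - z'); move/(joined_turn (a - z')): J; rewrite joinedC /turn E.
by congr joined; congr inl; ring.
Qed.

(** The night may depend on the rotation, which is needed for digons. *)
Lemma turning_family (F : Z -> seq V * seq V) m1 m2 :
    (forall t, seats partner m1 m2 (F t)) ->
    (forall d a, (0 < d < N)%N ->
       exists t, meets partner (map2 (turn t) (F t)) (inl a) (inl (a + d%:R))) ->
    (forall b a, exists t, meets partner (map2 (turn t) (F t)) (inr b) (inl a)) ->
  complete_family partner m1 m2 (2 * N).
Proof.
move=> ok fin inf; exists [seq map2 (turn t) (F t) | t <- enum Z]; split.
- by rewrite size_map -cardE card_ord Zp_cast.
- rewrite all_map; apply/allP=> t _ /=.
  exact: (seats_map (sp := partner) (sq := partner) (@turn_inj t) (turn_partner t) (ok t)).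
have ex u v : (exists t, meets partner (map2 (turn t) (F t)) u v) ->
    has (fun G => meets partner G u v) [seq map2 (turn t) (F t) | t <- enum Z].
  by case=> t mt; rewrite has_map; apply/hasP; exists t; rewrite ?mem_enum.
move=> [x|b] [y|b'] vu vpu; apply: ex; last 1 first.
- by move: vu vpu; case: b b' => [] [].
- have rE : y = x + (y - x) by rewrite addrC subrK.
  set r := y - x in rE; have r_lt : (val r < 2 * N)%N.
    by rewrite -[X in (_ < X)%N](Zp_cast n_gt1); exact: ltn_ord.
  have r0 : (0 < val r)%N.
    by rewrite lt0n; apply: contra vu => /eqP E; rewrite rE (_ : r = 0) ?addr0 //; apply: val_inj.
  have rN : val r != N.
    apply: contra vpu => /eqP E; rewrite rE /= (_ : r = N%:R) //; by rewrite -[LHS]natr_Zp E.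
  have [lt|ge] := ltnP (val r) N.
    by rewrite rE -[r]natr_Zp; apply: fin; rewrite r0.
  have [|t mt] := fin (2 * N - val r)%N y; first by move: rN; lia.
  exists t; rewrite meets_sym; move: mt; rewrite natrB ?(ltnW r_lt) // pchar_Zp // natr_Zp.
  by rewrite sub0r {2}rE addrK.
- by have [t mt] := inf b' x; exists t; rewrite meets_sym.
- exact: inf.
Qed.

Lemma seats_points C P : uniq (map fst (C ++ P)) -> (forall u, u \in C ++ P -> (u.1 < N)%N) ->
  seats partner (size C) (size P).+1 (map seat C, rcons (map seat P) (inr false)).
Proof.
move=> U lt; rewrite /seats /= size_rcons !size_map !eqxx /=.
pose flip (u : nat * bool) := (u.1, ~~ u.2).
have flipE u : partner (seat u) = seat (flip u).
  case: u => x e; rewrite /seat /point /flip /=; congr inl.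
  by case: e; rewrite /=; ring: half_half.
have P1 : perm_eq ((map seat C ++ rcons (map seat P) (inr false)) ++
             map partner (map seat C ++ rcons (map seat P) (inr false)))
   ([:: inr false; inr true] ++ map seat ((C ++ P) ++ map flip (C ++ P))).
  have E : map partner (map seat C ++ rcons (map seat P) (inr false)) =
      rcons (map seat (map flip (C ++ P))) (inr true).
    rewrite -cats1 catA -map_cat -cats1 map_cat; congr (_ ++ _).
    by rewrite -!map_comp; apply: eq_map => u; apply: flipE.
  rewrite E -!cats1 !map_cat; apply/permP=> a; rewrite !count_cat /=; clear.
  by move: (a (inr false)) (a (inr true)) => b b'; lia.
rewrite (perm_uniq P1) cat_uniq; apply/and3P; split=> //.
  by apply/hasPn => _ /mapP[u _ ->]; rewrite !in_cons.
have lt' u : u \in (C ++ P) ++ map flip (C ++ P) -> (u.1 < N)%N.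
  by rewrite mem_cat => /orP[/lt //|/mapP[v /lt ? ->]].
rewrite map_inj_in_uniq; last first.
  move=> u v /lt' uN /lt' vN E; apply: point_inj => //.
  by move: E; rewrite /seat => /(congr1 (fun w : V => if w is inl z then z else 0)).
have flipK : involutive flip by case=> x e; rewrite /flip /= negbK.
rewrite cat_uniq (map_uniq U) (map_inj_uniq (inv_inj flipK)) (map_uniq U) andbT.
apply/hasPn=> _ /mapP[u uL ->]; apply/negP=> fL.
have : flip u = u.
  apply: contraTeq U => ne; set L := C ++ P in uL fL *.
  apply/negP=> U; have := @nth_uniq _ 0%N (map fst L) (index (flip u) L) (index u L).
  rewrite !size_map !index_mem => /(_ fL uL U); rewrite !(nth_map u) ?index_mem // !nth_index //.
  rewrite eqxx => /esym/eqP E; case/eqP: ne.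
  by rewrite -(nth_index u fL) E nth_index.
by case: (u) => x [].
Qed.

Lemma ends_joined v L b a :
  exists t, joined partner (map (turn t) (rcons (map seat (v :: L)) (inr false))) (inr b) (inl a).
Proof.
pose c := rcons (map seat (v :: L)) (inr false : V).
have J1 : joined partner c (seat (last v L)) (inr true).
  apply: dart_joined; rewrite /c lastI map_rcons -cats1 cat_rcons.
  exact: (dart_next partner _ _ (inr false) [::]).
have J2 : joined partner c (inr false) (partner (seat v)).
  apply: dart_joined; rewrite /c /= .
  have := dart_last partner (seat v) (rcons (map seat L) (inr false)).
  by rewrite last_rcons.
case: b.
  exists (a - point (last v L)).
  move/(joined_turn (a - point (last v L))): J1; rewrite joinedC /turn /seat.
  by congr joined; congr inl; ring.
exists (a - (point v + N%:R)).
by move/(joined_turn (a - (point v + N%:R))): J2; congr joined; congr inl; ring.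
Qed.

Lemma adj_mem (T : eqType) (s : seq T) u v : adj s u v -> u \in s /\ v \in s.
Proof. by case=> s1 [s2 ->]; rewrite !mem_cat !in_cons !eqxx !orbT. Qed.

(** The two edges that join the ends of [P] to the fixed couple sweep out all the
meetings of that couple. *)
Theorem starter_family C P :
    P != [::] -> uniq (map fst (C ++ P)) -> (forall u, u \in C ++ P -> (u.1 < N)%N) ->
    (forall d, (0 < d < N)%N -> exists u v, class u v = d /\
       [\/ adj P u v, adj C u v | exists2 L, C = v :: L & u = last v L]) ->
  complete_family partner (size C) (size P).+1 (2 * N).
Proof.
move=> P0 U lt cov; pose P' := rcons (map seat P) (inr false : V).
apply: (turning_family (F := fun=> (map seat C, P'))).
- by move=> t; apply: seats_points.
- move=> d a /cov [u [v [<- H]]].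
  have inC w : w \in C -> (w.1 < N)%N by move=> wC; apply: lt; rewrite mem_cat wC.
  have inP w : w \in P -> (w.1 < N)%N by move=> wP; apply: lt; rewrite mem_cat wP orbT.
  case: H => [A|A|[L CE uE]].
  + have [uP vP] := adj_mem A.
    have := adj_joined [:: inr false] A; rewrite cats1 => J.
    have [t Jt] := spans_all a (spans_class (inP _ uP) (inP _ vP) J).
    by exists t; rewrite /meets /= Jt orbT.
  + have [uC vC] := adj_mem A.
    have := adj_joined [::] A; rewrite cats0 => J.
    have [t Jt] := spans_all a (spans_class (inC _ uC) (inC _ vC) J).
    by exists t; rewrite /meets /= Jt.
  + have vC : v \in C by rewrite CE mem_head.
    have uC : u \in C by rewrite CE uE mem_last.
    have J : joined partner (map seat C) (seat u) (partner (seat v)).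
      by rewrite CE uE; apply: closing_joined.
    have [t Jt] := spans_all a (spans_class (inC _ uC) (inC _ vC) J).
    by exists t; rewrite /meets /= Jt.
- move=> b a; rewrite /P'; case: (P) P0 => // v L _.
  by have [t Jt] := ends_joined v L b a; exists t; rewrite /meets Jt orbT.
Qed.

Lemma half_turn (t : Z) : (N <= val (t + N%:R)%R)%N = (val t < N)%N.
Proof.
have lt : (val t < 2 * N)%N by rewrite -[X in (_ < X)%N](Zp_cast n_gt1); exact: ltn_ord.
rewrite -{1}[t]natr_Zp -natrD [val _]/= val_Zp_nat //.
rewrite [val t]/= in lt *; move: (nat_of_ord t) lt => q lt.
have [h|h] := ltnP q N; first by rewrite modn_small; lia.
by rewrite (_ : (q + N = q - N + 2 * N)%N); [rewrite modnDr modn_small; lia | lia].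
Qed.

(** A half turn maps a digon to itself and would repeat its meetings.  So the digon
is used in one way by half of the rotations, with two crossings of length N - 1, and
in the other way by the other half, with two crossings of length 1. *)
Theorem digon_family P : (2 < N)%N ->
    P != [::] -> uniq (map fst P) -> (forall u, u \in P -> (1 < u.1 < N)%N) ->
    (forall d, (1 < d < N.-1)%N -> exists u v, class u v = d /\ adj P u v) ->
  complete_family partner 2 (size P).+1 (2 * N).
Proof.
move=> N2 P0 U lt cov; pose P' := rcons (map seat P) (inr false : V).
pose D (t : Z) := [:: (0%N, false); (1%N, N <= val t)%N].
apply: (turning_family (F := fun t => (map seat (D t), P'))).
- move=> t; apply: (@seats_points (D t)) => /=.
    have out c : (c <= 1)%N -> c \in map fst P = false.
      by move=> c1; apply/negP => /mapP[u /lt lu E]; move: lu; rewrite -E; clear -c1; lia.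
    by rewrite !in_cons !out // U.
  by move=> u; rewrite !in_cons => /or3P[/eqP ->|/eqP ->|/lt]; rewrite /=; lia.
- move=> d a dN; have [d1|d1] := eqVneq d 1%N.
    have [t [tN at_]] : exists t : Z, (N <= val t)%N /\ (a = t \/ a = t + N%:R).
      have [h|h] := leqP N (val a); first by exists a; auto.
      by exists (a + N%:R); rewrite half_turn h -addrA half_half addr0; auto.
    exists t; rewrite /meets /D tN d1; apply/orP; left.
    have := @dart_next _ partner [::] (turn t (seat (0%N, false))) (turn t (seat (1%N, true))) [::].
    have := @dart_last _ partner (turn t (seat (0%N, false))) [:: turn t (seat (1%N, true))].
    rewrite /= /point /= !addr0 !add0r => /dart_joined J1 /dart_joined J2.
    case: at_ => ->.
      by move: J2; congr joined; congr inl; ring: half_half.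
    by rewrite joinedC; move: J1; congr joined; congr inl; ring: half_half.
  have [dN1|dN1] := eqVneq d N.-1.
    have NE : d%:R = N%:R - 1 :> Z by rewrite dN1 -subn1 natrB.
    have [t [tN at_]] : exists t : Z, (N <= val t)%N = false /\ (a = t + 1 \/ a = t + 1 + N%:R).
      have [h|h] := leqP N (val (a - 1)).
        exists (a - 1 + N%:R); rewrite half_turn ltnNge h; split=> //; right.
        by ring: half_half.
      by exists (a - 1); rewrite leqNgt h; split=> //; left; ring.
    exists t; rewrite /meets /D tN; apply/orP; left.
    have := @dart_next _ partner [::] (turn t (seat (0%N, false))) (turn t (seat (1%N, false))) [::].
    have := @dart_last _ partner (turn t (seat (0%N, false))) [:: turn t (seat (1%N, false))].
    rewrite /= /point /= !addr0 !add0r => /dart_joined J1 /dart_joined J2.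
    case: at_ => ->.
      by move: J1; congr joined; congr inl; ring: NE half_half.
    by rewrite joinedC; move: J2; congr joined; congr inl; ring: NE half_half.
  have [|u [v [<- A]]] := cov d; first by move: dN d1 dN1; clear; lia.
  have [uP vP] := adj_mem A.
  have := adj_joined [:: inr false] A; rewrite cats1 => J.
  have /andP[_ uN] := lt _ uP; have /andP[_ vN] := lt _ vP.
  have [t Jt] := spans_all a (spans_class uN vN J).
  by exists t; rewrite /meets /= Jt orbT.
- move=> b a; rewrite /P'; case: (P) P0 => // v L _.
  by have [t Jt] := ends_joined v L b a; exists t; rewrite /meets Jt orbT.
Qed.

End Starter.

(** * Adjacent entries *)

Local Close Scope ring_scope.

Section Adjacent.
Variables (T S : Type).
Implicit Types (s : seq T) (u v : T).

Lemma adj_catl s1 s2 u v : adj s1 u v -> adj (s1 ++ s2) u v.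
Proof. by case=> a [b ->]; exists a, (b ++ s2); rewrite -catA. Qed.

Lemma adj_catr s1 s2 u v : adj s2 u v -> adj (s1 ++ s2) u v.
Proof. by case=> a [b ->]; exists (s1 ++ a), b; rewrite catA. Qed.

Lemma adj_cross s1 s2 z : s1 <> [::] -> s2 <> [::] ->
  adj (s1 ++ s2) (last z s1) (head z s2).
Proof.
case/lastP: s1 => // s1 u _; case: s2 => // v s2 _.
by exists s1, s2; rewrite last_rcons cat_rcons.
Qed.

Lemma adj_map (f : T -> S) s u v : adj s u v -> adj (map f s) (f u) (f v).
Proof. by case=> a [b ->]; exists (map f a), (map f b); rewrite map_cat. Qed.

Lemma adj_rev s u v : adj s u v -> adj (rev s) v u.
Proof.
case=> a [b ->]; exists (rev b), (rev a).
by rewrite rev_cat !rev_cons -!cats1 -!catA.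
Qed.

Lemma adj_cons s w u v : adj s u v -> adj (w :: s) u v.
Proof. by case=> a [b ->]; exists (w :: a), b. Qed.

Lemma adj_sorted (R : rel T) s u v : sorted R s -> adj s u v -> R u v.
Proof.
move=> So [a [b E]]; move: So; rewrite E; case: a {E} => [|w a] /=; first by case/andP.
by rewrite cat_path /= => /and3P[_ _ /andP[]].
Qed.

End Adjacent.

Lemma distC u v : dist u v = dist v u. Proof. exact: addnC. Qed.

(** * Graceful paths with given ends *)

Definition apart l : rel nat := fun u v => (u < l) != (v < l).

(** A path on 0, ..., K - 1 with steps of all lengths which alternates between the
lower and the upper half: when the halves are pulled apart by [a], every step
becomes longer by [a] ([stretch_apart]). *)
Definition alpha K x (s : seq nat) : Prop := let l := uphalf K in
  [/\ size s = K /\ uniq s, forall z, z \in s -> z < K,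
      head 0 s = x /\ last 0 s = (if odd K then l - 1 - x else l + x),
      sorted (apart l) s
    & forall d, 0 < d < K -> exists u v, adj s u v /\ dist u v = d].

Definition fan x i := if odd i then x + uphalf i else x - i./2.

(** The swings around [x] become wider and wider. *)
Lemma alpha_fan K x : K = 2 * x + 1 \/ K = 2 * x + 2 -> alpha K x (mkseq (fan x) K).
Proof.
move=> KE; have lE : uphalf K = x.+1 by lia.
have K0 : 0 < K by lia.
split; rewrite ?size_mkseq ?lE.
- split=> //; apply/mkseq_uniqP => i j; rewrite !inE /fan => iK jK.
  by case: ifP => oi; case: ifP => oj; lia.
- by move=> z /mapP[i]; rewrite mem_iota /fan => iK ->; case: ifP => oi; lia.
- case: K KE K0 {lE} => // K KE _; split; first by rewrite /mkseq /= /fan /=; lia.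
  rewrite /mkseq -[K.+1]addn1 iotaD map_cat last_cat /= /fan.
  by case: KE => KE; case: ifP => ?; case: ifP => ?; lia.
- apply/(sortedP 0) => i; rewrite size_mkseq => lt.
  by rewrite !nth_mkseq ?(ltnW lt) // /apart /fan; case: ifP => oi; case: ifP => oj; lia.
move=> d dK; exists (fan x d.-1), (fan x d); split; last first.
  by rewrite /dist /fan; case: ifP => oi; case: ifP => oj; lia.
have dE : K = d.-1 + (2 + (K - d - 1)) by lia.
rewrite /mkseq {1}dE !iotaD !map_cat add0n.
exists (map (fan x) (iota 0 d.-1)), (map (fan x) (iota d.+1 (K - d - 1))).
have d1 : d.-1.+1 = d by lia.
by rewrite /= d1 (_ : d.-1 + 2 = d.+1) //; lia.
Qed.

Definition stretch l a z := if z < l then z else z + a.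

Lemma stretch_inj l a : injective (stretch l a).
Proof. by move=> u v; rewrite /stretch; case: ifP => ?; case: ifP => ?; lia. Qed.

Lemma stretch_apart l a u v : apart l u v -> dist (stretch l a u) (stretch l a v) = dist u v + a.
Proof. by rewrite /apart /stretch /dist; case: ifP => hu; case: ifP => hv //; lia. Qed.

Lemma sorted_imp (T : eqType) (R R' : rel T) (s : seq T) :
  {in s &, forall u v, R u v -> R' u v} -> sorted R s -> sorted R' s.
Proof.
move=> H /(sortedP _) S; case: s H S => // z s H S.
by apply/(sortedP z) => i lt; apply: H; rewrite ?mem_nth ?(ltnW lt) //; apply: S.
Qed.

(** The second path is nested between the halves of the first one, pulled apart by
[K2]; if the first path ends low, then the second one is turned upside down.  The
step that joins them has length [K2]. *)
Lemma alpha_compose K1 K2 x s1 s2 : 0 < K1 -> 0 < K2 ->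
    2 * x < K1 -> 2 * x < K2 ->
    alpha K1 x s1 -> alpha K2 x s2 -> exists s, alpha (K1 + K2) x s.
Proof.
move=> K10 K20 x1 x2 [[sz1 U1] lt1 [hd1 la1] so1 cov1] [[sz2 U2] lt2 [hd2 la2] so2 cov2].
set l1 := uphalf K1 in la1 so1 *; set l2 := uphalf K2 in la2 so2 *.
pose f := stretch l1 K2.
pose g z := if odd K1 then l1 + (K2 - 1 - z) else l1 + z.
have l1E : l1 = uphalf K1 by []. have l2E : l2 = uphalf K2 by [].
have s10 : s1 <> [::] by move=> E; rewrite E in sz1; move: sz1 K10; clear=> /= <-.
have s20 : s2 <> [::] by move=> E; rewrite E in sz2; move: sz2 K20; clear=> /= <-.
have lE : uphalf (K1 + K2) = if odd K1 then l1 + (K2 - l2) else l1 + l2.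
  by rewrite /l1 /l2; case: ifP => o; clear -o; lia.
have fs0 z : head z (map f s1) = f (head 0 s1) by case: (s1) s10.
have fl z : last z (map f s1) = f (last 0 s1) by case: (s1) s10 => //= a b _; rewrite last_map.
have gh z : head z (map g s2) = g (head 0 s2) by case: (s2) s20.
have gl z : last z (map g s2) = g (last 0 s2) by case: (s2) s20 => //= a b _; rewrite last_map.
have fP z : z \in s1 -> (z < l1 /\ f z = z) \/ (l1 <= z < K1 /\ f z = z + K2).
  by move/lt1; rewrite /f /stretch; case: ifP => h zK; [left | right]; move: h; clear -zK; lia.
have gP z : z \in s2 -> z < K2 /\ g z = if odd K1 then l1 + (K2 - 1 - z) else l1 + z.
  by move/lt2.
have cross : dist (f (last 0 s1)) (g (head 0 s2)) = K2.
  rewrite /f /g /stretch la1 hd2 /dist l1E.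
  by case: (boolP (odd K1)) => o; case: ifP => h; move: h; clear -x1 x2 o; lia.
exists (map f s1 ++ map g s2); split; rewrite ?lE.
- rewrite size_cat !size_map sz1 sz2; split=> //.
  rewrite cat_uniq (map_inj_uniq (@stretch_inj _ _)) U1 map_inj_in_uniq ?U2 ?andbT /=; last first.
    by move=> u v /gP[uK ->] /gP[vK ->]; case: ifP => _; move: uK vK; clear; lia.
  apply/hasPn=> _ /mapP[v /gP[vK ->] ->]; apply/negP => /mapP[u /fP H E]; move: E H vK.
  by case: ifP => _ <-; clear; lia.
- move=> z; rewrite mem_cat => /orP[/mapP[u /fP H ->]|/mapP[v /gP[vK ->] ->]].
    by move: H; rewrite l1E; clear -K20; lia.
  by case: ifP => o; move: vK; rewrite l1E; clear -o K10; lia.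
- split; first by case: (s1) s10 hd1 => //= a b _ ->; rewrite /f /stretch l1E;
    case: ifP => //; clear -x1; lia.
  rewrite last_cat gl la2 /g; rewrite oddD l1E l2E.
  by case: (boolP (odd K1)) => o1; case: (boolP (odd K2)) => o2 /=; clear -o1 o2 x1 x2; lia.
- set l := if odd K1 then _ else _.
  have S1 : sorted (apart l) (map f s1).
    rewrite sorted_map; apply: sorted_imp so1 => u v /fP Hu /fP Hv; rewrite /relpre /= /apart.
    have : l1 <= l <= l1 + K2 by rewrite /l; case: ifP => _; rewrite l2E; clear; lia.
    by move: Hu Hv; clear; lia.
  have S2 : sorted (apart l) (map g s2).
    rewrite sorted_map; apply: sorted_imp so2 => u v /gP[uK uE] /gP[vK vE]; rewrite /relpre /= /apart.
    rewrite uE vE /l; case: ifP => _; move: uK vK; rewrite l2E; clear; lia.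
  have X : apart l (last 0 (map f s1)) (head 0 (map g s2)).
    rewrite fl gh la1 hd2 /apart /f /g /stretch /l l1E l2E.
    have [h|h] := boolP ((if odd K1 then uphalf K1 - 1 - x else uphalf K1 + x) < uphalf K1);
    move: h;
    by case: (boolP (odd K1)) => o; clear -x1 x2 o; lia.
  case: (map f s1) S1 X => [|a r] //=; rewrite cat_path => -> /=.
  by case: (map g s2) S2 => [|b q] //= -> ->.
move=> d dK; have [lt|ge] := ltnP d K2.
  have [|u [v [A D]]] := cov2 d; first by rewrite lt; case/andP: dK => ->.
  have [us vs] := adj_mem A.
  exists (g u), (g v); split; first by apply: adj_catr; apply: adj_map.
  have [uK ->] := gP _ us; have [vK ->] := gP _ vs; move: D; rewrite /dist.
  by case: ifP => _; move: uK vK; clear; lia.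
have [dE|ne] := eqVneq d K2.
  exists (f (last 0 s1)), (g (head 0 s2)); split; last by rewrite dE.
  rewrite -(fl 0) -(gh 0); apply: adj_cross; first by case: (s1) s10.
  by case: (s2) s20.
have [|u [v [A D]]] := cov1 (d - K2); first by move: dK ge ne; clear; lia.
exists (f u), (f v); split; first by apply: adj_catl; apply: adj_map.
by rewrite stretch_apart ?(adj_sorted so1 A) // D; move: ge; clear; lia.
Qed.

Lemma head_of_rev (T : Type) (z : T) s : head z (rev s) = last z s.
Proof. by case/lastP: s => // s b; rewrite rev_rcons last_rcons. Qed.

Lemma last_of_rev (T : Type) (z : T) s : last z (rev s) = head z s.
Proof. by case: s => // a s; rewrite rev_cons last_rcons. Qed.

Lemma alpha_rev K x s : odd K -> 2 * x < K -> alpha K x s -> alpha K (uphalf K - 1 - x) (rev s).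
Proof.
move=> oK xK [[sz U] lt [hd la] so cov]; rewrite oK in la; split.
- by rewrite size_rev rev_uniq.
- by move=> z; rewrite mem_rev; apply: lt.
- by rewrite oK head_of_rev last_of_rev hd la; move: xK oK; clear; lia.
- by rewrite rev_sorted; apply: sorted_imp so => u v _ _; rewrite /apart eq_sym.
move=> d /cov[u [v [A D]]]; exists v, u; split; first exact: adj_rev.
by rewrite distC.
Qed.

Lemma alpha_flip K x s : ~~ odd K -> 2 * x < K -> alpha K x s ->
  alpha K (uphalf K - 1 - x) (rev (map (fun z => K - 1 - z) s)).
Proof.
move=> oK xK [[sz U] lt [hd la] so cov]; rewrite (negPf oK) in la.
set f := fun z => _; split.
- rewrite size_rev size_map rev_uniq map_inj_in_uniq //.
  by move=> u v /lt uK /lt vK; rewrite /f; move: uK vK; clear; lia.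
- by move=> z; rewrite mem_rev => /mapP[u /lt uK ->]; rewrite /f; move: uK; clear; lia.
- rewrite (negPf oK) head_of_rev last_of_rev.
  have [E1 E2] : head 0 (map f s) = f (head 0 s) /\ last 0 (map f s) = f (last 0 s).
    by case: (s) sz => [|a r] /=; [move: xK; clear=> + E; rewrite -E | rewrite last_map].
  by rewrite E1 E2 hd la /f; move: xK oK; clear; lia.
- rewrite rev_sorted sorted_map; apply: sorted_imp so => u v /lt uK /lt vK.
  by rewrite /apart /relpre /f /=; move: uK vK oK; clear; lia.
move=> d /cov[u [v [A D]]]; have [/lt uK /lt vK] := adj_mem A.
exists (f v), (f u); split; first exact/adj_rev/adj_map.
by rewrite /f; move: uK vK D; rewrite /dist; clear; lia.
Qed.

(** If [K = 4 * x + 1], then both ends of the path would be [x].  Otherwise fans of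
[2 * x + 1] and [2 * x + 2] points are nested.  If [K] is too small for two fans,
then a symmetry of the path replaces [x] by a smaller start. *)
Theorem alpha_exists K x : 2 * x < K -> (K = 4 * x + 1 -> x = 0) -> exists s, alpha K x s.
Proof.
have [m] := ubnP (K + x); elim: m K x => // m IH K x le xK ex.
have block B : B = 2 * x + 1 \/ B = 2 * x + 2 -> exists s, alpha B x s.
  by move=> BE; exists (mkseq (fan x) B); apply: alpha_fan.
have glue B : B = 2 * x + 1 \/ B = 2 * x + 2 -> 2 * x < K - B ->
    (K - B = 4 * x + 1 -> x = 0) -> exists s, alpha K x s.
  move=> BE lt ex'; have [s1 a1] := block B BE.
  have [|s2 a2] := IH (K - B) x _ lt ex'; first by lia.
  have KE : B + (K - B) = K by lia.
  by rewrite -KE; apply: (alpha_compose _ _ _ lt a1 a2); lia.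
have [small|big] := leqP K (2 * x + 2); first by apply: block; lia.
have [K1|K1] := leqP (4 * x + 2) K.
  (* A fan of 2 x + 2 points would leave the exceptional number 4 x + 1 of them. *)
  have [E|ne] := eqVneq K (6 * x + 3); first by apply: (glue (2 * x + 1)); lia.
  have [E|ne'] := eqVneq K (4 * x + 2); first by apply: (glue (2 * x + 1)); lia.
  by apply: (glue (2 * x + 2)); lia.
have x0 : 0 < x by lia.
have [|||s a] := IH K (uphalf K - 1 - x); [lia|lia|lia|].
have [o|e] := boolP (odd K).
  exists (rev s); have := alpha_rev o _ a.
  by rewrite (_ : uphalf K - 1 - (uphalf K - 1 - x) = x); [apply|]; lia.
exists (rev (map (fun z => K - 1 - z) s)); have := alpha_flip e _ a.
by rewrite (_ : uphalf K - 1 - (uphalf K - 1 - x) = x); [apply|]; lia.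
Qed.

(** * Small cases *)

Lemma mem_zip_behead (T : eqType) (s : seq T) u v :
  (u, v) \in zip s (behead s) -> adj s u v.
Proof.
elim: s => [|a [|b s] IH] //=; rewrite in_cons => /orP[/eqP[-> ->]|].
  by exists [::], s.
by case/IH => s1 [s2 ->]; exists (a :: s1), s2.
Qed.

Lemma mem_zip_rot1 (T : eqType) (s : seq T) u v : (u, v) \in zip s (rot 1 s) ->
  adj s u v \/ exists2 L, s = v :: L & u = last v L.
Proof.
case: s => // w L; rewrite rot1_cons => H.
suff [A|[-> ->]] : adj (w :: L) u v \/ v = w /\ u = last w L by [left | right; exists L].
have : forall a, (u, v) \in zip (a :: L) (rcons L w) ->
    adj (a :: L) u v \/ v = w /\ u = last a L; last by apply.
elim: L {H} => [|b L IH] a /=.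
  by rewrite inE => /eqP[-> ->]; right.
rewrite in_cons => /orP[/eqP[-> ->]|/IH[[s1 [s2 ->]]|]]; last by right.
  by left; exists [::], L.
by left; exists (a :: s1), s2.
Qed.

Definition starter N (C P : seq (nat * bool)) : bool :=
  [&& P != [::], uniq (map fst (C ++ P)), all (fun u => u.1 < N) (C ++ P)
    & all (fun d => d \in [seq class N p.1 p.2 | p <- zip P (behead P) ++ zip C (rot 1 C)])
          (iota 1 N.-1)].

Lemma starter_complete N C P : 0 < N -> starter N C P ->
  complete_family (@partner N) (size C) (size P).+1 (2 * N).
Proof.
move=> N0 /and4P[P0 U lt /allP cov]; apply: starter_family => //.
  by move=> u; apply: (allP lt).
move=> d dN; have /mapP[[u v] uv ->] : d \in [seq class N p.1 p.2
    | p <- zip P (behead P) ++ zip C (rot 1 C)] by apply: cov; rewrite mem_iota; lia.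
exists u, v; split=> //; move: uv; rewrite mem_cat => /orP[/mem_zip_behead ?|/mem_zip_rot1[?|?]].
- exact: Or31.
- exact: Or32.
- exact: Or33.
Qed.

Lemma starter_5_4 : complete_family (@partner 8) 5 4 16.
Proof.
exact: (@starter_complete 8 [:: (0, false); (1, true); (7, false); (2, true); (4, false)]
  [:: (3, false); (6, true); (5, true)]).
Qed.

Lemma starter_7_4 : complete_family (@partner 10) 7 4 20.
Proof.
exact: (@starter_complete 10
  [:: (0, false); (1, true); (9, false); (2, true); (8, false); (3, true); (7, false)]
  [:: (4, false); (6, true); (5, true)]).
Qed.

Lemma starter_9_6 : complete_family (@partner 14) 9 6 28.
Proof.
exact: (@starter_complete 14
  [:: (0, false); (1, true); (13, false); (2, true); (12, false); (3, true); (11, false);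
      (4, false); (6, true)]
  [:: (7, false); (10, true); (5, false); (9, true); (8, true)]).
Qed.

Lemma starter_13_8 : complete_family (@partner 20) 13 8 40.
Proof.
exact: (@starter_complete 20
  [:: (0, false); (1, true); (19, false); (2, true); (18, false); (3, true); (17, false);
      (4, true); (16, false); (5, true); (15, false); (6, true); (12, false)]
  [:: (7, false); (14, true); (10, false); (9, false); (11, true); (8, false); (13, true)]).
Qed.

Lemma digon_2_7 : complete_family (@partner 8) 2 7 16.
Proof.
pose P := [:: (2, false); (5, true); (3, false); (7, true); (4, true); (6, true)].
apply: (@digon_family 8 _ P) => //.
  by apply/allP.
have /allP cov : all (fun d => d \in [seq class 8 p.1 p.2 | p <- zip P (behead P)]) (iota 2 5) by [].
move=> d dN; have /mapP[[u v] uv ->] := cov d (ltac:(by rewrite mem_iota; lia)).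
by exists u, v; split=> //; apply: mem_zip_behead.
Qed.

(** Two nights and their images under a rotation of order 4 of the first four
couples. *)
Lemma explicit_3_2 : complete_family (@spouse 'Z_5) 3 2 8.
Proof.
pose Fs : seq (seq (nat * bool) * seq (nat * bool)) :=
 [:: ([:: (0, true); (2, false); (3, false)], [:: (1, true); (4, true)]);
     ([:: (2, true); (0, true); (1, true)], [:: (3, true); (4, true)]);
     ([:: (0, false); (2, true); (3, true)], [:: (1, false); (4, true)]);
     ([:: (2, false); (0, false); (1, false)], [:: (3, false); (4, true)]);
     ([:: (1, true); (2, false); (3, true)], [:: (0, true); (4, true)]);
     ([:: (3, true); (0, true); (1, false)], [:: (2, true); (4, true)]);
     ([:: (1, false); (2, true); (3, false)], [:: (0, false); (4, true)]);
     ([:: (3, false); (0, false); (1, true)], [:: (2, false); (4, true)])].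
pose f (u : nat * bool) : 'Z_5 * bool := (inZp u.1, u.2).
pose flip (u : nat * bool) := (u.1, ~~ u.2).
exists (map (map2 f) Fs); split=> //.
move=> [x a] [y b] vu vpu; rewrite has_map.
have ff (z : 'Z_5) c : (z, c) = f (val z, c) by rewrite /f /= valZpK.
rewrite (ff x) (ff y).
suff : has (fun F => meets flip F (val x, a) (val y, b)) Fs.
  by apply: sub_has => F /(meets_map (f := f) (sp := flip) (sq := @spouse 'Z_5) (fun=> erefl)).
have /allP/(_ (val x, a)) : all (fun u => all (fun v =>
    (u.1 == v.1) || has (fun F => meets flip F u v) Fs)
    [seq (i, c) | i <- iota 0 5, c <- [:: false; true]])
    [seq (i, c) | i <- iota 0 5, c <- [:: false; true]] by [].
have mem (z : 'Z_5) c : (val z, c) \in [seq (i, c) | i <- iota 0 5, c <- [:: false; true]].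
  by apply/allpairsP; exists (val z, c); rewrite mem_iota ltn_ord !inE; case: c.
move/(_ (mem x a))/allP/(_ _ (mem y b))/orP => [/eqP /= E|//].
have Exy : x = y by apply: val_inj.
by move: vu vpu; rewrite Exy /spouse !xpair_eqE /= eqxx; case: (a) (b) => [] [].
Qed.

(** * Labelled paths *)

(** [chg] tells for each length of a step whether the label of the end changes. *)
Fixpoint walk (chg : nat -> bool) (e : bool) (s : seq nat) : seq (nat * bool) :=
  if s is u :: s' then
    (u, e) :: walk chg (if s' is v :: _ then e (+) chg (dist u v) else e) s'
  else [::].

Lemma map_walk chg e s : map fst (walk chg e s) = s.
Proof. by elim: s e => //= u s IH e; rewrite IH. Qed.

Lemma size_walk chg e s : size (walk chg e s) = size s.
Proof. by rewrite -[in RHS](map_walk chg e s) size_map. Qed.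

Lemma mem_walk chg e s u : u \in walk chg e s -> u.1 \in s.
Proof. by move/(map_f fst); rewrite map_walk. Qed.

Lemma walk_adj chg e s u v : adj s u v ->
  exists f, adj (walk chg e s) (u, f) (v, f (+) chg (dist u v)).
Proof.
case=> a [b ->]; elim: a e => [|w a IH] e /=; first by exists e, [::]; eexists.
by have [f A] := IH (if a ++ u :: v :: b is z :: _ then e (+) chg (dist w z) else e);
   exists f; apply: adj_cons.
Qed.

Lemma walk_class N chg e s u v : adj s u v -> exists p q, adj (walk chg e s) p q /\
  class N p q = (if chg (dist u v) then dist u v else N - dist u v).
Proof.
case/(walk_adj chg e) => f A; exists (u, f), (v, f (+) chg (dist u v)); split=> //.
by rewrite /class /= addbA addbb.
Qed.

Lemma last_walk_true z e f s : s <> [::] ->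
  last (z, f) (walk (fun=> true) e s) = (last z s, e (+) ~~ odd (size s)).
Proof.
elim: s z e f => //= u [|v s] IH z e f _ /=; first by rewrite addbF.
have /= -> := IH u (e (+) true) e (ltac:(by [])).
by congr (_, _); case: (e); case: (odd _).
Qed.

Lemma head_walk z chg e s : s <> [::] -> head z (walk chg e s) = (head z.1 s, e).
Proof. by case: s. Qed.

(** * Graceful paths with a prescribed start *)

Definition graceful K x (s : seq nat) : Prop :=
  [/\ size s = K /\ uniq s, forall z, z \in s -> z < K, head 0 s = x
    & forall d, 0 < d < K -> exists u v, adj s u v /\ dist u v = d].

(** A start in the upper half is moved to the lower half by a reflection. *)
Lemma graceful_exists K x : x < K -> (K = 4 * x + 1 -> K = 1) ->
  (K = 4 * (K - 1 - x) + 1 -> K = 1) -> exists s, graceful K x s.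
Proof.
move=> xK e1 e2; have [lt|ge] := ltnP (2 * x) K.
  have [|s [sz lt' [hd _] _ cov]] := alpha_exists lt; first by lia.
  by exists s.
have [||s [[sz U] lt' [hd _] _ cov]] := @alpha_exists K (K - 1 - x); [lia|lia|].
exists (map (fun z => K - 1 - z) s); split.
- rewrite size_map map_inj_in_uniq // => u v /lt' uK /lt' vK.
  by move: uK vK; clear; lia.
- by move=> _ /mapP[u /lt' uK ->]; move: uK; clear; lia.
- by case: s sz hd {U lt' cov} => [|a s] /= sz hd; [move: xK; rewrite -sz | rewrite hd; lia].
move=> d /cov[u [v [A D]]]; have [/lt' uK /lt' vK] := adj_mem A.
exists (K - 1 - u), (K - 1 - v); split; first exact: (adj_map (fun z => K - 1 - z)).
by move: D uK vK; rewrite /dist; clear; lia.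
Qed.

Lemma adj_shift k s u v : adj s u v -> adj (map (addn k) s) (k + u) (k + v).
Proof. exact: adj_map. Qed.

Lemma dist_shift k u v : dist (k + u) (k + v) = dist u v.
Proof. by rewrite /dist !subnDl. Qed.

(** * The even cycle through the fixed couple *)

(** The cycle is a graceful path whose halves are pulled apart by [a] and which is
closed by an edge of length [a].  The path visits the [a] couples in the gap, jumps
over the upper half with length [b], and proceeds gracefully on the last [b]
couples.  The label changes on the edges of the cycle except for the closing one,
which gives the classes a + 1, ..., a + 2c, and N - a.  Outside, it changes only on
the edge of length [a] and in the gap; this gives the class [a], those below [a],
and the ones above a + 2c other than N - a. *)
Lemma odd_inside c p a L1 q e s2 x (N := 2 * c + 2 * p) (b := 2 * p - 1 - a) :
    1 < p -> 0 < a <= c -> odd a = odd c -> a < b ->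
    L1 <> [::] -> last (0, false) L1 = (q, e) -> size L1 = a -> uniq (map fst L1) ->
    (forall u, u \in L1 -> c < u.1 <= c + a) ->
    (forall d, 0 < d < a -> exists u v, class N u v = d /\ adj L1 u v) ->
    graceful b x s2 -> 2 * c + a + 1 + x = q + b ->
  complete_family (@partner N) (2 * c + 1) (2 * p) (2 * N).
Proof.
move=> p1 /andP[a0 ac] par ab L10 L1q szL1 U1 in1 cov1 [[sz2 U2] lt2 hd2 cov2] join.
pose xi := (c - a)./2; have xiE : 2 * xi + a = c by rewrite /xi; lia.
have [||s1 [[sz1 Us1] lt1 [hd1 la1] so1 cova]] := @alpha_exists (2 * c + 1) xi; [lia|lia|].
have lE : uphalf (2 * c + 1) = c.+1 by lia.
have oE : odd (2 * c + 1) by lia.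
rewrite lE oE in la1 so1.
pose f := stretch c.+1 a; pose o := 2 * c + a + 1.
pose C := walk (fun=> true) false (map f s1).
pose G := walk (fun d => d == a) e (map (addn o) s2).
have s10 : s1 <> [::] by move=> E; move: sz1; rewrite E /=; lia.
have s20 : s2 <> [::] by move=> E; move: sz2; rewrite E /=; lia.
have szC : size C = 2 * c + 1 by rewrite size_walk size_map.
have szP : (size (L1 ++ G)).+1 = 2 * p.
  by rewrite size_cat szL1 size_walk size_map sz2 /b; clear -ab; lia.
rewrite -szC -szP.
have fP z : z \in s1 -> (z <= c /\ f z = z) \/ (c < z <= 2 * c /\ f z = z + a).
  by move/lt1; rewrite /f /stretch; case: ifP => h zK; [left | right]; move: h; clear -zK; lia.
have NE : N = o + b by rewrite /N /o /b; move: ab; rewrite /b; clear; lia.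
have class0 s u v : adj s u v -> forall w z, (w, z) = (u, v) -> adj s w z by move=> A w z [-> ->].
have fxi z : z <= c -> f z = z by rewrite /f /stretch ltnS => ->.
have hC : head (0, false) C = (xi, false).
  rewrite head_walk; last by case: (s1) s10.
  case: (s1) s10 hd1 => //= w r _ ->; rewrite fxi //; move: xiE; clear; lia.
have CE : C = (xi, false) :: behead C.
  by move: hC szC; rewrite addn1; case: (C) => //= w r ->.
have lastC : last (xi, false) (behead C) = (c - xi, false).
  have : last (0, true) C = (c - xi, false).
    rewrite last_walk_true; last by case: (s1) s10.
    rewrite size_map sz1 oE; congr (_, _).
    have -> : last 0 (map f s1) = f (last 0 s1) by case: (s1) s10 => //= w r _; rewrite last_map.
    by rewrite la1 fxi; move: xiE; clear; lia.
  by rewrite {1}CE.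
apply: starter_family.
- by rewrite /N; lia.
- by rewrite -size_eq0; move: szP; clear -p1; case: (size _) => //; lia.
- rewrite !map_cat !map_walk.
  have Uf : uniq (map f s1) by rewrite (map_inj_uniq (@stretch_inj _ _)).
  have Ug : uniq (map (addn o) s2) by rewrite (map_inj_uniq (@addnI _)).
  rewrite !cat_uniq Uf U1 Ug andbT /=; apply/andP; split; apply/hasPn.
    move=> z; rewrite mem_cat => zin; apply/negP => /mapP[w /fP wP zE].
    case/orP: zin => [/mapP[u /in1 uP uE]|/mapP[u _ uE]]; move: wP zE; rewrite uE.
      by move: (f w) u.1 uP => fw u1; clear; lia.
    by rewrite /o; clear; lia.
  move=> _ /mapP[w _ ->]; apply/negP => /mapP[u /in1 uP]; rewrite /o; move: (u.1) uP => u1; clear; lia.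
- move=> u; rewrite !mem_cat => /or3P[/mem_walk/mapP[w /fP wP ->]|/in1 uP|/mem_walk/mapP[w /lt2 wP ->]].
  + by rewrite NE /o; move: wP; clear; lia.
  + by rewrite NE /o; move: uP; clear; lia.
  + by rewrite NE; move: wP; clear; lia.
move=> d dN; have [d1|d1] := ltnP d a.
  have [|u [v [cl A]]] := cov1 d; first by case/andP: dN => ->.
  by exists u, v; split=> //; apply/Or31/adj_catl.
have [d2|d2] := eqVneq d a.
  have [|u [v [A D]]] := cov2 a; first by rewrite a0.
  have [p' [q' [A' cl]]] := walk_class N (fun d => d == a) e (adj_shift o A).
  exists p', q'; split; last exact/Or31/adj_catr.
  by rewrite cl dist_shift D eqxx d2.
have [d3|d3] := leqP d (2 * c + a).
  have [|u [v [A D]]] := cova (d - a); first by move: d1 d2 d3; clear; lia.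
  have [p' [q' [A' cl]]] := walk_class N (fun=> true) false (adj_map f A).
  exists p', q'; split; last exact: Or32.
  by rewrite cl stretch_apart ?(adj_sorted so1 A) // D; move: d1; clear; lia.
have [d4|d4] := eqVneq d o.
  exists (q, e), (o + x, e); split.
    by rewrite /class /= addbb d4 /dist NE; move: join; rewrite -/o; clear; lia.
  apply: Or31; rewrite -L1q.
  have -> : (o + x, e) = head (0, false) G.
    by rewrite head_walk; [case: (s2) s20 hd2 => //= w r _ -> | case: (s2) s20].
  by apply: adj_cross => //; rewrite /G; case: (s2) s20.
have [d5|d5] := eqVneq (N - d) a.
  exists (c - xi, false), (xi, false); split; last by apply: Or33; exists (behead C).
  by rewrite /class /= /dist; move: d5 xiE dN; clear; lia.
have [|u [v [A D]]] := cov2 (N - d); first by rewrite NE /o in dN d4 *; move: dN d3 d4; clear; lia.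
have [p' [q' [A' cl]]] := walk_class N (fun d => d == a) e (adj_shift o A).
exists p', q'; split; last exact/Or31/adj_catr.
by rewrite cl dist_shift D (negPf d5); move: dN; clear; lia.
Qed.

(** The closing edge of the cycle has a length of the parity of [c], so that the gap
has one or two couples.  Two couples can be visited in two orders, and these lead
to different starts on the other side: one of them is not an exception of
[graceful_exists]. *)
Theorem odd_small c p (N := 2 * c + 2 * p) : 0 < c -> c + 3 <= 2 * p ->
  complete_family (@partner N) (2 * c + 1) (2 * p) (2 * N).
Proof.
move=> c0 cp; have [oc|ec] := boolP (odd c).
  have [|||s gs] := @graceful_exists (2 * p - 1 - 1) (2 * p - 1 - 1 - 1 - c); [lia|lia|lia|].
  apply: (@odd_inside c p 1 [:: (c.+1, false)] c.+1 false s _ _ _ _ _ _ _ _ _ _ _ gs) => //; try lia.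
  - by move=> u; rewrite inE => /eqP -> /=; lia.
pose b := 2 * p - 1 - 2.
have arc u v x : u + v = 2 * c + 3 -> v = c.+1 \/ v = c.+2 -> 2 * c + 3 + x = v + b ->
    b != 4 * x + 1 -> b != 4 * (b - 1 - x) + 1 ->
    complete_family (@partner N) (2 * c + 1) (2 * p) (2 * N).
  move=> uv vE join e1 e2; have [|||s gs] := @graceful_exists b x; [lia|lia|lia|].
  apply: (@odd_inside c p 2 [:: (u, false); (v, true)] v true s x _ _ _ _ _ _ _ _ _ _ gs) => //;
    try by rewrite /b in join *; lia.
  - by rewrite /= inE; lia.
  - by move=> w; rewrite !inE => /orP[]/eqP -> /=; lia.
  - move=> d d2; exists (u, false), (v, true); split; last by exists [::], [::].
    by rewrite /class /dist /=; lia.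
have [bad|ok] := boolP ((b == 4 * c + 1) || (b == 4 * (b - 1 - c) + 1)).
  by apply: (arc c.+2 c.+1 (b - 2 - c)); rewrite /b in bad *; lia.
by apply: (arc c.+1 c.+2 (b - 1 - c)); rewrite /b in ok *; lia.
Qed.

(** * The odd cycle around the even one *)

(** The cycle will take the couples below 2p.  On the others, the path consists of a
graceful path whose halves are pulled apart by [p], of a step of length 2p, and of a
graceful path on the [p] couples in the gap.  The label changes on the middle step
and on the step of length 1. *)
Lemma outer_path c p x y s1 s2 (N := 2 * c + 2 * p) (K := 2 * c - p) (l := uphalf K) :
    0 < p -> 3 * p + 1 <= 2 * c -> alpha K x s1 -> graceful p y s2 ->
    x < l -> l + y = x + 2 * p ->
  exists P, [/\ size P = 2 * c, uniq (map fst P), forall u, u \in P -> 2 * p <= u.1 < N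
    & forall d, [\/ 2 * p <= d < N - p, N - p < d < N.-1 | d = 1 /\ 1 < p] ->
        exists u v, class N u v = d /\ adj P u v].
Proof.
move=> p0 pc [[sz1 U1] lt1 [hd1 _] so1 cov1] [[sz2 U2] lt2 hd2 cov2] xl join.
have KE : K + p = 2 * c by rewrite /K; lia.
have NE : N = K + 3 * p by rewrite /N; lia.
have lK : l <= K by rewrite /l; lia.
pose f z := 2 * p + stretch l p z; pose o := 2 * p + l.
pose A := [seq (z, false) | z <- rev (map f s1)].
pose B := walk (fun d => d == 1) true (map (addn o) s2).
have s10 : s1 <> [::] by move=> E; move: sz1; rewrite E /=; lia.
have s20 : s2 <> [::] by move=> E; move: sz2; rewrite E /=; lia.
have A0 : A <> [::].
  by move=> /(congr1 size); rewrite !size_map size_rev size_map sz1 /=; move: KE pc p0; clear; lia.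
have B0 : B <> [::] by rewrite /B; case: (s2) s20.
have fP z : z \in s1 -> (z < l /\ f z = 2 * p + z) \/ (l <= z < K /\ f z = 3 * p + z).
  by move/lt1; rewrite /f /stretch; case: ifP => h zK; [left | right]; move: h; clear -zK; lia.
exists (A ++ B); split.
- by rewrite size_cat size_walk !size_map size_rev size_map sz1 sz2.
- rewrite map_cat map_walk -map_comp map_id_in //.
  rewrite cat_uniq rev_uniq map_inj_uniq ?U1 ?(map_inj_uniq (@addnI _)) ?U2 ?andbT /=; last first.
    by move=> u v /addnI/stretch_inj.
  apply/hasPn=> _ /mapP[w /lt2 wp ->]; rewrite mem_rev; apply/negP => /mapP[z /fP zP].
  by rewrite /o; move: (f z) zP => fz; move: wp lK; clear; lia.
- move=> u; rewrite mem_cat => /orP[/mapP[z + ->]|/mem_walk/mapP[w /lt2 wp ->]].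
    rewrite mem_rev => /mapP[w /fP wP ->] /=.
    by move: (f w) wP => fw; rewrite NE; move: lK; clear; lia.
  by rewrite NE /o; move: wp lK; clear; lia.
have inner d : 0 < d < p -> exists u v, class N u v = (if d == 1 then d else N - d) /\ adj B u v.
  move=> /cov2[u [v [uv D]]].
  have [p' [q' [A' cl]]] := walk_class N (fun d => d == 1) true (adj_shift o uv).
  by exists p', q'; split=> //; rewrite cl dist_shift D.
move=> d H; have [d2|d2] := eqVneq d (2 * p).
  exists (f x, false), (o + y, true); split.
    by rewrite /class /= /f /stretch xl d2 /o /dist; move: join; clear; lia.
  have -> : (f x, false) = last (0, false) A.
    rewrite /A last_map; congr (_, _); rewrite last_of_rev.
    by case: (s1) s10 hd1 => //= a r _ ->.
  have -> : (o + y, true) = head (0, false) B.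
    by rewrite head_walk; [case: (s2) s20 hd2 => //= a r _ -> | case: (s2) s20].
  exact: adj_cross.
case: H => [dH|dH|[-> p1]].
- have [|u [v [uv D]]] := cov1 (N - d - p).
    by move: dH d2; rewrite NE; move: KE pc p0; clear; lia.
  exists (f v, false), (f u, false); split; last first.
    by apply: adj_catl; apply: (adj_map (fun z => (z, false))); apply/adj_rev/adj_map.
  rewrite /class /= /f dist_shift distC stretch_apart ?(adj_sorted so1 uv) // D.
  by move: dH d2; rewrite NE; move: KE pc p0; clear; lia.
- have [|u [v [cl uv]]] := inner (N - d); first by move: dH; rewrite NE; clear; lia.
  exists u, v; split; last exact: adj_catr.
  by rewrite cl ifF; move: dH; rewrite NE; clear; lia.
have [|u [v [cl uv]]] := inner 1; first by rewrite p1.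
by exists u, v; split; last exact: adj_catr.
Qed.

(** The inner path starts at its upper end, unless the outer path would be an
exception of [alpha_exists]; then it starts at its lower end. *)
Lemma outer_path_exists c p (N := 2 * c + 2 * p) :
    0 < p -> 3 * p + 1 <= 2 * c -> (p = 1 -> c != 3) ->
  exists P, [/\ size P = 2 * c, uniq (map fst P), forall u, u \in P -> 2 * p <= u.1 < N
    & forall d, [\/ 2 * p <= d < N - p, N - p < d < N.-1 | d = 1 /\ 1 < p] ->
        exists u v, class N u v = d /\ adj P u v].
Proof.
move=> p0 pc sp; pose K := 2 * c - p; pose l := uphalf K.
have [E|ne] := eqVneq K (4 * p + 1).
  have p1 : 1 < p by move: E sp; rewrite /K; lia.
  have [||s1 a1] := @alpha_exists K 1; [by rewrite /K; lia | by rewrite E; lia |].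
  have [|||s2 g2] := @graceful_exists p 0; [lia|lia|lia|].
  by apply: (outer_path p0 pc a1 g2); move: E; rewrite /K; lia.
have [||s1 a1] := @alpha_exists K (l - p - 1).
- by rewrite /l /K; lia.
- by move: ne; rewrite /l /K; lia.
have [|||s2 g2] := @graceful_exists p (p - 1); [lia|lia|lia|].
by apply: (outer_path p0 pc a1 g2); rewrite -/K -/l /l /K; lia.
Qed.

(** The even cycle is a fan on the couples below 2p, closed by an edge of length p.
The label changes except on the closing edge and on the step of length 1.  This
gives the classes 2, ..., 2p - 1, N - p and N - 1, which the outer path leaves
open. *)
Theorem odd_large c p (N := 2 * c + 2 * p) : 1 < p -> 3 * p + 1 <= 2 * c ->
  complete_family (@partner N) (2 * p) (2 * c + 1) (2 * N).
Proof.
move=> p1 pc; have [||| P [szP UP inP covP]] := @outer_path_exists c p; [lia|lia|lia|].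
rewrite -/N in inP covP.
have pE : p = p.-1.+1 by lia.
have [|[_ UF] ltF _ _ _] := @alpha_fan (2 * p) p.-1; first by right; lia.
pose T := map (fan p.-1) (iota 1 (2 * p - 1)).
pose C := (p.-1, false) :: walk (fun=> true) false T.
have FE : mkseq (fan p.-1) (2 * p) = p.-1 :: T.
  rewrite /mkseq (_ : 2 * p = (2 * p - 1).+1) /=; last lia.
  by congr (_ :: _); rewrite /fan /= subn0.
rewrite FE in UF ltF.
have szC : size C = 2 * p by rewrite /= size_walk size_map size_iota; lia.
have T0 : T <> [::] by move/(congr1 size); rewrite size_map size_iota /=; lia.
rewrite -szC (_ : 2 * c + 1 = (size P).+1); last by rewrite szP addn1.
have CE : map fst C = p.-1 :: T by rewrite /= map_walk.
have inT u : u \in C -> u.1 < 2 * p.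
  by move/(map_f fst); rewrite CE => /ltF.
apply: starter_family.
- by rewrite /N; lia.
- by rewrite -size_eq0 szP; lia.
- rewrite map_cat CE cat_uniq UF UP andbT /=.
  apply/hasPn=> _ /mapP[u /inP uP ->]; apply/negP => /ltF.
  by move: (u.1) uP => u1; clear; lia.
- move=> u; rewrite mem_cat => /orP[/inT|/inP]; last by case/andP.
  by rewrite /N; move: (u.1) => u1; clear; lia.
have fan_step d : 1 < d < 2 * p -> exists u v, class N u v = d /\ adj C u v.
  move=> dp; have A : adj T (fan p.-1 d.-1) (fan p.-1 d).
    have dE : 2 * p - 1 = (d - 2) + (2 + (2 * p - d - 1)) by lia.
    rewrite /T dE !iotaD !map_cat.
    exists (map (fan p.-1) (iota 1 (d - 2))), (map (fan p.-1) (iota d.+1 (2 * p - d - 1))).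
    have -> : 1 + (d - 2) = d.-1 by lia.
    have d1 : d.-1.+1 = d by lia.
    by rewrite /= d1 (_ : d.-1 + 2 = d.+1) //; lia.
  have [u [v [A' cl]]] := walk_class N (fun=> true) false A.
  exists u, v; split; last exact: adj_cons.
  by rewrite cl /dist /fan; case: ifP => o1; case: ifP => o2; move: dp o1 o2; clear; lia.
have TE : exists T', T = p :: T'.
  rewrite /T (_ : 2 * p - 1 = (2 * p - 2).+1) /=; last lia.
  by exists (map (fan p.-1) (iota 2 (2 * p - 2))); congr (_ :: _); rewrite /fan /=; lia.
move=> d dN.
have [d1|d1] := eqVneq d 1.
  have [|u [v [cl A]]] := covP d; first by apply: Or33.
  by exists u, v; split=> //; apply: Or31.
have [d2|d2] := ltnP d (2 * p).
  have [|u [v [cl A]]] := fan_step d; first by move: dN d1 d2; clear; lia.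
  by exists u, v; split=> //; apply: Or32.
have [d3|d3] := eqVneq d N.-1.
  exists (p.-1, false), (p, false); split.
    by rewrite /class /= /dist d3; move: dN pE; rewrite /N; clear; lia.
  apply: Or32; rewrite /C; have [T' ->] := TE.
  by exists [::]; eexists; rewrite /=.
have [d4|d4] := eqVneq d (N - p).
  have lC : last (p.-1, false) (walk (fun=> true) false T) = (2 * p - 1, false).
    rewrite last_walk_true // size_map size_iota; congr (_, _); last by lia.
    rewrite /T (_ : 2 * p - 1 = (2 * p - 2) + 1); last lia.
    by rewrite iotaD map_cat last_cat /= /fan; case: ifP => o; move: o pE p1; clear; lia.
  exists (2 * p - 1, false), (p.-1, false); split; last first.
    by apply: Or33; exists (walk (fun=> true) false T).
  by rewrite /class /= /dist d4; move: pE p1; rewrite /N; clear; lia.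
have [|u [v [cl A]]] := covP d; last by exists u, v; split=> //; apply: Or31.
by have [?|?] := ltnP d (N - p); [apply: Or31 | apply: Or32]; lia.
Qed.

Theorem odd_digon c (N := 2 * c + 2) : 1 < c -> c != 3 ->
  complete_family (@partner N) 2 (2 * c + 1) (2 * N).
Proof.
move=> c1 c3; have [|||P [szP UP inP covP]] := @outer_path_exists c 1; [lia|lia|by []|].
rewrite muln1 -/N in inP covP.
rewrite (_ : 2 * c + 1 = (size P).+1); last by rewrite szP addn1.
apply: digon_family => //.
- by rewrite /N; lia.
- by rewrite /N; lia.
- by rewrite -size_eq0 szP; lia.
by move=> d dN; apply: covP; apply: Or31; lia.
Qed.

(** * The case of odd m *)

Lemma complete_family_swap (V : finType) (sp : V -> V) m1 m2 N :
  complete_family sp m1 m2 N -> complete_family sp m2 m1 N.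
Proof.
case=> Fs [sz ok cov]; exists [seq (F.2, F.1) | F <- Fs]; split.
- by rewrite size_map.
- by rewrite all_map; apply: sub_all ok => F; apply: seats_swap.
- by move=> u v vu vpu; rewrite has_map; apply: sub_has (cov u v vu vpu) => F; rewrite /meets orbC.
Qed.

Lemma partner_family x y : (x, y) <> (0, 0) -> let N := 2 * x.+1 + 2 * y.+1 in
  complete_family (@partner N) (2 * x + 3) (2 * y.+1) (2 * N).
Proof.
move=> xy N; rewrite {}/N (_ : 2 * x + 3 = 2 * x.+1 + 1); last lia.
have [y0|y0] := posnP y.
  rewrite y0 in xy *; have x0 : x <> 0 by move=> E; apply: xy; rewrite E.
  have [->|ne] := eqVneq x.+1 3; first exact: complete_family_swap digon_2_7.
  by apply: complete_family_swap; apply: odd_digon; lia.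
have [lt|ge] := leqP (x.+1 + 3) (2 * y.+1); first exact: odd_small.
have [big|small] := leqP (3 * y.+1 + 1) (2 * x.+1).
  by apply: complete_family_swap; apply: odd_large.
have [[-> ->]|[[-> ->]|[[-> ->]|[-> ->]]]] : x = 1 /\ y = 1 \/ x = 2 /\ y = 1 \/
    x = 3 /\ y = 2 \/ x = 5 /\ y = 3 by lia.
- exact: starter_5_4.
- exact: starter_7_4.
- exact: starter_9_6.
- exact: starter_13_8.
Qed.

Lemma spanning_family x y (m := 2 * (x + y) + 5) :
  complete_family (@spouse 'Z_m) (2 * x + 3) (2 * y.+1) (2 * m.-1).
Proof.
have [[x0 y0]|ne] := eqVneq (x, y) (0, 0); first by rewrite /m x0 y0; exact: explicit_3_2.
have N0 : 0 < 2 * x.+1 + 2 * y.+1 by lia.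
have mE : m = (2 * x.+1 + 2 * y.+1).+1 by rewrite /m; lia.
have cardm : #|{: 'Z_m * bool}| = 2 * m.
  by rewrite card_prod card_bool card_ord Zp_cast 1?mulnC // mE; lia.
have {1}-> : 2 * m.-1 = 2 * (2 * x.+1 + 2 * y.+1) by rewrite mE.
apply: (family_transport (partnerK N0) (partner_neq N0) (n := m) _
  (@spouseK 'Z_m) (@spouse_neq 'Z_m) cardm).
  by rewrite card_points // mE.
by apply: partner_family; apply/eqP.
Qed.

Theorem odd_case s m1 m2 k : 1 < m1 -> 1 < m2 -> odd (m1 + m2) ->
  s + (m1 + m2) = (m1 + m2) * (2 * k + 1) -> HOP_solvable s [:: m1; m2].
Proof.
move=> h1 h2 om sE.
have both x y : s + (2 * x + 3 + 2 * y.+1) = (2 * x + 3 + 2 * y.+1) * (2 * k + 1) ->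
    HOP_solvable s [:: 2 * x + 3; 2 * y.+1] /\ HOP_solvable s [:: 2 * y.+1; 2 * x + 3].
  set m := 2 * (x + y) + 5; rewrite (_ : 2 * x + 3 + 2 * y.+1 = m); last by rewrite /m; lia.
  have fam := spanning_family x y; move=> E.
  have [k0|k0] := posnP k; last exact: (@multipartite_solution s m k x y erefl k0 E fam).
  have s0 : s = 0 by move: E; rewrite k0; lia.
  have mE : 2 * x + 3 + 2 * y.+1 = m by rewrite /m; lia.
  case: fam => Fs [sz ok cov].
  apply: (family_solves_both (s := s) (@spouseK 'Z_m) (@spouse_neq 'Z_m) _ _ _ _ ok cov).
  - have cardZ : #|'Z_m| = m by rewrite card_ord Zp_cast // /m; lia.
    by rewrite s0 mE card_prod card_bool cardZ mulnC.
  - by lia.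
  - by lia.
  - by rewrite sz mE s0 /=; lia.
have [o1|e1] := boolP (odd m1).
  have m1E : m1 = 2 * (m1 - 3)./2 + 3 by lia.
  have m2E : m2 = 2 * (m2./2.-1).+1 by lia.
  by rewrite m1E m2E in sE *; case: (both _ _ sE).
have m2E : m2 = 2 * (m2 - 3)./2 + 3 by lia.
have m1E : m1 = 2 * (m1./2.-1).+1 by lia.
by rewrite m1E m2E [X in s + X]addnC [X in _ = X * _]addnC in sE *; case: (both _ _ sE).
Qed.

Theorem theorem1p1 (s m1 m2 m n : nat)
    (hm1 : 2 <= m1) (hm12 : m1 <= m2)
    (hm : m = m1 + m2) (hn : n = s + m) :
  (n = 1 %[mod 2 * m] -> HOP_solvable s [:: m1; m2]) /\
  (odd m -> n = m %[mod 2 * m] -> HOP_solvable s [:: m1; m2]).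
Proof.
have hm2 : 2 <= m2 by apply: leq_trans hm12.
split=> [n1 | om nm].
  have nE := divn_eq n (2 * m); rewrite n1 modn_small in nE; last by lia.
  apply: (@cyclic_case s m1 m2 (n %/ (2 * m))) => //; last by lia.
  by rewrite lt0n; apply/negP => /eqP q0; rewrite q0 in nE; lia.
have nE := divn_eq n (2 * m); rewrite nm modn_small in nE; last by lia.
by apply: (@odd_case s m1 m2 (n %/ (2 * m))) => //; [rewrite -hm | lia].
Qed.
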